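(* Let $n\ge2$, $k\in\{1,\dots,n-1\}$, and let $b=(B_{ij},L)$ be a $k$-rectangle. Then for every $i\in\mathbb Z/n\mathbb Z$: (1) $\widehat\gamma_i(b)=\widetilde\gamma_i(b)$; (2) $\widehat\varphi_i(b)=-\widetilde\varphi_i(b)$ and $\widehat\varepsilon_i(b)=-\widetilde\varepsilon_i(b)$; (3) $\widetilde e_i(b)$ is defined if and only if $\widehat f(\widehat e_i(1,b))\ge0$, and in that case $\widehat e_i(1,b)=\widetilde e_i(b)$; (4) $\widetilde f_i(b)$ is defined if and only if $\widehat f(\widehat e_i(-1,b))\ge0$, and in that case $\widehat e_i(-1,b)=\widetilde f_i(b)$.
   Context: Notation: $[i,j]=\{m\in\mathbb Z:i\le m\le j\}$, $[n]=[1,n]$; $E_{ij}$ are $n\times n$ matrix units. Let $r=n-k$. Points of $\mathrm{Gr}(r,n)$ are column spans of full-rank $n\times r$ matrices; $P_J(M)$ is the maximal minor on the rows $J$ (increasing order). Conventions: for a finite set $I$ of integers, $P_I(M)=P_{I'}(M)$ with $I'$ the set of residues mod $n$ in $[n]$, and $P_{I'}(M)=0$ if $|I'|\ne r$. Geometric crystal on $\mathcal X_r=\mathrm{Gr}(r,n)\times\mathbb C^\times$ (for $i\in\mathbb Z/n\mathbb Z$ represented in $\{0,\dots,n-1\}$; $\delta_{i,a}=1$ iff $i\equiv a$ mod $n$): $\gamma=(\gamma_1,\dots,\gamma_n)$ with $\gamma_i=P_{[i-r+1,i]}/P_{[i-r,i-1]}$ for $i\le r$ and $\gamma_i=t\,P_{[i-r+1,i]}/P_{[i-r,i-1]}$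 for $i>r$; $\varphi_i=t^{-\delta_{i,0}}P_{[i-r+1,i-1]\cup\{i+1\}}/P_{[i-r+1,i]}$; $\varepsilon_i=t^{-\delta_{i,r}}\frac{P_{[i-r+1,i-1]\cup\{i+1\}}P_{[i-r+1,i]}}{P_{[i-r,i-1]}P_{[i-r+2,i+1]}}$; $e_i^c(M,t)=(x_i(\frac{c-1}{\varphi_i(M,t)})\cdot M,t)$ for $i\ne0$ and $e_0^c(M,t)=(x_0(\frac{(-1)^{r-1}}{t}\frac{c-1}{\varphi_0(M,t)})\cdot M,t)$, with $x_i(a)=\mathrm{Id}+aE_{i,i+1}$, $x_0(a)=\mathrm{Id}+aE_{n1}$ acting by left multiplication; decoration $f(M,t)=\sum_{i\in[n],i\ne r}\frac{P_{\{i-r\}\cup[i-r+2,i]}}{P_{[i-r+1,i]}}+t\frac{P_{[2,r]\cup\{n\}}}{P_{[1,r]}}$. Parametrization: $R_k=\{(i,j):1\le i\le k,\ i\le j\le i+n-k-1\}$, $\mathbb T_k=(\mathbb C^\times)^{R_k}\times\mathbb C^\times$ with points $(X_{ij},t)$. With $x_{-i}(c)=cE_{ii}+c^{-1}E_{i+1,i+1}+E_{i+1,i}+\sum_{j\ne i,i+1}E_{jj}$, $t_i(c)=cE_{ii}+\sum_{j\ne i}E_{jj}$, $M_{[i,j]}(c_i,\dots,c_j)=x_{-i}(c_i)\cdots x_{-(j-1)}(c_{j-1})t_j(c_j)$, let $\Phi_k(X_{ij},t)=\prod_{i=k}^1M_{[i,i+n-k]}(X_{ii},\dots,X_{i,i+n-k-1},t)$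 (decreasing $i$ left to right) and $\Theta_{n-k}(X_{ij},t)=(M,t)$ with $M$ the span of the first $n-k$ columns of $\Phi_k(X_{ij},t)$; this is birational $\mathbb T_k\to\mathcal X_{n-k}$. Tropicalization $\mathrm{Trop}$ of a subtraction-free rational function (ratio of polynomials with nonnegative integer coefficients): replace $+,\times,\div$ by $\min,+,-$ and positive constants by $0$; $X_{ij}\mapsto B_{ij}$, $t\mapsto L$, $c\mapsto m$. The functions $\gamma\circ\Theta_{n-k}$, $\varphi_i\circ\Theta_{n-k}$, $\varepsilon_i\circ\Theta_{n-k}$, $f\circ\Theta_{n-k}$ and $\Theta_{n-k}^{-1}\circ e_i^c\circ\Theta_{n-k}$ (as functions of $(X_{ij},t)$ and $c$) are subtraction-free; set $\widehat\gamma=\mathrm{Trop}(\gamma\circ\Theta_{n-k})$ with components $\widehat\gamma_i$, $\widehat\varphi_i=\mathrm{Trop}(\varphi_i\circ\Theta_{n-k})$, $\widehat\varepsilon_i=\mathrm{Trop}(\varepsilon_i\circ\Theta_{n-k})$, $\widehat f=\mathrm{Trop}(f\circ\Theta_{n-k})$, and $\widehat e_i(m,b)=\mathrm{Trop}(\Theta_{n-k}^{-1}\circ e_i^c\circ\Theta_{n-k})(m,b)$ for $m\in\mathbb Z$, $b\in\widetilde{\mathbb T}_k=\mathbb Z^{R_k}\times\mathbb Z$. $k$-rectangles: $b=(B_{ij},L)\in\widetilde{\mathbb T}_k$; array $A_{ij}=B_{ij}$ on $R_k$, $A_{ij}=L$ for $j>i+n-k-1$; $b$ is a $k$-rectangle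 if all $A_{ij}\ge0$ and $A_{i,j+1}\ge A_{ij}\ge A_{i+1,j+1}$ for $1\le i\le j\le n-1$. These correspond bijectively to semistandard tableaux $T$ of rectangular shape with $k$ rows and $L$ columns, entries in $[n]$, via $B_{ij}$ = number of entries $\le j$ in row $i$ of $T$. Combinatorial crystal on such tableaux: $\widetilde\gamma_i(T)$ = number of entries equal to $i$. For $i\in[n-1]$: form the reading word of $T$ (rows concatenated, bottom row first, each row left to right), delete letters other than $i,i+1$, then repeatedly delete adjacent pairs ''$i+1$ followed by $i$'' until the remaining word is $i^\alpha(i+1)^\beta$. Set $\widetilde\varepsilon_i(T)=\beta$, $\widetilde\varphi_i(T)=\alpha$; $\widetilde e_i(T)$ is undefined if $\beta=0$ and otherwise changes the leftmost remaining $i+1$ into $i$; $\widetilde f_i(T)$ is undefined if $\alpha=0$ and otherwise changes the rightmost remaining $i$ into $i+1$. Promotion $\widetilde{\mathrm{pr}}=\widetilde\sigma_1\cdots\widetilde\sigma_{n-1}$, where the Bender–Knuth involution $\widetilde\sigma_r$ replaces, in each row, the consecutive subword $r^\alpha(r+1)^\beta$ formed by the $r$'s not directly above an $r+1$ and the $(r+1)$'s not directly below an $r$ by $r^\beta(r+1)^\alpha$. For $i=0$: $\widetilde\varepsilon_0=\widetilde\varepsilon_1\circ\widetilde{\mathrm{pr}}$, $\widetilde\varphi_0=\widetilde\varphi_1\circ\widetilde{\mathrm{pr}}$, $\widetilde e_0=\widetilde{\mathrm{pr}}^{-1}\circ\widetilde e_1\circ\widetilde{\mathrm{pr}}$, $\widetilde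 f_0=\widetilde{\mathrm{pr}}^{-1}\circ\widetilde f_1\circ\widetilde{\mathrm{pr}}$ (undefined when the inner operator is). All of these are transported to $k$-rectangles. *)

(* Defs.v *)
From mathcomp Require Import all_boot all_order all_algebra.
From mathcomp Require Import boolp classical_sets reals.
From mathcomp Require Import complex.
From mathcomp Require mpoly.

Set Implicit Arguments.
Unset Strict Implicit.
Unset Printing Implicit Defensive.

Import Order.TTheory GRing.Theory Num.Theory.

Local Open Scope ring_scope.

(* Rows and columns are numbered from 1 in the mathematics and from 0 by the
   ordinals: row a : 'I_n of a matrix is row number a.+1.  A class in Z/nZ is
   given by its representative i : 'I_n in {0, ..., n-1}. *)

Definition zitv (a b : int) : seq int :=
  [seq a + l%:Z | l <- iota 0 (absz (Num.max 0 (b - a + 1)))].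

Definition rep1n (n i : nat) : nat := if i == 0%N then n else i.

Section Grassmannian.
Variables (C : fieldType) (n r : nat).

(* I', the set of residues of I modulo n *)
Definition residues (I : seq int) : {set 'I_n} :=
  [set j : 'I_n | has (fun m => (m == j.+1%:Z %[mod n%:Z])%Z) I].

(* enum_val lists the elements of a set of ordinals in increasing order *)
Definition minor (J : {set 'I_n}) (M : 'M[C]_(n, r)) : C :=
  if #|J| =P r is ReflectT e then
    \det (\matrix_(a < r, b < r) M (enum_val (cast_ord (esym e) a)) b)
  else 0.

Definition plucker (I : seq int) (M : 'M[C]_(n, r)) : C := minor (residues I) M.

(* A point of Gr(r,n) x C^* is given by a matrix of rank r, up to equality of
   column spans, and a nonzero scalar. *)
Definition Xpoint : Type := ('M[C]_(n, r) * C)%type.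

Definition same_Xpoint (p q : Xpoint) : Prop :=
  (p.1^T == q.1^T)%MS /\ p.2 = q.2.

Definition gamma (i : nat) (p : Xpoint) : C :=
  let: (M, t) := p in
  let l := rep1n n i in
  (if (l <= r)%N then 1 else t)
  * plucker (zitv (l%:Z - r%:Z + 1) l%:Z) M / plucker (zitv (l%:Z - r%:Z) (l%:Z - 1)) M.

Definition phi (i : nat) (p : Xpoint) : C :=
  let: (M, t) := p in
  t ^- (i == 0%N)
  * plucker (zitv (i%:Z - r%:Z + 1) (i%:Z - 1) ++ [:: i%:Z + 1]) M
  / plucker (zitv (i%:Z - r%:Z + 1) i%:Z) M.

Definition epsilon (i : nat) (p : Xpoint) : C :=
  let: (M, t) := p in
  t ^- (i == r)
  * (plucker (zitv (i%:Z - r%:Z + 1) (i%:Z - 1) ++ [:: i%:Z + 1]) M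
     * plucker (zitv (i%:Z - r%:Z + 1) i%:Z) M)
  / (plucker (zitv (i%:Z - r%:Z) (i%:Z - 1)) M
     * plucker (zitv (i%:Z - r%:Z + 2) (i%:Z + 1)) M).

Definition decoration (p : Xpoint) : C :=
  let: (M, t) := p in
  \sum_(1 <= i < n.+1 | i != r)
     plucker ((i%:Z - r%:Z) :: zitv (i%:Z - r%:Z + 2) i%:Z) M
     / plucker (zitv (i%:Z - r%:Z + 1) i%:Z) M
  + t * (plucker (zitv 2 r%:Z ++ [:: n%:Z]) M / plucker (zitv 1 r%:Z) M).

(* the matrix unit E_ij, with i and j in {1, ..., n} *)
Definition Emx (i j : nat) : 'M[C]_n :=
  \matrix_(a, b) ((a.+1 == i) && (b.+1 == j))%:R.

Definition xmx (i : nat) (a : C) : 'M[C]_n :=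
  1%:M + a *: (if i == 0%N then Emx n 1 else Emx i i.+1).

Definition ecrystal (i : nat) (c : C) (p : Xpoint) : Xpoint :=
  let: (M, t) := p in
  let a := (if i == 0%N then (-1) ^+ r.-1 / t else 1) * ((c - 1) / phi i p) in
  (xmx i a *m M, t).

(* x_{-i}(c) *)
Definition xneg (i : nat) (c : C) : 'M[C]_n :=
  c *: Emx i i + c^-1 *: Emx i.+1 i.+1 + Emx i.+1 i
  + \sum_(1 <= j < n.+1 | j \notin [:: i; i.+1]) Emx j j.

Definition tmx (i : nat) (c : C) : 'M[C]_n :=
  c *: Emx i i + \sum_(1 <= j < n.+1 | j != i) Emx j j.

End Grassmannian.

(* The coordinates on T_k: Some (a, s) is the index (i, j) = (a + 1, a + 1 + s)
   of R_k, and None is the coordinate t (or L). *)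
Definition coordk (n k : nat) : finType := option ('I_k * 'I_(n - k)).

Section Parametrization.
Variables (C : fieldType) (n k : nat).

(* M_{[i,i+n-k]}(X_ii, ..., X_{i,i+n-k-1}, t), where i = a + 1 *)
Definition Mseg (x : {ffun coordk n k -> C}) (a : 'I_k) : 'M[C]_n :=
  (\prod_(s < n - k) xneg n (a.+1 + s) (x (Some (a, s))))
  *m tmx n (a.+1 + (n - k)) (x None).

Definition Phi (x : {ffun coordk n k -> C}) : 'M[C]_n :=
  \prod_(a < k) Mseg x (rev_ord a).

Definition Theta (x : {ffun coordk n k -> C}) : Xpoint C n (n - k) :=
  (colsub (widen_ord (leq_subr k n)) (Phi x), x None).

Definition in_torus (V : finType) (x : {ffun V -> C}) : Prop :=
  forall v, x v != 0.

(* The inverse of the birational map Theta: Theta is injective on a dense open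
   set, so this determines the inverse as a rational map. *)
Definition Theta_inv (p : Xpoint C n (n - k)) : {ffun coordk n k -> C} :=
  xget [ffun=> 0] [set x | in_torus x /\ same_Xpoint (Theta x) p]%classic.

(* Theta^-1 \o e_i^c \o Theta, as a function of X_ij, t and c, the coordinate
   c being None. *)
Definition e_torus (i : nat) (y : {ffun option (coordk n k) -> C}) :
    {ffun coordk n k -> C} :=
  Theta_inv (ecrystal i (y None) (Theta [ffun v => y (Some v)])).

End Parametrization.

Section Tropicalization.
Import mpoly.

Definition nonneg_poly (m : nat) (p : {mpoly int[m]}) : Prop :=
  forall u, 0 <= p@_u.

(* The value at w of the tropicalization of a nonzero polynomial with
   nonnegative coefficients. *)
Definition trop_poly (V : finType) (p : {mpoly int[#|V|]}) (w : {ffun V -> int}) : int :=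
  let vals := [seq \sum_(a < #|V|) w (enum_val a) *+ u a | u : 'X_{1..#|V|} <- msupp p] in
  \big[Num.min/head 0 vals]_(z <- vals) z.

Section Complex.
Variables (R : realType) (V : finType).
Local Notation C := (R[i]).

Definition evalC (p : {mpoly int[#|V|]}) (x : {ffun V -> C}) : C :=
  (map_mpoly intr p).@[fun a => x (enum_val a)].

(* F = p / q as rational functions on the torus (C^* )^V, that is, on the
   complement of a proper closed subset. *)
Definition is_ratio (F : {ffun V -> C} -> C) (p q : {mpoly int[#|V|]}) : Prop :=
  exists2 g : {mpoly C[#|V|]}, g != 0 &
    forall x : {ffun V -> C}, in_torus x ->
      g.@[fun a => x (enum_val a)] != 0 -> F x = evalC p x / evalC q x.

Definition subtraction_free_form (F : {ffun V -> C} -> C)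
    (pq : {mpoly int[#|V|]} * {mpoly int[#|V|]}) : Prop :=
  [/\ pq.1 != 0, pq.2 != 0, nonneg_poly pq.1, nonneg_poly pq.2
    & is_ratio F pq.1 pq.2].

(* The value at w does not depend on the choice of the subtraction-free form. *)
Definition Trop (F : {ffun V -> C} -> C) (w : {ffun V -> int}) : int :=
  let pq := xget (0, 0) [set pq | subtraction_free_form F pq]%classic in
  trop_poly pq.1 w - trop_poly pq.2 w.

End Complex.
End Tropicalization.

Section Hats.
Variables (R : realType) (n k : nat).
Local Notation C := (R[i]).

Definition gamma_hat (i : nat) : {ffun coordk n k -> int} -> int :=
  Trop (fun x : {ffun coordk n k -> C} => gamma i (Theta x)).

Definition phi_hat (i : nat) : {ffun coordk n k -> int} -> int :=
  Trop (fun x : {ffun coordk n k -> C} => phi i (Theta x)).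

Definition epsilon_hat (i : nat) : {ffun coordk n k -> int} -> int :=
  Trop (fun x : {ffun coordk n k -> C} => epsilon i (Theta x)).

Definition f_hat : {ffun coordk n k -> int} -> int :=
  Trop (fun x : {ffun coordk n k -> C} => decoration (Theta x)).

Definition e_hat (i : nat) (m : int) (b : {ffun coordk n k -> int}) :
    {ffun coordk n k -> int} :=
  [ffun v => Trop (fun y : {ffun option (coordk n k) -> C} => e_torus i y v)
                  [ffun u => if u is Some u' then b u' else m]].

End Hats.

(* Tableaux are given by the list of their rows, from top to bottom. *)
Definition tableau : Type := seq (seq nat).

Section Tableaux.
Implicit Types (T : tableau) (w : seq nat).
Local Open Scope nat_scope.

Definition reading_word T : seq nat := flatten (rev T).

(* inverse of reading_word, the shape being that of T *)
Definition with_reading_word T w : tableau := rev (reshape (shape (rev T)) w).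

(* pairs (position, letter) *)
Fixpoint delete_pair (i : nat) (s : seq (nat * nat)) : seq (nat * nat) :=
  if s is x :: s1 then
    if s1 is y :: s2 then
      if (x.2 == i.+1) && (y.2 == i) then s2 else x :: delete_pair i s1
    else s
  else s.

Definition reduced_word (i : nat) w : seq (nat * nat) :=
  let s := [seq x <- zip (iota 0 (size w)) w | (x.2 == i) || (x.2 == i.+1)] in
  iter (size s) (delete_pair i) s.

(* positions of the letter l in the reduced word, in increasing order *)
Definition remaining (i l : nat) w : seq nat :=
  [seq x.1 | x <- reduced_word i w & x.2 == l].

Definition content_tab (l : nat) T : nat := count_mem l (flatten T).

Definition eps_tab (i : nat) T : nat := size (remaining i i.+1 (reading_word T)).

Definition phi_tab (i : nat) T : nat := size (remaining i i (reading_word T)).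

Definition e_tab (i : nat) T : option tableau :=
  let w := reading_word T in
  if remaining i i.+1 w is p :: _ then
    Some (with_reading_word T (set_nth 0 w p i))
  else None.

Definition f_tab (i : nat) T : option tableau :=
  let w := reading_word T in
  if rev (remaining i i w) is p :: _ then
    Some (with_reading_word T (set_nth 0 w p i.+1))
  else None.

(* The Bender-Knuth involution on the row x between the rows u and l; missing
   entries are read as 0, which is not a letter. *)
Definition bk_free (r : nat) (u x l : seq nat) (c : nat) : bool :=
  ((nth 0 x c == r) && (nth 0 l c != r.+1))
  || ((nth 0 x c == r.+1) && (nth 0 u c != r)).

Definition bk_row (r : nat) (u x l : seq nat) : seq nat :=
  let beta := count (fun c => bk_free r u x l c && (nth 0 x c == r.+1))
                    (iota 0 (size x)) in
  mkseq (fun c => if bk_free r u x l c then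
                    if count (bk_free r u x l) (iota 0 c) < beta then r else r.+1
                  else nth 0 x c) (size x).

Definition bender_knuth (r : nat) T : tableau :=
  mkseq (fun a => bk_row r (nth [::] ([::] :: T) a) (nth [::] T a) (nth [::] T a.+1))
        (size T).

Definition promotion (n : nat) T : tableau := foldr bender_knuth T (iota 1 n.-1).

(* sigma_{n-1} ... sigma_1, which is the inverse of sigma_1 ... sigma_{n-1}
   because the sigma_r are involutions *)
Definition promotion_inv (n : nat) T : tableau :=
  foldr bender_knuth T (rev (iota 1 n.-1)).

Definition eps_tilde_tab (n i : nat) T : nat :=
  if i == 0 then eps_tab 1 (promotion n T) else eps_tab i T.

Definition phi_tilde_tab (n i : nat) T : nat :=
  if i == 0 then phi_tab 1 (promotion n T) else phi_tab i T.

Definition e_tilde_tab (n i : nat) T : option tableau :=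
  if i == 0 then omap (promotion_inv n) (e_tab 1 (promotion n T)) else e_tab i T.

Definition f_tilde_tab (n i : nat) T : option tableau :=
  if i == 0 then omap (promotion_inv n) (f_tab 1 (promotion n T)) else f_tab i T.

End Tableaux.

Section Rectangles.
Variables (n k : nat).
Implicit Types (b : {ffun coordk n k -> int}).

(* The array A_ij in row i = a + 1, for j in {1, ..., n}; for j < i, where A_ij
   is not part of the array, it is 0, the number of entries <= j in row i of a
   semistandard tableau. *)
Definition Aij b (a : 'I_k) (j : nat) : int :=
  if (j <= a)%N then 0
  else if insub (j - a.+1)%N is Some s then b (Some (a, s)) else b None.

(* Only inequalities between entries in the rows 1, ..., k are required. *)
Definition k_rectangle b : Prop :=
  [/\ forall (a : 'I_k) (j : nat), (a < j <= n)%N -> 0 <= Aij b a j,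
      forall (a : 'I_k) (j : nat), (a < j < n)%N -> Aij b a j <= Aij b a j.+1
    & forall (a a' : 'I_k) (j : nat), a' = a.+1 :> nat -> (a < j < n)%N ->
        Aij b a' j.+1 <= Aij b a j].

(* The bijection between k-rectangles and tableaux; b None is the number of
   columns. *)
Definition tab_of b : tableau :=
  [seq flatten [seq nseq (absz (Aij b a j - Aij b a j.-1)) j | j <- iota 1 n]
     | a <- enum 'I_k].

Definition rect_of (T : tableau) : {ffun coordk n k -> int} :=
  [ffun v : coordk n k => (match v with
              | Some (a, s) => count (fun x => x <= a.+1 + s)%N (nth [::] T a)
              | None => size (head [::] T)
              end)%:Z].

Definition gamma_tilde (i : nat) b : nat := content_tab (rep1n n i) (tab_of b).

Definition epsilon_tilde (i : nat) b : nat := eps_tilde_tab n i (tab_of b).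

Definition phi_tilde (i : nat) b : nat := phi_tilde_tab n i (tab_of b).

Definition e_tilde (i : nat) b : option {ffun coordk n k -> int} :=
  omap rect_of (e_tilde_tab n i (tab_of b)).

Definition f_tilde (i : nat) b : option {ffun coordk n k -> int} :=
  omap rect_of (f_tilde_tab n i (tab_of b)).

End Rectangles.

(* Main.v *)
(* All functions are computed explicitly in the coordinates X_ij.  With the rows
   of Phi_k in echelon position, the minors on cyclic intervals are products of
   the X_ij, and x_i(a) can be moved through the factors of Phi_k; so e_i^c, for
   i <> 0, multiplies X_{a+1,i} by E_a / E_{a+1}, where each E_a is, up to a common
   factor, the sum of the terms of phi_i with the terms b >= a multiplied by c.
   A cyclic shift of the rows of the matrix reduces i = 0 to i = 1; in coordinates
   it is a composition of birational toggles.
   Tropically phi_i is a minimum over the rows, the toggles become the Bender-Knuth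
   involutions, and e_i (c -> 1 or -1) changes the entry (a, i) of the array by 1 in
   the extremal row a where the minimum is attained.  The bracketing rule computes
   the same minimum row by row, from the bottom, the number of unmatched letters i
   being the running maximum of a walk.  Finally, the tropical decoration is the
   minimum of all the gaps A_{i,j+1} - A_ij and A_ij - A_{i+1,j+1}, so it is
   nonnegative exactly on k-rectangles. *)

Require Import Defs.
From mathcomp Require Import all_boot all_order all_algebra.
From mathcomp Require Import boolp classical_sets reals.
From mathcomp Require Import complex.
From mathcomp Require mpoly.
From mathcomp Require Import ring lra zify.

Set Implicit Arguments.
Unset Strict Implicit.
Unset Printing Implicit Defensive.

Import Order.TTheory GRing.Theory Num.Theory.

Local Open Scope ring_scope.

(** * Subtraction-free expressions and their tropicalization *)

(** [Trop] and [Theta_inv] are given by choice, so neither can be unfolded: the chosen object has to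
    be identified by uniqueness, for pairs of polynomials through generic equality of values, for
    [Theta_inv] through injectivity of [Theta] on the torus. Each function is therefore exhibited as
    a subtraction-free expression that agrees with it off a hypersurface. Division by zero gives 0
    here, but such an expression is generically nonzero, which disposes of all denominators at once.
    The minor in phi_i is not expanded: its value is read off from the effect of e_i^c, for c = 2,
    on an interval minor. Nor is epsilon_i: epsilon_i / phi_i is a quotient of interval minors,
    tropically a difference of two contents, and the numbers of unmatched letters satisfy the same
    identity. Only phi_i has to be compared with the bracketing rule. That rule reads all k rows,
    whereas phi_i involves only the rows in which column i of the array holds a coordinate. Column
    strictness shows that the other rows never lower the minimum. *)

Section NonVanishing.
Import mpoly.

Lemma digits_inj (D n : nat) (f g : nat -> nat) :
    (forall i, (f i < D)%N) -> (forall i, (g i < D)%N) ->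
  (\sum_(i < n) f i * D ^ i = \sum_(i < n) g i * D ^ i)%N ->
  forall i, (i < n)%N -> f i = g i.
Proof.
elim: n f g => [//|n IHn] f g ltf ltg.
rewrite !big_ord_recl /= !expn0 !muln1.
have shiftD (h : nat -> nat) :
    (\sum_(i < n) h (bump 0 i) * D ^ (bump 0 i) = (\sum_(i < n) h i.+1 * D ^ i) * D)%N.
  by rewrite big_distrl; apply: eq_bigr => i _; rewrite expnSr mulnA.
rewrite !shiftD => eq_sum.
have eq0 : f 0%N = g 0%N.
  by have := congr1 (modn^~ D) eq_sum; rewrite !(addnC (_ 0%N)) !modnMDl !modn_small.
case=> [//|i]; rewrite ltnS => lti.
apply: (IHn (fun j => f j.+1) (fun j => g j.+1)) => //.
have D0 : (0 < D)%N := leq_ltn_trans (leq0n _) (ltf 0%N).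
by move/eqP: eq_sum; rewrite eq0 eqn_add2l eqn_pmul2r // => /eqP.
Qed.

(* Kronecker substitution x_i = y^(D^i), with D above all the exponents. *)
Lemma mpoly_nonvanishing (C : numFieldType) (n : nat) (p : {mpoly C[n]}) :
  p != 0 -> exists v : 'I_n -> C, p.@[v] != 0.
Proof.
move=> pN0; pose D := msize p.
pose wt (m : 'X_{1..n}) := (\sum_(i < n) m i * D ^ i)%N.
have ltD m i : m \in msupp p -> (m i < D)%N.
  move=> mp; apply: leq_ltn_trans (msize_mdeg_lt mp).
  by rewrite mdegE (bigD1 i) //= leq_addr.
have wt_inj m m' : m \in msupp p -> m' \in msupp p -> wt m = wt m' -> m = m'.
  move=> mp m'p; rewrite /wt => eqwt; apply/mnmP => i.
  pose h (u : 'X_{1..n}) j := if insub j is Some a then u a else 0%N.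
  have hE u (a : 'I_n) : h u a = u a by rewrite /h valK.
  have D0 : (0 < D)%N := leq_ltn_trans (leq0n _) (ltD _ i mp).
  rewrite -!hE; apply: (@digits_inj D n) => //.
  - by move=> j; rewrite /h; case: insubP => // a _ _; apply: ltD.
  - by move=> j; rewrite /h; case: insubP => // a _ _; apply: ltD.
  - under eq_bigr do rewrite hE; by under [RHS]eq_bigr do rewrite hE.
pose q : {poly C} := \sum_(m <- msupp p) p@_m *: 'X^(wt m).
have qN0 : q != 0.
  case: (altP (msupp p =P [::])) => [/msuppnil0 /eqP|]; first by rewrite (negPf pN0).
  case def_s: (msupp p) => [//|m0 s] _.
  have m0p : m0 \in msupp p by rewrite def_s mem_head.
  suff: q`_(wt m0) != 0 by apply: contraNneq => ->; rewrite coef0.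
  rewrite coef_sum (bigD1_seq m0) ?msupp_uniq //= coefZ coefXn eqxx mulr1.
  rewrite big_seq_cond big1 ?addr0 -?mcoeff_msupp // => m /andP[mp m_neq].
  rewrite coefZ coefXn; case: eqP => [/wt_inj eqm|]; last by rewrite mulr0.
  by rewrite eqm ?eqxx // in m_neq.
have [y qyN0] : exists y, q.[y] != 0.
  pose rs : seq C := [seq j%:R | j <- iota 0 (size q)].
  have rs_uniq : uniq rs.
    by rewrite map_inj_uniq ?iota_uniq // => a b /eqP; rewrite eqr_nat => /eqP.
  case: (boolP (all (root q) rs)) => [all_rs|/allPn[y _ ?]]; last by exists y.
  by have := max_poly_roots qN0 all_rs rs_uniq; rewrite size_map size_iota ltnn.
exists (fun i => y ^+ (D ^ i)%N); suff -> : p.@[fun i => y ^+ (D ^ i)%N] = q.[y] by [].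
rewrite mevalE horner_sum; apply: eq_bigr => m _; rewrite hornerZ hornerXn; congr (_ * _).
rewrite /wt -prodrXr; apply: eq_bigr => i _.
by rewrite -exprM mulnC.
Qed.

End NonVanishing.

Section PositivePolynomials.
Import mpoly.
Variable V : finType.
Local Notation n := #|V|.
Implicit Types (p q : {mpoly int[n]}) (w : {ffun V -> int}).

Definition mono_val w (u : 'X_{1..n}) : int := \sum_(a < n) w (enum_val a) *+ u a.

Lemma mono_valD w u v : mono_val w (u + v)%MM = mono_val w u + mono_val w v.
Proof.
by rewrite /mono_val -big_split /=; apply: eq_bigr => a _; rewrite mnmDE mulrnDr.
Qed.

Lemma big_min_seqP (s : seq int) : s != [::] ->
  let m := \big[Num.min/head 0 s]_(z <- s) z in m \in s /\ forall z, z \in s -> m <= z.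
Proof.
case: s => [//|z0 s] _ /=; set t := z0 :: s; split.
  suff H l : {subset l <= t} -> \big[Num.min/z0]_(z <- l) z \in t by apply: H.
  elim: l => [|z l IHl] sub; first by rewrite big_nil mem_head.
  rewrite big_cons minEle; case: ifP => _; first by rewrite sub ?mem_head.
  by apply: IHl => y yl; apply: sub; rewrite inE yl orbT.
move=> z; elim: t => [//|y l IHl]; rewrite inE big_cons => /predU1P[->|zl].
  by rewrite ge_min lexx.
by rewrite ge_min IHl ?orbT.
Qed.

Lemma trop_polyP p w : p != 0 ->
  (exists2 u, u \in msupp p & trop_poly p w = mono_val w u) /\
  (forall u, u \in msupp p -> trop_poly p w <= mono_val w u).
Proof.
move=> pN0; have := @big_min_seqP [seq mono_val w u | u <- msupp p].
rewrite -size_eq0 size_map size_eq0 msupp_eq0 => /(_ pN0) /= [].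
rewrite -/(trop_poly p w) => /mapP[u up ->] le_u; split; first by exists u.
by move=> u' u'p; apply/le_u/map_f.
Qed.

Lemma trop_poly_unique p w z : p != 0 ->
    (exists2 u, u \in msupp p & z = mono_val w u) ->
    (forall u, u \in msupp p -> z <= mono_val w u) -> trop_poly p w = z.
Proof.
move=> pN0 [u up ->] le_z; have [[u' u'p E] le_t] := trop_polyP w pN0.
by apply/le_anti; rewrite le_t // E le_z.
Qed.

Lemma nonneg_polyD p q : nonneg_poly p -> nonneg_poly q -> nonneg_poly (p + q).
Proof. by move=> hp hq u; rewrite mcoeffD addr_ge0. Qed.

Lemma nonneg_polyM p q : nonneg_poly p -> nonneg_poly q -> nonneg_poly (p * q).
Proof. by move=> hp hq u; rewrite mcoeffM sumr_ge0 // => k _; rewrite mulr_ge0. Qed.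

Lemma nonneg_polyX (u : 'X_{1..n}) : nonneg_poly ('X_[u] : {mpoly int[n]}).
Proof. by move=> u'; rewrite mcoeffX ler0n. Qed.

Lemma mem_msupp_nonnegD p q u : nonneg_poly p -> nonneg_poly q ->
  (u \in msupp (p + q)) = (u \in msupp p) || (u \in msupp q).
Proof.
by move=> hp hq; rewrite !mcoeff_msupp mcoeffD paddr_eq0 // negb_and.
Qed.

(** Nonnegative coefficients exclude cancellation: the coefficient of u + v is a sum of nonnegative
    terms, among them the nonzero p_u q_v. *)
Lemma mem_msupp_nonnegM p q u v : nonneg_poly p -> nonneg_poly q ->
  u \in msupp p -> v \in msupp q -> (u + v)%MM \in msupp (p * q).
Proof.
move=> hp hq; rewrite !mcoeff_msupp => pu qv; apply/negP; rewrite mcoeffM => /eqP.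
have du : (mdeg u < (mdeg (u + v)%MM).+1)%N by rewrite mdegD ltnS leq_addr.
have dv : (mdeg v < (mdeg (u + v)%MM).+1)%N by rewrite mdegD ltnS leq_addl.
move=> /psumr_eq0P H; have := H _ (BMultinom du, BMultinom dv) (eqxx _).
move=> /(_ _)/eqP; rewrite mulf_eq0 (negPf pu) (negPf qv) => /(_ _)/negP; apply=> //.
by move=> k _; rewrite mulr_ge0.
Qed.

Lemma nonneg_addr_neq0 p q : nonneg_poly p -> nonneg_poly q -> p != 0 -> p + q != 0.
Proof.
move=> hp hq pN0; have [[u up _] _] := trop_polyP [ffun=> 0] pN0.
have: u \in msupp (p + q) by rewrite mem_msupp_nonnegD ?up.
by apply: contraTneq => ->; rewrite msupp0.
Qed.

Lemma trop_polyM p q w : p != 0 -> q != 0 -> nonneg_poly p -> nonneg_poly q ->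
  trop_poly (p * q) w = trop_poly p w + trop_poly q w.
Proof.
move=> pN0 qN0 hp hq.
have [[u up Eu] leu] := trop_polyP w pN0; have [[v vq Ev] lev] := trop_polyP w qN0.
apply: trop_poly_unique; first by rewrite mulf_neq0.
  by exists (u + v)%MM; [apply: mem_msupp_nonnegM | rewrite mono_valD Eu Ev].
move=> x /msuppM_le/allpairsP[[u1 v1] /= [u1p v1q ->]].
by rewrite mono_valD lerD ?leu ?lev.
Qed.

Lemma trop_polyD p q w : p != 0 -> q != 0 -> nonneg_poly p -> nonneg_poly q ->
  trop_poly (p + q) w = Num.min (trop_poly p w) (trop_poly q w).
Proof.
move=> pN0 qN0 hp hq.
have [[u up Eu] leu] := trop_polyP w pN0; have [[v vq Ev] lev] := trop_polyP w qN0.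
apply: trop_poly_unique; first exact: nonneg_addr_neq0.
  rewrite minEle; case: ifP => _; [exists u|exists v] => //;
  by rewrite mem_msupp_nonnegD // ?up ?vq ?orbT.
by move=> x; rewrite mem_msupp_nonnegD // => /orP[/leu|/lev] le_x; rewrite ge_min le_x ?orbT.
Qed.

Lemma monomial_neq0 (K : nzRingType) m (u : 'X_{1..m}) : 'X_[u] != 0 :> {mpoly K[m]}.
Proof. by rewrite -msupp_eq0 msuppX. Qed.

Lemma trop_polyX (u : 'X_{1..n}) w : trop_poly 'X_[u] w = mono_val w u.
Proof.
apply: trop_poly_unique; first exact: monomial_neq0.
  by exists u; rewrite ?msuppX ?mem_head.
by move=> v; rewrite msuppX mem_seq1 => /eqP->.
Qed.

End PositivePolynomials.

Lemma frac_add (K : fieldType) (u v a b c d : K) : b != 0 -> d != 0 -> u = a / b -> v = c / d ->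
  u + v = (a * d + c * b) / (b * d).
Proof. by move=> b0 d0 -> ->; rewrite addf_div. Qed.

Lemma frac_mul (K : fieldType) (u v a b c d : K) : u = a / b -> v = c / d ->
  u * v = (a * c) / (b * d).
Proof. by move=> -> ->; rewrite mulf_div. Qed.

Section Generic.
Import mpoly.
Variables (C : numFieldType) (V : finType).
Implicit Types (P Q : {ffun V -> C} -> Prop) (F G : {ffun V -> C} -> C).

(** Convertible to [evalC] when C is [R[i]]. *)
Definition evalF (p : {mpoly int[#|V|]}) (x : {ffun V -> C}) : C :=
  (map_mpoly intr p).@[fun a => x (enum_val a)].

(** The pattern of [is_ratio] for an arbitrary predicate. The hypersurface is hidden, so that
    finitely many generic conditions can be intersected. *)
Definition generically P : Prop :=
  exists2 g : {mpoly C[#|V|]}, g != 0 &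
    forall x : {ffun V -> C}, in_torus x -> g.@[fun a => x (enum_val a)] != 0 -> P x.

Lemma generically_torus P : (forall x : {ffun V -> C}, in_torus x -> P x) -> generically P.
Proof. by move=> hP; exists 1; rewrite ?oner_neq0 // => x hx _; apply: hP. Qed.

Lemma generically_and P Q :
  generically P -> generically Q -> generically (fun x => P x /\ Q x).
Proof.
move=> [g gN0 hg] [h hN0 hh]; exists (g * h); first by rewrite mulf_neq0.
by move=> x hx; rewrite mevalM mulf_eq0 negb_or => /andP[? ?]; split; auto.
Qed.

Lemma generically_imp P Q : (forall x : {ffun V -> C}, in_torus x -> P x -> Q x) ->
  generically P -> generically Q.
Proof. by move=> PQ [g gN0 hg]; exists g => // x hx gx; apply/PQ/hg. Qed.

Lemma generically_all (I : finType) (P : I -> {ffun V -> C} -> Prop) :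
  (forall i, generically (P i)) -> generically (fun x => forall i, P i x).
Proof.
move=> hP; suff: generically (fun x => forall i, i \in enum I -> P i x).
  by apply: generically_imp => x _ H i; apply: H; rewrite mem_enum.
elim: (enum I) => [|i l IHl]; first by apply: generically_torus.
apply: generically_imp (generically_and (hP i) IHl) => x _ [Pi Pl] j.
by rewrite inE => /predU1P[->|/Pl].
Qed.

Lemma generically_ex P : generically P -> exists2 x : {ffun V -> C}, in_torus x & P x.
Proof.
case=> g gN0 hg.
(* Multiplying g by all the variables forces the point that is found into the torus. *)
have [|v] := @mpoly_nonvanishing _ #|V| (g * \prod_(a < #|V|) 'X_a).
  rewrite mulf_neq0 //; apply/prodf_neq0 => a _; exact: (monomial_neq0 C).
rewrite mevalM mulf_eq0 negb_or rmorph_prod => /andP[gv /prodf_neq0 vN0].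
pose x := [ffun z => v (enum_rank z)].
have ev a : x (enum_val a) = v a by rewrite ffunE enum_valK.
exists x; first by move=> z; have := vN0 (enum_rank z) isT; rewrite /= mevalXU ffunE.
apply: hg; first by move=> z; have := vN0 (enum_rank z) isT; rewrite /= mevalXU ffunE.
by rewrite (meval_eq _ ev).
Qed.

Lemma evalFM (p q : {mpoly int[#|V|]}) (x : {ffun V -> C}) :
  evalF (p * q) x = evalF p x * evalF q x.
Proof. by rewrite /evalF rmorphM mevalM. Qed.

Lemma evalFD (p q : {mpoly int[#|V|]}) (x : {ffun V -> C}) :
  evalF (p + q) x = evalF p x + evalF q x.
Proof. by rewrite /evalF rmorphD mevalD. Qed.

Lemma evalFB (p q : {mpoly int[#|V|]}) (x : {ffun V -> C}) :
  evalF (p - q) x = evalF p x - evalF q x.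
Proof. by rewrite /evalF rmorphB mevalB. Qed.

Lemma generically_poly_neq0 (p : {mpoly int[#|V|]}) :
  p != 0 -> generically (fun x => evalF p x != 0).
Proof.
move=> pN0; exists (map_mpoly intr p) => //.
apply: contraNneq pN0 => p0; apply/eqP/mpolyP => u.
have := congr1 (mcoeff u) p0; rewrite mcoeff_map_mpoly !mcoeff0 => /eqP.
by rewrite intr_eq0 => /eqP.
Qed.

Lemma generically_poly_eq (p q : {mpoly int[#|V|]}) :
  generically (fun x => evalF p x = evalF q x) -> p = q.
Proof.
move=> gpq; apply/eqP; rewrite -subr_eq0; apply/negPn/negP => /generically_poly_neq0 gN.
have [x _ [Epq /negP[]]] := generically_ex (generically_and gpq gN).
by rewrite evalFB Epq subrr.
Qed.

(** Clearing denominators turns generic agreement of values into an identity of integer polynomials,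
    to which [trop_poly] applies; this removes the choice made in [Trop]. *)
Lemma cross_generic (F : {ffun V -> C} -> C) (p q p' q' : {mpoly int[#|V|]}) :
  q != 0 -> q' != 0 ->
  generically (fun x => F x = evalF p x / evalF q x) ->
  generically (fun x => F x = evalF p' x / evalF q' x) -> p' * q = p * q'.
Proof.
move=> qN0 q'N0 gF gF'; apply: generically_poly_eq.
have gq := generically_and (generically_poly_neq0 qN0) (generically_poly_neq0 q'N0).
apply: generically_imp (generically_and gq (generically_and gF gF')).
move=> x _ [[qx q'x] [-> /eqP]]; rewrite !evalFM eqr_div // => /eqP E.
by rewrite E.
Qed.

End Generic.

Section SubtractionFree.
Import mpoly.

(** Syntax is kept because the min-plus value is not a function of the values at points that could
    be read off directly; an expression carries both by parallel recursions. *)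
Inductive sfexpr (V : Type) : Type :=
| SVar of V
| SOne
| SAdd of sfexpr V & sfexpr V
| SMul of sfexpr V & sfexpr V
| SInv of sfexpr V.

Fixpoint sf_eval (V : Type) (K : fieldType) (x : V -> K) (e : sfexpr V) : K :=
  match e with
  | SVar v => x v
  | SOne => 1
  | SAdd e1 e2 => sf_eval x e1 + sf_eval x e2
  | SMul e1 e2 => sf_eval x e1 * sf_eval x e2
  | SInv e1 => (sf_eval x e1)^-1
  end.

Fixpoint sf_trop (V : Type) (w : V -> int) (e : sfexpr V) : int :=
  match e with
  | SVar v => w v
  | SOne => 0
  | SAdd e1 e2 => Num.min (sf_trop w e1) (sf_trop w e2)
  | SMul e1 e2 => sf_trop w e1 + sf_trop w e2
  | SInv e1 => - sf_trop w e1
  end.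

Fixpoint sf_subst (V W : Type) (s : W -> sfexpr V) (e : sfexpr W) : sfexpr V :=
  match e with
  | SVar v => s v
  | SOne => SOne V
  | SAdd e1 e2 => SAdd (sf_subst s e1) (sf_subst s e2)
  | SMul e1 e2 => SMul (sf_subst s e1) (sf_subst s e2)
  | SInv e1 => SInv (sf_subst s e1)
  end.

Variable C : numFieldType.

Lemma sf_ratio (V : finType) (e : sfexpr V) :
  exists p q : {mpoly int[#|V|]},
  [/\ p != 0 /\ q != 0, nonneg_poly p /\ nonneg_poly q,
      forall w : {ffun V -> int}, sf_trop w e = trop_poly p w - trop_poly q w
    & generically (fun x : {ffun V -> C} =>
        [/\ evalF p x != 0, evalF q x != 0 & sf_eval x e = evalF p x / evalF q x])].
Proof.
have eval1 (x : {ffun V -> C}) : evalF 1 x = 1 by rewrite /evalF rmorph1 meval1.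
have trop1 (w : {ffun V -> int}) : trop_poly 1 w = 0.
  by rewrite -mpolyX0 trop_polyX /mono_val big1 // => a _; rewrite mnm0E mulr0n.
have nn1 : nonneg_poly (1 : {mpoly int[#|V|]}) by rewrite -mpolyX0; apply: nonneg_polyX.
have n01 : (1 : {mpoly int[#|V|]}) != 0 by rewrite oner_neq0.
elim: e => [v||e1 [p1 [q1 [[p1N0 q1N0] [p1n q1n] t1 g1]]] e2 [p2 [q2 [[p2N0 q2N0] [p2n q2n] t2 g2]]]
           |e1 [p1 [q1 [[p1N0 q1N0] [p1n q1n] t1 g1]]] e2 [p2 [q2 [[p2N0 q2N0] [p2n q2n] t2 g2]]]
           |e1 [p1 [q1 [[p1N0 q1N0] [p1n q1n] t1 g1]]]].
- exists 'X_(enum_rank v), 1; split; rewrite ?monomial_neq0 ?n01 //.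
  + by split=> //; apply: nonneg_polyX.
  + move=> w; rewrite trop1 subr0 trop_polyX /mono_val (bigD1 (enum_rank v)) //=.
    rewrite enum_rankK mnm1E eqxx mulr1n big1 ?addr0 // => a av.
    by rewrite mnm1E eq_sym (negPf av) mulr0n.
  + apply: generically_torus => x hx.
    by rewrite eval1 /evalF map_mpolyX mevalXU enum_rankK divr1 oner_neq0; split.
- exists 1, 1; split=> //= [w|]; first by rewrite trop1 subr0.
  by apply: generically_torus => x _; rewrite eval1 divr1 oner_neq0.
- exists (p1 * q2 + p2 * q1), (q1 * q2).
  have pN0 : p1 * q2 + p2 * q1 != 0.
    by apply: nonneg_addr_neq0; rewrite ?mulf_neq0 //; apply: nonneg_polyM.
  split; [by rewrite mulf_neq0| | |].
  + by split; [apply: nonneg_polyD|]; apply: nonneg_polyM.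
  + move=> w /=; rewrite t1 t2 trop_polyD ?mulf_neq0 //; try exact: nonneg_polyM.
    rewrite !trop_polyM //.
    have add_min (a b c : int) : Num.min a b - c = Num.min (a - c) (b - c).
      by rewrite !minEle lerD2r; case: ifP.
    by rewrite add_min; congr Num.min; ring.
  (* The numerator of a sum can vanish at complex points although its coefficients are nonnegative;
     these points are discarded. *)
  + apply: generically_imp (generically_and (generically_poly_neq0 C pN0) (generically_and g1 g2)).
    move=> x _ [pN [[p1N q1N E1] [p2N q2N E2]]]; split=> //; first by rewrite evalFM mulf_neq0.
    by rewrite evalFD !evalFM /=; apply: (frac_add q1N q2N E1 E2).
- exists (p1 * p2), (q1 * q2); split; rewrite ?mulf_neq0 //.
  + by split; apply: nonneg_polyM.
  + by move=> w /=; rewrite t1 t2 !trop_polyM //; ring.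
  + apply: generically_imp (generically_and g1 g2).
    move=> x _ [[? ? E1] [? ? E2]]; rewrite !evalFM; split; try exact: mulf_neq0.
    exact: frac_mul E1 E2.
- exists q1, p1; split=> // [w|]; first by rewrite /= t1 opprB.
  by apply: generically_imp g1 => x _ [? ? /= ->]; rewrite invf_div.
Qed.

Section Pairs.
Variable V : finType.
Implicit Types (F G : {ffun V -> C} -> C) (f g : {ffun V -> int} -> int).

(* f is the tropicalization of F, where F is given by a subtraction-free
   expression (evaluated with the convention 1/0 = 0). *)
Definition tropical F f : Prop :=
  exists e : sfexpr V, (forall x, F x = sf_eval x e) /\ (forall w, f w = sf_trop w e).

Lemma tropical_ext F G f g : tropical F f -> F =1 G -> f =1 g -> tropical G g.
Proof. by move=> [e [hF hf]] FG fg; exists e; split=> x; rewrite -?FG -?fg. Qed.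

Lemma tropical_var v : tropical (fun x => x v) (fun w => w v).
Proof. by exists (SVar v). Qed.

Lemma tropical1 : tropical (fun=> 1) (fun=> 0).
Proof. by exists (SOne V). Qed.

Lemma tropicalD F G f g : tropical F f -> tropical G g ->
  tropical (fun x => F x + G x) (fun w => Num.min (f w) (g w)).
Proof.
by move=> [e [hF hf]] [e' [hG hg]]; exists (SAdd e e'); split=> x /=; rewrite ?hF ?hG ?hf ?hg.
Qed.

Lemma tropicalM F G f g : tropical F f -> tropical G g ->
  tropical (fun x => F x * G x) (fun w => f w + g w).
Proof.
by move=> [e [hF hf]] [e' [hG hg]]; exists (SMul e e'); split=> x /=; rewrite ?hF ?hG ?hf ?hg.
Qed.

Lemma tropicalV F f : tropical F f -> tropical (fun x => (F x)^-1) (fun w => - f w).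
Proof. by move=> [e [hF hf]]; exists (SInv e); split=> x /=; rewrite ?hF ?hf. Qed.

Lemma tropical_div F G f g : tropical F f -> tropical G g ->
  tropical (fun x => F x / G x) (fun w => f w - g w).
Proof. by move=> hF /tropicalV; apply: tropicalM. Qed.

Lemma tropical_prod (I : Type) (s : seq I) (P : pred I) (F : I -> {ffun V -> C} -> C)
    (f : I -> {ffun V -> int} -> int) :
  (forall i, tropical (F i) (f i)) ->
  tropical (fun x => \prod_(i <- s | P i) F i x) (fun w => \sum_(i <- s | P i) f i w).
Proof.
move=> hF; elim: s => [|i s IHs].
  by apply: tropical_ext tropical1 _ _ => x; rewrite big_nil.
case Pi: (P i); last by apply: tropical_ext IHs _ _ => x; rewrite big_cons Pi.
by apply: tropical_ext (tropicalM (hF i) IHs) _ _ => x; rewrite big_cons Pi.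
Qed.

(** A minimum of integers has no neutral element, hence the nonempty list, whose first term becomes
    the default value. *)
Lemma tropical_sum (I : Type) (i0 : I) (s : seq I) (F : I -> {ffun V -> C} -> C)
    (f : I -> {ffun V -> int} -> int) :
  (forall i, tropical (F i) (f i)) ->
  tropical (fun x => \sum_(i <- i0 :: s) F i x)
    (fun w => \big[Num.min/f i0 w]_(i <- s) f i w).
Proof.
move=> hF; elim: s => [|i s IHs].
  by apply: tropical_ext (hF i0) _ _ => x; rewrite ?big_seq1 ?big_nil.
apply: tropical_ext (tropicalD (hF i) IHs) _ _ => x; rewrite !big_cons //.
by rewrite addrCA.
Qed.

(** The source of all later nonvanishing conditions: numerator and denominator of a subtraction-free
    expression are nonzero polynomials. *)
Lemma tropical_neq0 F f : tropical F f -> generically (fun x => F x != 0).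
Proof.
move=> [e [hF _]]; have [p [q [_ _ _]]] := sf_ratio e.
by apply: generically_imp => x _ [pN qN E]; rewrite hF E mulf_neq0 ?invr_eq0.
Qed.

End Pairs.

End SubtractionFree.

Section TropEval.
Import mpoly.
Variables (R : realType) (V : finType).
Local Notation C := (R[i]).
Implicit Types (F G : {ffun V -> C} -> C) (f : {ffun V -> int} -> int).

Lemma subtraction_free_formE F (p q : {mpoly int[#|V|]}) :
  is_ratio F p q <-> generically (fun x => F x = evalF p x / evalF q x).
Proof. by []. Qed.

(** The pair chosen by [Trop] and the pair built from the expression have equal cross products;
    taking [trop_poly], which is additive on products, gives equal differences. *)
Lemma Trop_tropical F G f w :
  tropical F f -> generically (fun x => G x = F x) -> Trop G w = f w.
Proof.
move=> [e [hF hf]] gG; have [p [q [[pN0 qN0] [pn qn] Et ge]]] := sf_ratio C e.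
have gGpq : generically (fun x => G x = evalF p x / evalF q x).
  by apply: generically_imp (generically_and gG ge) => x _ [-> [_ _ <-]]; rewrite hF.
have: subtraction_free_form G (p, q) by split=> //; apply/subtraction_free_formE.
rewrite /Trop => /(xgetI (0, 0)); set pq := xget _ _; case: pq => p' q' [/= p'N0 q'N0 hp' hq'].
move/subtraction_free_formE/(cross_generic qN0 q'N0 gGpq)/(congr1 (fun r => trop_poly r w)).
rewrite hf Et !trop_polyM // => E; apply/eqP.
by rewrite subr_eq addrAC eq_sym subr_eq -E addrC.
Qed.

End TropEval.

(** * The parametrization and its inverse *)

Section Arrays.
Variables (n k : nat) (T : Type) (u : T).
Implicit Types x : {ffun coordk n k -> T}.

(* A_{a+1,j} for 0 <= j <= n, where u stands for the entries left of the
   diagonal: 1 for points of the torus and 0 for their tropicalizations. *)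
Definition arrT x (a j : nat) : T :=
  if (j <= a)%N then u
  else if insub a is Some a' then
         if insub (j - a.+1)%N is Some s then x (Some (a', s)) else x None
       else x None.

Lemma arr_lo x a j : (j <= a)%N -> arrT x a j = u.
Proof. by rewrite /arrT => ->. Qed.

Lemma arr_hi x a j : (a + (n - k) < j)%N -> arrT x a j = x None.
Proof.
move=> lt_j; rewrite /arrT leqNgt (leq_ltn_trans _ lt_j) ?leq_addr //=.
by case: insub => // a'; rewrite insubF //; lia.
Qed.

Lemma arr_ord x (a : 'I_k) (q : 'I_(n - k)) j :
  j = (a.+1 + q)%N -> arrT x a j = x (Some (a, q)).
Proof.
move=> ->; rewrite /arrT leqNgt leq_addr /= valK.
by rewrite addKn valK.
Qed.

End Arrays.

Section Rows.
Variables (C : fieldType) (n : nat).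

(** Rows are indexed by natural numbers, with the zero row outside the matrix, so that shifts of
    indices need no ordinals. *)
Definition rw m (B : 'M[C]_(n, m)) (p : nat) : 'rV[C]_m :=
  if insub p is Some i then row i B else 0.

Lemma rw_ord m (B : 'M[C]_(n, m)) (i : 'I_n) : rw B i = row i B.
Proof. by rewrite /rw valK. Qed.

Lemma rw_inj m (A B : 'M[C]_(n, m)) : (forall p, (p < n)%N -> rw A p = rw B p) -> A = B.
Proof. by move=> eqAB; apply/row_matrixP => i; rewrite -!rw_ord eqAB. Qed.

Lemma rwD m (A B : 'M[C]_(n, m)) p : rw (A + B) p = rw A p + rw B p.
Proof. by rewrite /rw; case: insub => [i|]; rewrite ?addr0 ?linearD. Qed.

Lemma rwZ m c (A : 'M[C]_(n, m)) p : rw (c *: A) p = c *: rw A p.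
Proof. by rewrite /rw; case: insub => [i|]; rewrite ?scaler0 ?linearZ. Qed.

Lemma rw_mulmx m l (A : 'M[C]_(n, m)) (B : 'M[C]_(m, l)) p : rw (A *m B) p = rw A p *m B.
Proof. by rewrite /rw; case: insub => [i|]; rewrite ?mul0mx ?row_mul. Qed.

Lemma rw_Emx m (B : 'M[C]_(n, m)) i j p : (0 < j)%N -> (p < n)%N ->
  rw (Emx C n i j *m B) p = if p.+1 == i then rw B j.-1 else 0.
Proof.
case: j => // j _ ltp /=; rewrite -[p]/(val (Ordinal ltp)) rw_ord.
apply/rowP => c; rewrite !mxE /rw.
case: insubP => [j' _ def_j|le_nj].
  rewrite (bigD1 j') //= mxE def_j eqxx andbT big1 => [|l lj].
    by case: ifP => _; rewrite addr0 ?mul1r ?mul0r mxE.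
  rewrite mxE eqSS; case: (l =P j :> nat) => [def_l|_]; last by rewrite andbF mul0r.
  by case/eqP: lj; apply: val_inj; rewrite def_j.
rewrite big1 => [|l _]; first by case: ifP; rewrite mxE.
rewrite mxE eqSS; case: (l =P j :> nat) => [def_l|_]; last by rewrite andbF mul0r.
by rewrite -def_l ltn_ord in le_nj.
Qed.

Lemma rw_sum_Emx m (B : 'M[C]_(n, m)) (P : pred nat) p : (p < n)%N ->
  rw ((\sum_(1 <= j < n.+1 | P j) Emx C n j j) *m B) p = if P p.+1 then rw B p else 0.
Proof.
move=> ltp; have rw_sum I (s : seq I) (Q : pred I) (f : I -> 'M[C]_(n, m)) :
    rw (\sum_(i <- s | Q i) f i) p = \sum_(i <- s | Q i) rw (f i) p.
  by apply: (big_morph (fun A => rw A p)) => [A A'|]; rewrite ?rwD // /rw insubT linear0.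
rewrite mulmx_suml rw_sum big_mkcond big_seq_cond.
rewrite (eq_bigr (fun j => if j == p.+1 then if P j then rw B p else 0 else 0)); last first.
  move=> j /andP[]; rewrite mem_index_iota => /andP[j0 _] _.
  rewrite rw_Emx // (eq_sym p.+1).
  by case: eqP => [->|_] //; case: ifP.
rewrite -big_seq_cond (bigD1_seq p.+1) ?iota_uniq ?mem_index_iota ?ltnS ?ltp //= eqxx.
by rewrite big1 ?addr0 // => j /negPf->.
Qed.

Lemma rw_xneg m (B : 'M[C]_(n, m)) i c p : (0 < i)%N -> (p < n)%N ->
  rw (xneg n i c *m B) p =
  if p.+1 == i then c *: rw B p
  else if p == i then c^-1 *: rw B p + rw B p.-1 else rw B p.
Proof.
move=> i0 ltp; rewrite /xneg !mulmxDl !rwD -!scalemxAl !rwZ !rw_Emx // rw_sum_Emx //.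
rewrite !inE eqSS negb_or; case: eqP => [<-|_] /=.
  by rewrite eqn_leq ltnn andbF scaler0 !addr0.
by case: eqP => [->|_] /=; rewrite ?scaler0 ?add0r ?addr0.
Qed.

Lemma rw_tmx m (B : 'M[C]_(n, m)) i c p : (0 < i)%N -> (p < n)%N ->
  rw (tmx n i c *m B) p = if p.+1 == i then c *: rw B p else rw B p.
Proof.
move=> i0 ltp; rewrite /tmx mulmxDl !rwD -!scalemxAl rwZ rw_Emx // rw_sum_Emx //.
by case: eqP => [<-|_] /=; rewrite ?scaler0 ?addr0 ?add0r.
Qed.

End Rows.

Section ThetaRows.
Variables (C : fieldType) (n k : nat).
Hypothesis le_kn : (k <= n)%N.
Local Notation r := (n - k)%N.
Implicit Types x : {ffun coordk n k -> C}.
Local Notation arr := (arrT 1).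

(** The diagonal of the lower bidiagonal matrix [Mseg x a], as [rw_Mseg] shows. Its tropicalization
    counts the letters p + 1 in row a + 1 of the tableau. *)
Definition zrat x (a p : nat) : C := arr x a p.+1 / arr x a p.

(* The rows (numbered from 0) of the product of the last a factors M_{[i,i+n-k]}
   of Phi, restricted to the first r columns. *)
Fixpoint rowv x (a p : nat) : 'rV[C]_r :=
  if a is a'.+1 then
    zrat x a' p *: rowv x a' p + (if (a' < p <= a' + r)%N then rowv x a' p.-1 else 0)
  else if insub p is Some q then delta_mx 0 q else 0.

Lemma arr_neq0 x a j : in_torus x -> arr x a j != 0.
Proof.
by move=> hx; rewrite /arrT; case: ifP; rewrite ?oner_neq0 // => _; do 2?case: insub => // ?.
Qed.

Lemma rw_Mseg x m (B : 'M[C]_(n, m)) (a : 'I_k) p : in_torus x -> (p < n)%N ->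
  rw (Mseg x a *m B) p =
  zrat x a p *: rw B p + (if (a < p <= a + r)%N then rw B p.-1 else 0).
Proof.
move=> hx ltp; rewrite /Mseg.
pose F s : 'M[C]_n := xneg n (a.+1 + s) (arr x a (a.+1 + s)).
have -> : \prod_(s < r) xneg n (a.+1 + s) (x (Some (a, s))) = \prod_(0 <= s < r) F s.
  by rewrite big_mkord; apply: eq_bigr => s _; rewrite /F (@arr_ord _ _ _ 1 x a s).
have tE : x None = arr x a (a.+1 + r) by rewrite arr_hi // addSn.
have X0 j : arr x a j != 0 by apply: arr_neq0.
(* The product is built from its right end. In row a + m', the first one affected, the ratio still
   lacks its denominator, which the next factor on the left supplies. *)
suff H d : forall m', (m' + d = r)%N -> forall p, (p < n)%N ->
    rw ((\prod_(m' <= s < r) F s *m tmx n (a.+1 + r) (x None)) *m B) p =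
    if (p < a + m')%N then rw B p else if p == (a + m')%N then arr x a p.+1 *: rw B p
    else zrat x a p *: rw B p + (if (p <= a + r)%N then rw B p.-1 else 0).
  rewrite (H r 0%N) // addn0; case: (ltngtP p a) => //= [lt_pa|def_p]; last first.
    by rewrite /zrat def_p [arr x a a]arr_lo // divr1 addr0.
  by rewrite /zrat !arr_lo ?(ltnW lt_pa) // divr1 scale1r addr0.
elim: d => [|d IH] m' def_r {}p {}ltp.
  rewrite addn0 in def_r; rewrite def_r big_geq // mul1mx rw_tmx // addSn eqSS tE.
  case: ltngtP => [//|lt_p|->] //; rewrite ?addSn //.
  by rewrite /zrat !arr_hi ?divff ?scale1r ?addr0 // ltnW.
rewrite big_ltn ?def_r; last by rewrite -def_r -addSnnS leq_addr.
rewrite -mulmxE -!mulmxA rw_xneg // mulmxA !(IH m'.+1) ?addSnnS //; last first.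
  by apply: leq_ltn_trans ltp; apply: leq_pred.
rewrite -addSnnS addSn eqSS.
case: (ltngtP p (a + m')%N) => [lt_p|gt_p|->].
- by rewrite ltnS ltnW // ltn_eqF // ltnW.
- case: eqP => [->|/eqP neq_p].
    by rewrite /= ltnn leqnn scalerA /zrat mulrC ltn_add2l -def_r -addSnnS leq_addr.
  by rewrite ltnNge gt_p /=.
- by rewrite leqnn.
Qed.

Lemma row_Phi x p : in_torus x -> (p < n)%N ->
  rw (colsub (widen_ord (leq_subr k n)) (Phi x)) p = rowv x k p.
Proof.
move=> hx ltp; pose W a : 'M[C]_n := if insub a is Some a' then Mseg x a' else 1%:M.
pose B0 : 'M[C]_(n, r) := colsub (widen_ord (leq_subr k n)) 1%:M.
have colsubE (A : 'M[C]_n) : colsub (widen_ord (leq_subr k n)) A = A *m B0.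
  by rewrite mulmx_colsub mulmx1.
have -> : Phi x = \prod_(0 <= a < k) W (k - a.+1)%N.
  by rewrite big_mkord; apply: eq_bigr => a _; rewrite /W -[(k - _)%N]/(val (rev_ord a)) valK.
rewrite colsubE; suff H m : (m <= k)%N -> forall p, (p < n)%N ->
  rw ((\prod_(0 <= a < m) W (m - a.+1)%N) *m B0) p = rowv x m p by apply: H.
elim: m => [_|m IH ltm] {}p {}ltp.
  rewrite big_geq // mul1mx -[p]/(val (Ordinal ltp)) rw_ord /=.
  apply/rowP => c; rewrite !mxE; case: insubP => [q _ def_q|le_p].
    rewrite !mxE eqxx; by rewrite -!val_eqE /= def_q eq_sym.
  rewrite mxE -val_eqE /=; case: eqP => // def_p.
  by rewrite def_p ltn_ord in le_p.
rewrite big_nat_recl // subn1 /= -mulmxE -mulmxA.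
rewrite {1}/W insubT (@rw_Mseg _ _ _ (Ordinal ltm)) //=.
rewrite !IH //; try by [apply: ltnW | apply: leq_ltn_trans ltp; apply: leq_pred].
Qed.

End ThetaRows.

(** * Bidiagonal matrices, frames and the injectivity of the parametrization *)

Section Bidiagonal.
Variables (C : fieldType) (r : nat).
Implicit Types (u y : nat -> C) (w : nat -> 'rV[C]_r).

Definition upbid u : 'M[C]_r := \matrix_(q, c) ((c == q)%:R + u q * (c == q.+1 :> nat)%:R).

Definition lobid y s : 'M[C]_r :=
  \matrix_(q, c) (y q * (c == q)%:R + s q * (c.+1 == q :> nat)%:R).

Definition unitrow (p : nat) : 'rV[C]_r := if insub p is Some q then delta_mx 0 q else 0.

Lemma unitrow_out p : (r <= p)%N -> unitrow p = 0.
Proof. by move=> le_rp; rewrite /unitrow insubF // ltnNge le_rp. Qed.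

Lemma unitrow_ord (q : 'I_r) : unitrow q = delta_mx 0 q.
Proof. by rewrite /unitrow valK. Qed.

Lemma row_mul_nat l (A : 'M[C]_(l, r)) w q :
  row q (A *m \matrix_(c < r) w c) = \sum_(c < r) A q c *: w c.
Proof.
rewrite row_mul; apply/rowP => d; rewrite !mxE summxE.
by apply: eq_bigr => c _; rewrite !mxE.
Qed.

Lemma sum_pick w p (d : C) :
  \sum_(c < r) (d * (c == p :> nat)%:R) *: w c = if (p < r)%N then d *: w p else 0.
Proof.
case: ifP => ltp; last first.
  rewrite big1 // => c _; case: eqP => [def_c|_]; last by rewrite mulr0 scale0r.
  by rewrite -def_c ltn_ord in ltp.
rewrite (bigD1 (Ordinal ltp)) //= eqxx mulr1 big1 ?addr0 // => c.
by rewrite -val_eqE /= => /negPf->; rewrite mulr0 scale0r.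
Qed.

Lemma row_upbid_mul u w (q : 'I_r) :
  row q (upbid u *m \matrix_(c < r) w c) = w q + (if (q.+1 < r)%N then u q *: w q.+1 else 0).
Proof.
rewrite row_mul_nat; under eq_bigr do rewrite mxE scalerDl.
rewrite big_split /= sum_pick; congr (_ + _).
under eq_bigr do rewrite -val_eqE -[_%:R]mul1r.
by rewrite sum_pick ltn_ord scale1r.
Qed.

Lemma row_lobid_mul y s w (q : 'I_r) :
  row q (lobid y s *m \matrix_(c < r) w c) =
  y q *: w q + (if (0 < q)%N then s q *: w q.-1 else 0).
Proof.
rewrite row_mul_nat; under eq_bigr do rewrite mxE scalerDl.
rewrite big_split /=; under eq_bigr do rewrite -val_eqE.
rewrite sum_pick ltn_ord; congr (_ + _); case: ifP => q0.
  have E (c : 'I_r) : (c.+1 == q :> nat) = (c == q.-1 :> nat) by rewrite -{1}(prednK q0) eqSS.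
  under eq_bigr do rewrite E.
  by rewrite sum_pick (leq_ltn_trans (leq_pred q)).
rewrite big1 // => c _; case: (nat_of_ord q) q0 => // _.
by rewrite mulr0 scale0r.
Qed.

Lemma det_upbid u : \det (upbid u) = 1.
Proof.
rewrite -det_tr det_trig; last first.
  by apply/is_trig_mxP => i j lt_ij; rewrite !mxE -val_eqE /= !ltn_eqF ?mulr0 ?addr0 // ltnW.
by rewrite big1 // => q _; rewrite !mxE eqxx ltn_eqF // mulr0 addr0.
Qed.

Lemma det_lobid y s : \det (lobid y s) = \prod_(q < r) y q.
Proof.
rewrite det_trig; last first.
  apply/is_trig_mxP => i j lt_ij; rewrite !mxE -val_eqE /= !gtn_eqF ?mulr0 ?addr0 //.
  exact: ltnW.
by apply: eq_bigr => q _; rewrite !mxE eqxx gtn_eqF // mulr0 mulr1 addr0.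
Qed.

Lemma mx_rowsE (A : 'M[C]_r) : A = A *m \matrix_(c < r) unitrow c.
Proof.
rewrite -[LHS]mulmx1; congr (_ *m _); apply/matrixP => i j.
by rewrite !mxE unitrow_ord mxE eqxx eq_sym.
Qed.

(* The exchange relation for lower and upper bidiagonal matrices. *)
Lemma upbid_lobid u u' y y' :
    (forall q, (q < r)%N -> y q + (if (q.+1 < r)%N then u' q else 0)
                            = y' q + (if (0 < q)%N then u q.-1 else 0)) ->
    (forall q, (q.+1 < r)%N -> u' q * y q.+1 = y' q * u q) ->
  upbid u' *m lobid y (fun=> 1) = lobid y' (fun=> 1) *m upbid u.
Proof.
move=> diag super; rewrite (mx_rowsE (lobid y _)) (mx_rowsE (upbid u)).
apply/row_matrixP => q; pose e := unitrow.
have -> : lobid y (fun=> 1) *m \matrix_c e c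
        = \matrix_(c < r) (y c *: e c + (if (0 < c)%N then e c.-1 else 0)).
  by apply/row_matrixP => c; rewrite row_lobid_mul rowK scale1r.
have -> : upbid u *m \matrix_c e c
        = \matrix_(c < r) (e c + (if (c.+1 < r)%N then u c *: e c.+1 else 0)).
  by apply/row_matrixP => c; rewrite row_upbid_mul rowK.
rewrite (@row_upbid_mul _ (fun c => y c *: e c + (if (0 < c)%N then e c.-1 else 0))).
rewrite (@row_lobid_mul _ _ (fun c => e c + (if (c.+1 < r)%N then u c *: e c.+1 else 0))).
case: q => [[|q] ltq] /=; have := diag _ ltq; have := super _; rewrite /= ?ltq ?scale1r.
  move: (e 0%N) (e 1%N) => E E1 /(_ 0%N); case: ifP => [_ /(_ isT)|_ _].
    move=> Es; rewrite !addr0 => Ed; apply/rowP => c; rewrite !mxE.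
    by rewrite mulrDr mulrA Es -Ed; ring.
  by rewrite !addr0 => ->.
move: (e q) (e q.+1) (e q.+2) => Em E E1 /(_ q.+1); case: ifP => [_ /(_ isT)|_ _].
  move=> Es Ed; apply/rowP => c; rewrite !mxE (mulrDr (u' q.+1)) (mulrA (u' q.+1)) Es.
  transitivity ((y q.+1 + u' q.+1) * E 0 c + Em 0 c + y' q.+1 * u q.+1 * E1 0 c); first by ring.
  by rewrite Ed; ring.
by rewrite !addr0 => ->; rewrite scalerDl -!addrA; congr (_ + _); rewrite addrC.
Qed.

End Bidiagonal.

Section Frames.
Variables (C : fieldType) (n k : nat).
Hypothesis le_kn : (k <= n)%N.
Local Notation r := (n - k)%N.
Implicit Types x y : {ffun coordk n k -> C}.
Local Notation arr := (arrT 1).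

(** Rows a, ..., a + r - 1 of the partial product, those below being zero by [rowv_out]. Passing
    from a to a + 1 multiplies the frame by a unipotent upper bidiagonal matrix, so it remains a
    basis of determinant 1. *)
Definition frame x a : 'M[C]_r := \matrix_(q < r) rowv x a (a + q).

Definition frame_step x a := upbid r (fun q => zrat x a (a.+1 + q)).

Lemma rowv_out x a p : (a + r <= p)%N -> rowv x a p = 0.
Proof.
elim: a p => [|a IH] p; first by rewrite add0n; apply: unitrow_out.
rewrite addSn => lt_p /=; rewrite (IH p (ltnW lt_p)) scaler0.
by rewrite [(p <= _)%N]leqNgt lt_p andbF addr0.
Qed.

Lemma frameS x a : frame x a.+1 = frame_step x a *m frame x a.
Proof.
apply/row_matrixP => q; rewrite (@row_upbid_mul _ _ _ (fun q => rowv x a (a + q))) rowK /=.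
rewrite addSn ltnS leq_addr addnS /= -addSn addSn ltn_add2l ltn_ord addrC; congr (_ + _).
by case: ltnP => // le_q; rewrite rowv_out ?scaler0 // -addnS leq_add2l.
Qed.

Lemma frame0 x : frame x 0 = 1%:M.
Proof. by apply/row_matrixP => q; rewrite rowK row1 /= valK. Qed.

Lemma det_frame x a : \det (frame x a) = 1.
Proof. by elim: a => [|a IH]; rewrite ?frame0 ?det1 // frameS det_mulmx det_upbid mul1r. Qed.

Lemma frame_unit x a : frame x a \in unitmx.
Proof. by rewrite unitmxE det_frame unitr1. Qed.

Lemma zrat_lo x a p : (p < a)%N -> zrat x a p = 1.
Proof. by move=> lt_p; rewrite /zrat !arr_lo ?divr1 // ltnW. Qed.

Lemma zrat_neq0 x a p : in_torus x -> zrat x a p != 0.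
Proof. by move=> hx; rewrite mulf_neq0 ?invr_eq0 ?arr_neq0. Qed.

(** The factor of index m leaves the rows above row m alone, so row a is final after the factor of
    index a. *)
Lemma rowv_stable x a m : (a < m)%N -> rowv x m a = rowv x a.+1 a.
Proof.
elim: m => // m IH; rewrite ltnS leq_eqVlt => /predU1P[->//|lt_a].
by rewrite -IH // [LHS]/= zrat_lo // scale1r ltnNge (ltnW lt_a) addr0.
Qed.

Lemma rowv_diag x a : rowv x a.+1 a = arr x a a.+1 *: rowv x a a.
Proof. by rewrite /= ltnn addr0 /zrat (arr_lo _ _ (leqnn a)) divr1. Qed.

Definition frame_coords x a : 'rV[C]_r := \row_q ((-1) ^+ q * arr x a (a.+1 + q)).

(* The sum telescopes, since frame (a+1) is obtained from frame a by a unipotent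
   upper bidiagonal matrix with entries A_{q+1} / A_q. *)
Lemma rowv_coords x a : (0 < r)%N -> in_torus x ->
  rowv x a.+1 a = frame_coords x a *m frame x a.+1.
Proof.
move=> r0 hx; have X0 j : arr x a j != 0 by apply: arr_neq0.
rewrite mulmx_sum_row rowv_diag.
rewrite (eq_bigr (fun q : 'I_r => (-1) ^+ q *: (arr x a (a.+1 + q) *: rowv x a (a + q) +
   arr x a (a.+1 + q.+1) *: rowv x a (a + q.+1)))); last first.
  move=> q _; rewrite mxE rowK -scalerA; congr (_ *: _) => /=.
  rewrite ltnS leq_addr addSn ltn_add2l ltn_ord /= scalerDr scalerA addrC.
  by rewrite /zrat !addnS addSn mulrC divfK.
suff H m : \sum_(q < m) (-1) ^+ q *: (arr x a (a.+1 + q) *: rowv x a (a + q) +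
    arr x a (a.+1 + q.+1) *: rowv x a (a + q.+1)) =
    arr x a a.+1 *: rowv x a a - (-1) ^+ m *: (arr x a (a.+1 + m) *: rowv x a (a + m)).
  by rewrite H (@rowv_out _ _ (a + r)) ?scaler0 ?subr0.
elim: m => [|m IH]; first by rewrite big_ord0 !addn0 expr0 scale1r subrr.
by rewrite big_ord_recr IH /= scalerDr addrA subrK exprS mulN1r scaleNr opprK.
Qed.

Lemma row_Theta x p : in_torus x -> (p < n)%N -> rw (Theta x).1 p = rowv x k p.
Proof. exact: row_Phi. Qed.

Lemma same_Xpoint_mul (p q : Xpoint C n r) (g : 'M[C]_r) :
  g \in unitmx -> q.1 = p.1 *m g -> q.2 = p.2 -> same_Xpoint q p.
Proof.
move=> g_unit Eq Et; split=> //; rewrite Eq.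
by rewrite trmx_mul; apply/eqmxP/eqmxMfull; rewrite row_full_unit unitmx_tr.
Qed.

Lemma same_Xpoint_sym (p q : Xpoint C n r) : same_Xpoint p q -> same_Xpoint q p.
Proof. by case=> [/eqmxP E Et]; split=> //; apply/eqmxP/eqmx_sym. Qed.

Lemma same_Xpoint_trans (p q s : Xpoint C n r) :
  same_Xpoint p q -> same_Xpoint q s -> same_Xpoint p s.
Proof.
case=> [/eqmxP E Et] [/eqmxP E' Et']; split; last by rewrite Et.
exact/eqmxP/(eqmx_trans E E').
Qed.

(** The column operation g being fixed, the factors are peeled off from a = k downwards. In the
    basis [frame x a.+1], row a of the matrix has the entries of row a of the array as coordinates,
    up to sign; these determine the bidiagonal step and hence the previous frame. *)
Lemma Theta_inj x y : (0 < r)%N -> in_torus x -> in_torus y ->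
  same_Xpoint (Theta y) (Theta x) -> y = x.
Proof.
move=> r0 hx hy [/eqmxP E Et]; rewrite /= in Et.
have /submxP[D /(congr1 trmx)] : ((Theta y).1^T <= (Theta x).1^T)%MS by rewrite E.
rewrite trmx_mul !trmxK; set g := D^T => Eg.
have rowE p : (p < n)%N -> rowv y k p = rowv x k p *m g.
  by move=> ltp; rewrite -!row_Theta // Eg rw_mulmx.
suff H d a : (a + d = k)%N -> frame y a = frame x a *m g /\
    forall b, (a <= b < k)%N -> forall q, (q < r)%N -> arr y b (b.+1 + q) = arr x b (b.+1 + q).
  have [_ eqX] := H k 0%N (add0n k).
  apply/ffunP; case=> [[a q]|] //.
  have := eqX a (ltn_ord a) q (ltn_ord q).
  by rewrite (@arr_ord _ _ _ 1 y a q) ?(@arr_ord _ _ _ 1 x a q).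
elim: d a => [|d IH] a def_k.
  rewrite addn0 in def_k; rewrite def_k; split; last first.
    by move=> b /andP[/leq_ltn_trans lt_b /lt_b]; rewrite ltnn.
  apply/row_matrixP => q; rewrite row_mul !rowK rowE //.
  by have := ltn_ord q; lia.
have lt_ak : (a < k)%N by lia.
have [|EF EX] := IH a.+1; first by rewrite addSnnS.
have Ec : frame_coords y a = frame_coords x a.
  apply: (can_inj (mulmxK (frame_unit y a.+1))).
  rewrite -rowv_coords // EF mulmxA -rowv_coords //.
  by rewrite -!(rowv_stable _ lt_ak) rowE // (leq_trans lt_ak).
have EXa q : (q < r)%N -> arr y a (a.+1 + q) = arr x a (a.+1 + q).
  move=> ltq; have /rowP/(_ (Ordinal ltq)) := Ec; rewrite !mxE /=.
  by apply/mulfI; rewrite expf_neq0 // oppr_eq0 oner_neq0.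
have EU : frame_step y a = frame_step x a.
  apply/matrixP => q c; rewrite !mxE; congr (_ + _ * _).
  rewrite /zrat -!addnS (EXa q) //; case: (ltnP q.+1 r) => [ltq|leq]; first by rewrite EXa.
  by rewrite !(@arr_hi _ _ _ _ _ _ (a.+1 + q.+1)) ?Et //; lia.
split.
  apply: (can_inj (mulKmx (_ : frame_step y a \in unitmx))).
    by rewrite unitmxE det_upbid unitr1.
  by rewrite mulmxA {2}EU -!frameS.
by move=> b /andP[]; rewrite leq_eqVlt => /predU1P[<- _|lt_ab lt_bk]; auto; apply: EX; rewrite lt_ab.
Qed.

Lemma Theta_invE x (p : Xpoint C n r) : (0 < r)%N -> in_torus x ->
  same_Xpoint (Theta x) p -> Theta_inv p = x.
Proof.
move=> r0 hx hxp; rewrite /Theta_inv.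
have /(xgetI [ffun=> 0]) [hy hyp] : [set x | in_torus x /\ same_Xpoint (Theta x) p]%classic x by [].
by apply: Theta_inj => //; apply: same_Xpoint_trans hyp (same_Xpoint_sym hxp).
Qed.

End Frames.

(** * Minors and the crystal operators in the coordinates X_ij *)

Section CrystalPass.
Variables (C : fieldType) (n k : nat).
Hypothesis le_kn : (k <= n)%N.
Local Notation r := (n - k)%N.
Implicit Types x y : {ffun coordk n k -> C}.
Local Notation arr := (arrT 1).

(** In row b + 1 of the array, position i then holds a coordinate rather than the constant 1 or
    t. *)
Definition active (i b : nat) : bool := (b < i <= b + r)%N.

(** Moving E_{i,i+1} to the right through the diagonal parts of the factors k - 1, ..., b multiplies
    it by this product. *)
Definition eprod x i b : C := \prod_(b <= b' < k) (zrat x b' i / zrat x b' i.-1).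

Definition esum_term x i b : C := eprod x i b.+1 / zrat x b i.-1.

Definition scale_column x i (D : nat -> C) : {ffun coordk n k -> C} :=
  [ffun v : coordk n k => match v with
     | Some (a, q) => if (a.+1 + q)%N == i then x v * (D a / D a.+1) else x v
     | None => x v
     end].

Lemma arr_scale_column x i D b j : (b < k)%N ->
  (~~ active i b -> D b = D b.+1) -> D b.+1 != 0 ->
  arr (scale_column x i D) b j = arr x b j * (if j == i then D b / D b.+1 else 1).
Proof.
move=> ltb hD Db; have [le_jb|lt_bj] := leqP j b.
  rewrite !arr_lo // mul1r; case: eqP => // def_j.
  by rewrite hD ?divff // /active; lia.
have [le_j|gt_j] := leqP j (b + r).
  have ltq : (j - b.+1 < r)%N by lia.
  have jE : j = (b.+1 + (j - b.+1))%N by lia.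
  have E (z : {ffun coordk n k -> C}) : arr z b j = z (Some (Ordinal ltb, Ordinal ltq)).
    exact: (@arr_ord _ _ _ _ z (Ordinal ltb) (Ordinal ltq)).
  rewrite !E ffunE /= -jE.
  by case: eqP; rewrite ?mulr1.
rewrite !arr_hi // ffunE; case: eqP => [def_j|_]; last by rewrite mulr1.
by rewrite hD ?divff ?mulr1 // /active; lia.
Qed.

Section Pass.
Variables (x : {ffun coordk n k -> C}) (i : nat) (d : C) (D : nat -> C).
Hypotheses (hx : in_torus x) (i0 : (0 < i)%N).
Hypothesis D_rec : forall b, (b < k)%N ->
  D b = D b.+1 + (if active i b then d * esum_term x i b else 0).
Hypothesis D_neq0 : forall b, (b <= k)%N -> D b != 0.
Local Notation y := (scale_column x i D).

Lemma arr_scaled b j : (b < k)%N ->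
  arr y b j = arr x b j * (if j == i then D b / D b.+1 else 1).
Proof.
move=> ltb; apply: arr_scale_column => //; last exact: D_neq0.
by move=> /negPf na; rewrite D_rec // na addr0.
Qed.

Lemma scale_column_torus : in_torus y.
Proof.
move=> v; rewrite ffunE; case: v => [[a q]|]; last exact: hx.
case: ifP => _; last exact: hx.
rewrite !mulf_neq0 ?invr_eq0 ?hx ?(D_neq0 (ltn_ord a)) //.
exact/D_neq0/ltnW/ltn_ord.
Qed.

Lemma zrat_scaled b p : (b < k)%N -> zrat y b p =
  if p.+1 == i then zrat x b p * (D b / D b.+1)
  else if p == i then zrat x b p * (D b.+1 / D b) else zrat x b p.
Proof.
move=> ltb; rewrite /zrat !arr_scaled //; case: eqP => [<-|_].
  by rewrite ltn_eqF // mulr1 mulrAC.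
rewrite mulr1; case: eqP => _; last by rewrite mulr1.
by rewrite invfM invf_div; apply: mulrA.
Qed.

(* A left factor 1 + a E_{i,i+1} is moved through the factors M_{[j,j+n-k]} of
   Phi one by one, from left to right: this rescales column i of the array and
   leaves a right factor of the same kind. *)
Lemma scale_column_pass :
  exists2 g : 'M[C]_r, \det g = 1 & forall b p, (b <= k)%N ->
    rowv y b p *m g =
    rowv x b p + (if p.+1 == i then (d * eprod x i b / D b) *: rowv x b i else 0).
Proof.
(* The coefficient of the elementary factor once the factors of index at least b have been passed;
   at b = 0 it becomes the right factor. *)
pose beta b := d * eprod x i b / D b.
exists (upbid r (fun q => if q.+1 == i then beta 0%N else 0)); first exact: det_upbid.
elim=> [|b IH] p.
  move=> _; rewrite /= -!/(unitrow C r _); have [lt_p|le_p] := ltnP p r; last first.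
    rewrite unitrow_out // mul0mx; case: eqP => [<-|_]; rewrite ?addr0 //.
    by rewrite unitrow_out ?scaler0 ?addr0 // ltnW.
  have -> : unitrow C r p = delta_mx 0 (Ordinal lt_p) by rewrite -unitrow_ord.
  rewrite -rowE [X in row _ X]mx_rowsE row_upbid_mul /=.
  rewrite -(unitrow_ord C (Ordinal lt_p)) /=; congr (_ + _).
  case: ltnP => [_|le_p]; case: eqP => [def_i|_]; rewrite ?scale0r //; first by rewrite def_i.
  by rewrite unitrow_out ?scaler0 -?def_i.
move=> ltb; rewrite [rowv y _ _]/= mulmxDl -scalemxAl (IH _ (ltnW ltb)) zrat_scaled //.
have Dn := D_neq0 (ltnW ltb); have Dn1 := D_neq0 ltb.
have zn q : zrat x b q != 0 by apply: zrat_neq0.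
have eprodS : eprod x i b = zrat x b i / zrat x b i.-1 * eprod x i b.+1.
  by rewrite /eprod big_ltn.
have Drec := D_rec ltb; rewrite /esum_term in Drec.
set g := upbid _ _.
have -> : (if (b < p <= b + r)%N then rowv y b p.-1 else 0) *m g =
    if (b < p <= b + r)%N then rowv x b p.-1 + (if p == i then beta b *: rowv x b i else 0) else 0.
  case: ifP => [/andP[lt_bp _]|_]; last by rewrite mul0mx.
  by rewrite IH ?(ltnW ltb) // prednK // (leq_trans _ lt_bp).
rewrite [rowv x _ p]/= [rowv x _ i]/=; case: eqP => [def_i|/eqP p_neq].
  have zE : zrat x b p * (D b / D b.+1) =
      zrat x b p + (if active i b then d * eprod x i b.+1 / D b.+1 else 0).
    rewrite Drec -def_i /=; case: ifP => _; last by rewrite addr0 divff ?mulr1 ?addr0.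
    by field; rewrite Dn1 zn.
  have bE : zrat x b p * (D b / D b.+1) * (d * eprod x i b / D b) =
      d * eprod x i b.+1 / D b.+1 * zrat x b i.
    by rewrite eprodS -def_i /=; field; rewrite Dn Dn1 zn.
  rewrite scalerDr scalerA bE zE scalerDl scalerDr scalerA /active -def_i ltn_eqF //=.
  case: ifP => _; rewrite !(addr0, scale0r, scaler0);
    apply/rowP => c; rewrite !mxE; case: ifP => _; rewrite ?mxE; ring.
case: eqP => [def_p|_]; last by rewrite !addr0.
rewrite def_p /active -/(active i b) !addr0.
have zE : (if active i b then zrat x b i * (D b.+1 / D b) + beta b
           else zrat x b i * (D b.+1 / D b)) = zrat x b i.
  case: ifP => act; last by rewrite Drec act addr0 divff ?mulr1.
  have -> : D b.+1 = D b - d * (eprod x i b.+1 / zrat x b i.-1) by rewrite Drec act addrK.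
  by rewrite /beta eprodS; field; rewrite Dn zn.
rewrite [RHS]/= -/(active i b) -[in RHS]zE; case: ifP => _; rewrite ?addr0 // scalerDl -!addrA.
by congr (_ + _); rewrite addrC.
Qed.

End Pass.
End CrystalPass.

(** * Plücker coordinates as minors on increasing sequences of rows *)

Section Plucker.
Variables (C : fieldType) (n r : nat).
Implicit Types (M : 'M[C]_(n, r)) (f : nat -> nat) (I : seq int).

Lemma mem_zitv a b (m : int) : (m \in zitv a b) = (a <= m <= b).
Proof.
apply/mapP/andP => [[l + ->]|[le_am le_mb]]; first by rewrite mem_iota; lia.
exists `|m - a|%N; last by lia.
by rewrite mem_iota; lia.
Qed.

(** All the intervals that occur lie in (-n, n], where a residue class has only the representatives
    j and j - n. *)
Lemma mem_residues I (j : 'I_n) : all (fun m : int => - n%:Z < m <= n%:Z) I ->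
  (j \in residues n I) = (j.+1%:Z \in I) || (j.+1%:Z - n%:Z \in I).
Proof.
move=> /allP hI; rewrite inE; have ltj := ltn_ord j.
apply/hasP/orP => [[m mI]|].
  have := hI m mI => /andP[m_gt m_le].
  rewrite eqz_mod_dvd => /dvdzP[q Eq].
  have q0 : q = 0 \/ q = -1 by nia.
  case: q0 Eq => -> Eq; [left|right].
    by have E : j.+1%:Z = m :> int; [lia | rewrite E].
  by have E : j.+1%:Z - n%:Z = m :> int; [lia | rewrite E].
case=> mI; [exists j.+1%:Z => //|exists (j.+1%:Z - n%:Z) => //].
by rewrite eqz_mod_dvd; apply/dvdzP; exists (-1); lia.
Qed.

Definition pminor M f : C := \det (\matrix_(a < r) rw M (f a)).

Lemma plucker_pminor M I f :
    (forall a, (a < r)%N -> (f a < n)%N) ->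
    (forall a b, (a < b < r)%N -> (f a < f b)%N) ->
    (forall j : 'I_n, (j \in residues n I) <-> exists2 a, (a < r)%N & f a = j) ->
  plucker I M = pminor M f.
Proof.
move=> lt_f mono_f memI; rewrite /plucker; set J := residues n I.
have Eenum : [seq val j | j <- enum J] = [seq f a | a <- iota 0 r].
  apply: (irr_sorted_eq ltn_trans ltnn).
  - rewrite sorted_map; have -> : enum J = filter (mem J) (enum 'I_n) by rewrite enumT.
    apply: (@sorted_filter _ (relpre val ltn)); first by move=> a b c; apply: ltn_trans.
    by rewrite -sorted_map val_enum_ord iota_ltn_sorted.
  - rewrite sorted_map; apply/(sortedP 0%N) => a; rewrite size_iota => lta /=.
    by rewrite !nth_iota ?(ltnW lta) // !add0n mono_f // ltnSn.
  - move=> j; apply/mapP/mapP => [[j' + ->]|[a + ->]].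
      by rewrite mem_enum => /memI[a lta E]; exists a; rewrite ?mem_iota.
    rewrite mem_iota /= add0n => lta; exists (Ordinal (lt_f a lta)) => //.
    by rewrite mem_enum; apply/memI; exists a.
have cardJ : #|J| = r by rewrite cardE -(size_map val) Eenum size_map size_iota.
rewrite /minor; case: eqP => // e; rewrite /pminor; congr (\det _).
apply/matrixP => a b; rewrite !mxE.
have Ev : val (enum_val (cast_ord (esym e) a)) = f a.
  have j0 := enum_val (cast_ord (esym e) a).
  rewrite (enum_val_nth j0) -(nth_map j0 0%N) -?cardE ?cardJ ?ltn_ord //=.
    by rewrite Eenum (nth_map 0%N) ?size_iota // nth_iota.
by rewrite -Ev rw_ord mxE.
Qed.

Lemma pminor_mul M (g : 'M[C]_r) f : pminor (M *m g) f = pminor M f * \det g.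
Proof.
rewrite /pminor -det_mulmx; congr (\det _).
by apply/row_matrixP => a; rewrite row_mul !rowK rw_mulmx.
Qed.

Lemma eq_pminor M M' f f' : (forall a, (a < r)%N -> rw M (f a) = rw M' (f' a)) ->
  pminor M f = pminor M' f'.
Proof.
by move=> E; congr (\det _); apply/row_matrixP => a; rewrite !rowK E.
Qed.

Lemma det_row_comb (A B : 'M[C]_r) (w : 'rV[C]_r) (q0 : 'I_r) :
  (forall q, q != q0 -> row q A = row q B) -> row q0 A = w *m B ->
  \det A = w 0 q0 * \det B.
Proof.
move=> eqAB eqq0; have cofE j : cofactor A q0 j = cofactor B q0 j.
  congr (_ * \det _); apply/row_matrixP => i; apply/rowP => c; rewrite !mxE.
  have /rowP/(_ (lift j c)) := eqAB (lift q0 i) (negbT (lift_eqF q0 i)).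
  by rewrite !mxE.
rewrite (expand_det_row A q0).
have -> : \sum_j A q0 j * cofactor A q0 j = (row q0 A *m \adj B) 0 q0.
  by rewrite mxE; apply: eq_bigr => j _; rewrite cofE !mxE.
by rewrite eqq0 -mulmxA mul_mx_adj mul_mx_scalar mxE mulrC.
Qed.

(** If two matrices differ in one row and a linear form vanishes on all the others, the ratio of the
    determinants is the ratio of its values on that row. The minors of the decoration are compared
    with interval minors in this way. *)
Lemma det_row_form (A B : 'M[C]_r) (l : 'cV[C]_r) (q0 : 'I_r) : \det B != 0 ->
  (forall q, q != q0 -> row q A = row q B /\ row q B *m l = 0) ->
  \det A * (row q0 B *m l) 0 0 = \det B * (row q0 A *m l) 0 0.
Proof.
move=> dB eqAB; have Bu : B \in unitmx by rewrite unitmxE unitfE.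
pose w := row q0 A *m invmx B; have wB : row q0 A = w *m B by rewrite mulmxKV.
rewrite (det_row_comb (w := w) (fun q hq => (eqAB q hq).1) wB) wB.
suff -> : w *m B *m l = w 0 q0 *: (row q0 B *m l) by rewrite !mxE; ring.
rewrite (mulmx_sum_row w) mulmx_suml (bigD1 q0) //= -scalemxAl big1 ?addr0 // => q hq.
by rewrite -scalemxAl (eqAB q hq).2 scaler0.
Qed.

End Plucker.

Section ThetaMinors.
Variables (C : fieldType) (n k : nat).
Hypotheses (k0 : (0 < k)%N) (lt_kn : (k < n)%N).
Local Notation r := (n - k)%N.
Implicit Types x y : {ffun coordk n k -> C}.
Local Notation arr := (arrT 1).
Let le_kn : (k <= n)%N := ltnW lt_kn.

(* the rows (from 0) of the cyclic interval [i-r+1,i], in increasing order *)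
Definition intv_row (i a : nat) : nat :=
  if (i < r)%N then if (a < i)%N then a else (a + k)%N else (a + (i - r))%N.

Lemma intv_row_lt i a : (i <= n)%N -> (a < r)%N -> (intv_row i a < n)%N.
Proof. by rewrite /intv_row => lei lta; case: ifP => _; try case: ifP => _; lia. Qed.

Lemma intv_row_mono i a b : (a < b < r)%N -> (intv_row i a < intv_row i b)%N.
Proof. by rewrite /intv_row => ltab; case: ifP => _; do 2?case: ifP => ?; lia. Qed.

Lemma plucker_interval (M : 'M[C]_(n, r)) (a m : int) (i : nat) :
    (i <= n)%N -> m = i%:Z \/ (r <= i)%N /\ m = i%:Z - n%:Z -> a = m - r%:Z + 1 ->
  plucker (zitv a m) M = pminor M (intv_row i).
Proof.
move=> lei hm ->; apply: plucker_pminor.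
- by move=> b; apply: intv_row_lt.
- by move=> b c; apply: intv_row_mono.
move=> j; have ltj := ltn_ord j; rewrite mem_residues; last first.
  by apply/allP => m'; rewrite mem_zitv; lia.
rewrite !mem_zitv /intv_row; split=> [hj|[b ltb]].
  have [lti|gei] := ltnP i r; last by exists (j - (i - r))%N; lia.
  have [ltji|leij] := ltnP j i; first by exists j; [lia|rewrite ltji].
  exists (j - k)%N; first by lia.
  by case: ifP => ?; lia.
by case: ifP => ?; try case: ifP => ?; lia.
Qed.

(** The entries with a < i - r, all equal to t, are left out; they account for the explicit powers
    of t in gamma and epsilon. *)
Definition intv_prod x (i : nat) : C := \prod_(i - r <= a < k) arr x a i.

Lemma prod_zrat x a m l : in_torus x ->
  \prod_(q < l) zrat x a (m + q) = arr x a (m + l) / arr x a m.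
Proof.
move=> hx; have X0 j : arr x a j != 0 by apply: arr_neq0.
elim: l => [|l IH]; first by rewrite big_ord0 addn0 divff.
by rewrite big_ord_recr IH /= /zrat addnS mulrC mulrA divfK.
Qed.

(** At a = m the rows form a frame. Since m <= a, each further factor acts on them by a lower
    bidiagonal matrix, whose diagonal entries telescope. *)
Lemma det_rowv_interval x m a : in_torus x -> (m <= a)%N ->
  \det (\matrix_(q < r) rowv x a (m + q)) = \prod_(m <= b < a) arr x b (m + r).
Proof.
move=> hx; elim: a => [|a IH]; first by rewrite leqn0 => /eqP->; rewrite big_geq // -/(frame x 0) det_frame.
rewrite leq_eqVlt => /predU1P[->|le_ma]; first by rewrite big_geq // -/(frame x a.+1) det_frame.
rewrite big_nat_recr //= -IH //.
have -> : \matrix_(q < r) rowv x a.+1 (m + q) =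
    @lobid C r (fun q => zrat x a (m + q)) (fun q => (a < m + q <= a + r)%N%:R) *m
    \matrix_(q < r) rowv x a (m + q).
  apply/row_matrixP => q; rewrite (@row_lobid_mul _ _ _ _ (fun q => rowv x a (m + q))) rowK /=.
  congr (_ + _); case: (nat_of_ord q) => [|q'] /=; last by rewrite addnS; case: ifP; rewrite ?scale1r ?scale0r.
  by rewrite addn0 ltnNge -ltnS le_ma.
rewrite det_mulmx det_lobid prod_zrat // mulrC; congr (_ * _).
by rewrite [X in _ / X]arr_lo ?divr1.
Qed.

(* block diagonal, with a lower and an upper triangular block *)
Lemma det_split_trig l (A : 'M[C]_l) i :
    (forall q c : 'I_l, (q < i)%N -> (q < c)%N -> A q c = 0) ->
    (forall q c : 'I_l, (i <= q)%N -> (c < q)%N -> A q c = 0) ->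
  \det A = \prod_q A q q.
Proof.
move=> lowA upA.
pose T1 : 'M[C]_l := \matrix_q (if (q < i)%N then row q A else delta_mx 0 q).
pose T2 : 'M[C]_l := \matrix_q (if (q < i)%N then delta_mx 0 q else row q A).
have AE : A = T2 *m T1.
  apply/row_matrixP => q; rewrite row_mul rowK; case: ifP => [lt_qi|/negbT].
    by rewrite -rowE rowK lt_qi.
  rewrite -leqNgt => le_iq; apply/rowP => c; rewrite !mxE (bigD1 c) //=.
  rewrite big1 => [|d dc]; rewrite !mxE.
    rewrite addr0; case: ltnP => [lt_ci|le_ic]; rewrite !mxE ?eqxx ?mulr1 //.
    by rewrite upA ?mul0r // (leq_trans lt_ci).
  case: ltnP => [lt_di|le_id]; first by rewrite upA ?mul0r // (leq_trans lt_di).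
  by rewrite mxE eqxx (eq_sym c) (negPf dc) mulr0.
rewrite AE det_mulmx -(det_tr T2) !det_trig; last first.
- apply/is_trig_mxP => q c lt_qc; rewrite !mxE; case: ltnP => [lt_ci|le_ic]; rewrite !mxE.
    by rewrite eqxx -val_eqE /= ltn_eqF.
  by rewrite upA.
- apply/is_trig_mxP => q c lt_qc; rewrite !mxE; case: ltnP => [lt_ci|le_ic]; rewrite !mxE.
    by rewrite lowA.
  by rewrite eqxx -val_eqE /= gtn_eqF.
rewrite -AE -big_split /=; apply: eq_bigr => q _; rewrite !mxE.
by case: ltnP => _; rewrite !mxE !eqxx ?mul1r ?mulr1.
Qed.

Lemma rowv_lower x a p (c : 'I_r) : (p < c)%N -> rowv x a p 0 c = 0.
Proof.
elim: a p => [|a IH] p ltp /=.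
  case: insubP => [q _ def_q|_]; rewrite !mxE // eqxx.
  by rewrite -val_eqE /= def_q gtn_eqF.
rewrite !mxE IH // mulr0 add0r; case: ifP => _; rewrite ?mxE // IH //.
exact: leq_ltn_trans (leq_pred p) ltp.
Qed.

Lemma rowv_diagonal x a (c : 'I_r) : rowv x a c 0 c = \prod_(b < a) zrat x b c.
Proof.
elim: a => [|a IH] /=; first by rewrite big_ord0 valK mxE !eqxx.
rewrite !mxE big_ord_recr /= IH mulrC; case: ifP => [/andP[lt_a _]|_]; rewrite ?mxE ?addr0 //.
by rewrite rowv_lower ?addr0 // prednK // (leq_trans _ lt_a).
Qed.

Lemma frame_upper x a (q c : 'I_r) : (c <= q)%N -> frame x a q c = (c == q)%:R.
Proof.
elim: a q c => [|a IH] q c le_cq.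
  by rewrite frame0 mxE eq_sym.
rewrite frameS mxE (bigD1 q) //= !mxE eqxx ltn_eqF // mulr0 addr0 mul1r -[rowv _ _ _ _ _]/(_ 0 c).
have -> : rowv x a (a + q) 0 c = frame x a q c by rewrite mxE.
rewrite IH // big1 ?addr0 // => d dq; rewrite !mxE (negPf dq) add0r.
case: eqP => [def_d|_]; last by rewrite mulr0 mul0r.
have -> : rowv x a (a + d) 0 c = frame x a d c by rewrite mxE.
by rewrite IH ?def_d ?(leqW le_cq) // -val_eqE /= def_d ltn_eqF ?mulr0 // ltnS.
Qed.

(** Superdiagonal entries of unipotent upper triangular matrices add up under multiplication. *)
Lemma frame_super x a (q c : 'I_r) : c = q.+1 :> nat ->
  frame x a q c = \sum_(b < a) zrat x b (b.+1 + q).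
Proof.
move=> def_c; elim: a => [|a IH].
  by rewrite big_ord0 frame0 mxE -val_eqE /= def_c ltn_eqF.
have fE (d : 'I_r) : rowv x a (a + d) 0 c = frame x a d c by rewrite mxE.
have neq_cq : c != q by rewrite -val_eqE /= def_c gtn_eqF.
rewrite frameS mxE (bigD1 q) //= (bigD1 c) //= !mxE eqxx (negPf neq_cq) !fE IH.
rewrite frame_upper // def_c !eqxx (ltn_eqF (ltnSn q)) !mulr0 addr0 !mul1r add0r !mulr1.
rewrite big_ord_recr /=; congr (_ + _); rewrite big1 ?addr0 // => d /andP[dq dc].
rewrite !mxE (negPf dq) add0r; case: eqP => [def_d|_]; last by rewrite mulr0 mul0r.
by case/eqP: dc; apply: val_inj; rewrite /= def_d def_c.
Qed.

Lemma rw_Theta x p : in_torus x -> (p < n)%N -> rw (Theta x).1 p = rowv x k p.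
Proof. exact: row_Theta. Qed.

(** For i < r the cyclic interval wraps around: its first i rows are lower triangular, and the
    others belong to the unipotent frame k. For i >= r it consists of consecutive rows. *)
Lemma pminor_Theta x i : in_torus x -> (i <= n)%N ->
  pminor (Theta x).1 (intv_row i) = intv_prod x i.
Proof.
move=> hx lei; rewrite /pminor /intv_prod.
have -> : \matrix_(a < r) rw (Theta x).1 (intv_row i a) = \matrix_(a < r) rowv x k (intv_row i a).
  by apply/row_matrixP => a; rewrite !rowK rw_Theta // intv_row_lt.
have [lti|gei] := ltnP i r; last first.
  have -> : \matrix_(a < r) rowv x k (intv_row i a) = \matrix_(a < r) rowv x k (i - r + a).
    by apply/row_matrixP => a; rewrite !rowK /intv_row ltnNge gei /= addnC.
  by rewrite det_rowv_interval ?subnK //; lia.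
rewrite (@det_split_trig _ _ i) => [|q c ltq ltqc|q c leq ltcq]; first last.
- rewrite mxE /intv_row lti ltnNge leq /= addnC.
  have -> : rowv x k (k + q) 0 c = frame x k q c by rewrite mxE.
  by rewrite frame_upper -?val_eqE /= ?(ltnW ltcq) // ltn_eqF.
- by rewrite mxE /intv_row lti ltq rowv_lower.
rewrite (eq_bigr (fun q : 'I_r => if (q < i)%N then \prod_(b < k) zrat x b q else 1)); last first.
  move=> q _; rewrite mxE /intv_row lti; case: ltnP => [ltq|leq]; first by rewrite rowv_diagonal.
  rewrite addnC; have -> : rowv x k (k + q) 0 q = frame x k q q by rewrite mxE.
  by rewrite frame_upper // eqxx.
rewrite -big_mkcond /= -(big_ord_widen r (fun q => \prod_(b < k) zrat x b q) (ltnW lti)).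
rewrite exchange_big /= (_ : (i - r = 0)%N) ?big_mkord; last by lia.
apply: eq_bigr => b _; have := @prod_zrat x b 0 i hx.
by rewrite [arr x b 0]arr_lo // divr1.
Qed.

Lemma intv_prod_neq0 x i : in_torus x -> intv_prod x i != 0.
Proof. by move=> hx; rewrite prodf_seq_neq0; apply/allP => a _; apply: arr_neq0. Qed.

End ThetaMinors.

Section Components.
Variables (C : fieldType) (n r : nat).
Implicit Types p : Xpoint C n r.

Lemma gammaE i p : gamma i p =
  let l := rep1n n i in (if (l <= r)%N then 1 else p.2)
  * plucker (zitv (l%:Z - r%:Z + 1) l%:Z) p.1 / plucker (zitv (l%:Z - r%:Z) (l%:Z - 1)) p.1.
Proof. by case: p. Qed.

Lemma phiE i p : phi i p =
  p.2 ^- (i == 0%N)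
  * plucker (zitv (i%:Z - r%:Z + 1) (i%:Z - 1) ++ [:: i%:Z + 1]) p.1
  / plucker (zitv (i%:Z - r%:Z + 1) i%:Z) p.1.
Proof. by case: p. Qed.

Lemma epsilonE i p : epsilon i p =
  p.2 ^- (i == r)
  * (plucker (zitv (i%:Z - r%:Z + 1) (i%:Z - 1) ++ [:: i%:Z + 1]) p.1
     * plucker (zitv (i%:Z - r%:Z + 1) i%:Z) p.1)
  / (plucker (zitv (i%:Z - r%:Z) (i%:Z - 1)) p.1
     * plucker (zitv (i%:Z - r%:Z + 2) (i%:Z + 1)) p.1).
Proof. by case: p. Qed.

Lemma ecrystalE i c p : ecrystal i c p =
  (xmx n i ((if i == 0%N then (-1) ^+ r.-1 / p.2 else 1) * ((c - 1) / phi i p)) *m p.1, p.2).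
Proof. by case: p. Qed.

End Components.

(** * The crystal functions and the operators for nonzero i *)

Section CrystalTheta.
Variables (C : fieldType) (n k : nat).
Hypotheses (k0 : (0 < k)%N) (lt_kn : (k < n)%N).
Local Notation r := (n - k)%N.
Implicit Types x y : {ffun coordk n k -> C}.
Local Notation arr := (arrT 1).
Let le_kn : (k <= n)%N := ltnW lt_kn.

Lemma rw_xmx i c (M : 'M[C]_(n, r)) p : (0 < i)%N -> (p < n)%N ->
  rw (xmx n i c *m M) p = rw M p + (if p.+1 == i then c *: rw M i else 0).
Proof.
move=> i0 ltp; rewrite /xmx gtn_eqF // mulmxDl mul1mx rwD -scalemxAl rwZ rw_Emx //=.
by case: ifP => _; rewrite ?scaler0.
Qed.

Lemma rw_xmx0 c (M : 'M[C]_(n, r)) p : (p < n)%N ->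
  rw (xmx n 0 c *m M) p = rw M p + (if p.+1 == n then c *: rw M 0 else 0).
Proof.
move=> ltp; rewrite /xmx eqxx mulmxDl mul1mx rwD -scalemxAl rwZ rw_Emx //=.
by case: ifP => _; rewrite ?scaler0.
Qed.

Definition phi_row (i a : nat) : nat :=
  if intv_row n k i a == i.-1 then i else intv_row n k i a.

Lemma plucker_phi (M : 'M[C]_(n, r)) (i : nat) : (0 < i < n)%N ->
  plucker (zitv (i%:Z - r%:Z + 1) (i%:Z - 1) ++ [:: i%:Z + 1]) M = pminor M (phi_row i).
Proof.
move=> lti; apply: plucker_pminor.
- move=> a lta; rewrite /phi_row; case: ifP => _; first by lia.
  by apply: intv_row_lt => //; lia.
- move=> a b ltab; rewrite /phi_row /intv_row.
  by case: (ltnP i r) => ?; case: (ltnP a i) => ?; case: (ltnP b i) => ?;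
    do ?case: eqP => ?; lia.
move=> j; have ltj := ltn_ord j; rewrite mem_residues; last first.
  by apply/allP => m'; rewrite mem_cat mem_zitv mem_seq1; lia.
rewrite !mem_cat !mem_zitv !mem_seq1 /phi_row /intv_row; split=> [hj|[b ltb]].
  have [lti'|gei] := ltnP i r.
    have [ltji|leij] := ltnP j i; first by exists j; [lia|rewrite ltji; case: eqP; lia].
    have [->|neq_ji] := eqVneq (nat_of_ord j) i.
      by exists i.-1; [lia|case: ltnP => ?; rewrite ?eqxx //; lia].
    exists (j - k)%N; first by lia.
    by case: ltnP => ?; [lia|case: eqP; lia].
  have [->|neq_ji] := eqVneq (nat_of_ord j) i.
    by exists r.-1; [lia|case: eqP; lia].
  by exists (j - (i - r))%N; [lia|case: eqP; lia].
by case: (ltnP i r) => ?; [case: (ltnP b i) => ?|]; case: eqP => ?; lia.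
Qed.

Lemma pminor_xmx i c (M : 'M[C]_(n, r)) : (0 < i < n)%N ->
  pminor (xmx n i c *m M) (intv_row n k i)
  = pminor M (intv_row n k i) + c * pminor M (phi_row i).
Proof.
move=> lti; have r0 : (0 < r)%N by lia.
have lt_a0 : ((if (i < r)%N then i.-1 else r.-1) < r)%N by case: ifP; lia.
pose a0 := Ordinal lt_a0.
have a0E : intv_row n k i a0 = i.-1.
  by rewrite /intv_row /=; case: (ltnP i r) => ?; [case: ltnP; lia|lia].
have neq_a (a : 'I_r) : a != a0 -> (intv_row n k i a == i.-1) = false.
  rewrite -val_eqE /= /intv_row => /eqP.
  by case: (ltnP i r) => ?; [case: (ltnP a i) => ?|] => neq; apply/eqP; lia.
have lt_row a : (a < r)%N -> (intv_row n k i a < n)%N.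
  by move=> lta; apply: intv_row_lt => //; lia.
rewrite -[X in X + _]mul1r /pminor; apply: (determinant_multilinear (i0 := a0)).
- rewrite !rowK rw_xmx ?lt_row //; last by lia.
  by rewrite a0E /phi_row a0E eqxx prednK ?eqxx ?scale1r //; lia.
- apply/row_matrixP => a; rewrite !row_rowsub !rowK.
  rewrite rw_xmx ?lt_row //; last by lia.
  have := neq_a (lift a0 a) (negbT (lift_eqF a0 a)).
  rewrite -eqSS prednK; last by lia.
  by move=> ->; rewrite addr0.
- apply/row_matrixP => a; rewrite !row_rowsub !rowK.
  rewrite rw_xmx ?lt_row //; last by lia.
  have := neq_a (lift a0 a) (negbT (lift_eqF a0 a)); rewrite /phi_row => E; rewrite E.
  move: E; rewrite -eqSS prednK; last by lia.
  by move=> ->; rewrite addr0.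
Qed.

(** The bounds of the sum select the active rows. From b = k down to b = i - r the value goes from
    phi_i to c times phi_i. *)
Definition esum x i c b : C :=
  \sum_(i - r <= b' < minn i k) (if (b <= b')%N then c else 1) * esum_term x i b'.

Definition phi_sum x i : C := \sum_(i - r <= b' < minn i k) esum_term x i b'.

Lemma esum_rec x i c b : (b < k)%N ->
  esum x i c b = esum x i c b.+1 + (if active n k i b then (c - 1) * esum_term x i b else 0).
Proof.
move=> ltb; have -> : active n k i b = (i - r <= b < minn i k)%N.
  by rewrite /active leq_min ltb andbT andbC; congr (_ && _); lia.
rewrite -(big_nat1_eq +%R (fun b' => (c - 1) * esum_term x i b')) big_mkcond -big_split /=; apply: eq_bigr => b' _.
by case: (ltngtP b b') => _; rewrite ?addr0 // -mulrDl addrC subrK.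
Qed.

Lemma esum_last x i c : esum x i c k = phi_sum x i.
Proof.
apply: eq_big_nat => b' /andP[_]; rewrite leq_min => /andP[_ ltb].
by rewrite leqNgt ltb mul1r.
Qed.

Lemma esum_first x i c b : (b <= i - r)%N -> esum x i c b = c * phi_sum x i.
Proof.
move=> leb; rewrite big_distrr; apply: eq_big_nat => b' /andP[leb' _].
by rewrite (leq_trans leb leb').
Qed.

Definition e_coords x i c := scale_column x i (esum x i c).

Section Apply.
Variables (x : {ffun coordk n k -> C}) (i : nat) (c : C).
Hypotheses (hx : in_torus x) (lti : (0 < i < n)%N).
Hypothesis esum_neq0 : forall b, (b <= k)%N -> esum x i c b != 0.

Lemma xmx_Theta : exists2 g : 'M[C]_r, \det g = 1 &
  xmx n i ((c - 1) / phi_sum x i) *m (Theta x).1 = (Theta (e_coords x i c)).1 *m g.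
Proof.
have i0 : (0 < i)%N by lia.
have [g dg hg] := scale_column_pass le_kn hx (@esum_rec x i c) esum_neq0.
have hy : in_torus (e_coords x i c) := scale_column_torus i hx esum_neq0.
exists g => //; apply: rw_inj => p ltp; rewrite [RHS]rw_mulmx rw_xmx // !rw_Theta //; last by lia.
rewrite hg // esum_last /eprod big_geq // mulr1.
by case: ifP.
Qed.

(** The factors [esum] b / [esum] (b + 1) of column i telescope to c. *)
Lemma intv_prod_e_coords : intv_prod (e_coords x i c) i = c * intv_prod x i.
Proof.
have E := arr_scaled le_kn (@esum_rec x i c) esum_neq0.
rewrite /intv_prod (eq_big_nat _ _ (F2 := fun b => arr x b i * (esum x i c b / esum x i c b.+1))).
  rewrite big_split /= mulrC; congr (_ * _).
  rewrite telescope_prodr; last by lia.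
    rewrite esum_last esum_first // mulfK // -(esum_last x i c); exact: esum_neq0.
  by move=> b ltb; rewrite unitfE esum_neq0 //; lia.
by move=> b /andP[_ ltb]; rewrite /e_coords E // eqxx.
Qed.

Lemma e_coords_torus : in_torus (e_coords x i c).
Proof. exact: scale_column_torus. Qed.

End Apply.

(** Adding a times row i + 1 to row i changes the interval minor P to P + a P', where P' is the
    minor in the numerator of phi_i. With a = (c - 1) / [phi_sum] the new minor is c P, so P' / P
    equals [phi_sum]; taking c = 2 makes c - 1 equal to 1. *)
Lemma phi_Theta x i : in_torus x -> (0 < i < n)%N ->
  (forall b, (b <= k)%N -> esum x i (1 + 1) b != 0) -> phi i (Theta x) = phi_sum x i.
Proof.
move=> hx lti nz; rewrite phiE gtn_eqF ?(andP lti).1 // expr0 invr1 mul1r.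
rewrite plucker_phi // (plucker_interval k0 lt_kn _ (i := i)) //; [|by lia|by left].
have N0 : intv_prod x i != 0 by apply: intv_prod_neq0.
have p0 : phi_sum x i != 0 by rewrite -(esum_last x i (1 + 1)) nz.
have [g dg /(congr1 (fun M => pminor M (intv_row n k i)))] := xmx_Theta hx lti nz.
rewrite pminor_mul dg mulr1 pminor_xmx //.
rewrite !pminor_Theta ?intv_prod_e_coords //; try lia; last exact: e_coords_torus.
rewrite addrK mulrDl !mul1r => /addrI E.
by rewrite -E invfM invrK mulrCA divff ?mulr1 //; apply: contraNneq N0 => P0; rewrite -E P0 mulr0.
Qed.

Lemma ecrystal_Theta x i c : in_torus x -> (0 < i < n)%N ->
  (forall b, (b <= k)%N -> esum x i (1 + 1) b != 0) ->
  (forall b, (b <= k)%N -> esum x i c b != 0) ->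
  same_Xpoint (Theta (e_coords x i c)) (ecrystal i c (Theta x)).
Proof.
move=> hx lti nz2 nzc; have [g dg E] := xmx_Theta hx lti nzc.
apply: same_Xpoint_sym; apply: (same_Xpoint_mul (g := g)); first by rewrite unitmxE dg unitr1.
  by rewrite ecrystalE -E -(phi_Theta hx lti nz2) ifF ?mul1r // gtn_eqF ?(andP lti).1.
by rewrite ecrystalE /= ffunE.
Qed.

Lemma gamma_Theta x l : in_torus x -> (0 < l <= n)%N ->
  gamma l (Theta x) = (if (l <= r)%N then 1 else x None) * (intv_prod x l / intv_prod x l.-1).
Proof.
move=> hx ltl; rewrite gammaE /rep1n gtn_eqF ?(andP ltl).1 // -mulrA; congr (_ * (_ / _)).
  rewrite (plucker_interval k0 lt_kn _ (i := l)) //; [|by lia|by left].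
  by apply: pminor_Theta => //; lia.
rewrite (plucker_interval k0 lt_kn _ (i := l.-1)) //; try lia.
by apply: pminor_Theta => //; lia.
Qed.

Lemma gamma0_Theta x : gamma 0 (Theta x) = gamma n (Theta x).
Proof. by rewrite !gammaE /rep1n eqxx; case: (n == 0%N). Qed.

(** The numerator minor is common to epsilon_i and phi_i, so their quotient involves interval minors
    only. *)
Lemma epsilon_Theta x i : in_torus x -> (i < n)%N ->
  epsilon i (Theta x) = phi i (Theta x) * (x None ^+ (i == 0%N) / x None ^+ (i == r) *
   (intv_prod x i * intv_prod x i /
    (intv_prod x (if i == 0%N then n.-1 else i.-1) * intv_prod x i.+1))).
Proof.
move=> hx lti; rewrite epsilonE phiE.
have r0 : (0 < r)%N by lia.
rewrite (plucker_interval k0 lt_kn _ (i := i) (m := i%:Z)) //; [|by lia|by left].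
rewrite (plucker_interval k0 lt_kn _ (m := i%:Z + 1) (i := i.+1)) //; try lia.
rewrite (plucker_interval k0 lt_kn _ (m := i%:Z - 1) (i := if i == 0%N then n.-1 else i.-1)); first last.
- by lia.
- by case: eqP; lia.
- by case: eqP; lia.
have lt_pred : ((if i == 0%N then n.-1 else i.-1) <= n)%N by case: eqP; lia.
rewrite !pminor_Theta //; try lia.
have t0 m : x None ^+ m != 0 by rewrite expf_neq0.
have P0 j := intv_prod_neq0 j hx.
move: (plucker _ _) (x None ^+ (i == 0%N)) (x None ^+ (i == r)) (t0 (i == 0%N)) (t0 (i == r)).
move=> P t1 t2 t10 t20; field.
by rewrite !P0 t10 t20.
Qed.

End CrystalTheta.

(** * The decoration in the coordinates *)

Section Decoration.
Variables (C : fieldType) (n k : nat).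
Hypotheses (k0 : (0 < k)%N) (lt_kn : (k < n)%N).
Local Notation r := (n - k)%N.
Implicit Types x y : {ffun coordk n k -> C}.
Local Notation arr := (arrT 1).
Let le_kn : (k <= n)%N := ltnW lt_kn.
Let r0 : (0 < r)%N.
Proof. by rewrite subn_gt0. Qed.

(** The first element i - r + 1 of the cyclic interval is lowered by one. Numbered from 0, its row
    is k + i if i < r, and i - r otherwise. *)
Definition deco_row (i a : nat) : nat :=
  if intv_row n k i a == (if (i < r)%N then k + i else i - r)%N then (intv_row n k i a).-1
  else intv_row n k i a.

Lemma plucker_deco (M : 'M[C]_(n, r)) (i : nat) : (0 < i <= n)%N -> i != r ->
  plucker ((i%:Z - r%:Z) :: zitv (i%:Z - r%:Z + 2) i%:Z) M = pminor M (deco_row i).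
Proof.
move=> lti /eqP neq_ir; apply: plucker_pminor.
- move=> a lta; rewrite /deco_row.
  have : (intv_row n k i a < n)%N by apply: intv_row_lt => //; lia.
  by case: ifP => _ //; lia.
- move=> a b ltab; rewrite /deco_row /intv_row.
  by case: (ltnP i r) => ?; [case: (ltnP a i) => ?; case: (ltnP b i) => ?|];
    do ?case: eqP => ?; lia.
move=> j; have ltj := ltn_ord j; rewrite mem_residues; last first.
  by apply/allP => m'; rewrite inE mem_zitv; lia.
rewrite !inE !mem_zitv /deco_row /intv_row; split=> [hj|[b ltb]].
  have [lti'|gei] := ltnP i r.
    have [ltji|leij] := ltnP j i; first by exists j; [lia|rewrite ltji; case: eqP; lia].
    have [Ej|neq_ji] := eqVneq (nat_of_ord j) (k + i).-1.
      by exists i; [lia|rewrite ltnn; case: eqP; lia].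
    exists (j - k)%N; first by lia.
    by case: ltnP => ?; case: eqP; lia.
  have [Ej|neq_ji] := eqVneq (nat_of_ord j) (i - r).-1.
    by exists 0%N; [lia|case: eqP; lia].
  by exists (j - (i - r))%N; [lia|case: eqP; lia].
by case: (ltnP i r) => ?; [case: (ltnP b i) => ?|]; case: eqP => ?; lia.
Qed.

Definition tdeco_row (a : nat) : nat := if a == r.-1 then n.-1 else a.+1.

Lemma plucker_tdeco (M : 'M[C]_(n, r)) :
  plucker (zitv 2 r%:Z ++ [:: n%:Z]) M = pminor M tdeco_row.
Proof.
apply: plucker_pminor.
- by move=> a lta; rewrite /tdeco_row; case: eqP => ?; lia.
- by move=> a b ltab; rewrite /tdeco_row; do 2?case: eqP => ?; lia.
move=> j; have ltj := ltn_ord j; rewrite mem_residues; last first.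
  by apply/allP => m'; rewrite mem_cat mem_seq1 mem_zitv; lia.
rewrite !mem_cat !mem_seq1 !mem_zitv /tdeco_row; split=> [hj|[b ltb]]; last by case: eqP; lia.
have [Ej|neq_j] := eqVneq (nat_of_ord j) n.-1; first by exists r.-1; [lia|case: eqP; lia].
by exists j.-1; [lia|case: eqP; lia].
Qed.

Section Terms.
Variable x : {ffun coordk n k -> C}.
Hypothesis hx : in_torus x.

Let X0 a j : arr x a j != 0. Proof. exact: arr_neq0. Qed.

Let rowvS a p : rowv x a.+1 p =
  zrat x a p *: rowv x a p + (if (a < p <= a + r)%N then rowv x a p.-1 else 0).
Proof. by []. Qed.

Let pminorE f : (forall a, (a < r)%N -> (f a < n)%N) ->
  pminor (Theta x).1 f = \det (\matrix_(a < r) rowv x k (f a)).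
Proof.
by move=> ltf; congr (\det _); apply/row_matrixP => a; rewrite !rowK rw_Theta // ltf.
Qed.

Let deco_lt i : (0 < i <= n)%N -> forall a, (a < r)%N -> (deco_row i a < n)%N.
Proof.
move=> lti a lta; rewrite /deco_row.
have : (intv_row n k i a < n)%N by apply: intv_row_lt => //; lia.
by case: ifP => _ //; lia.
Qed.

Let intv_lt i : (i <= n)%N -> forall a, (a < r)%N -> (intv_row n k i a < n)%N.
Proof. by move=> lei a lta; apply: intv_row_lt. Qed.

Let rowv_frame (q c : 'I_r) : rowv x k (k + q) 0 c = frame x k q c.
Proof. by rewrite mxE. Qed.

(** The linear form is coordinate i, from 0: it vanishes on the other rows of the interval by
    triangularity, and on the moved row it is a superdiagonal entry of the frame. *)
Lemma pminor_deco_small i : (0 < i < r)%N ->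
  pminor (Theta x).1 (deco_row i) = intv_prod x i * \sum_(a < k) zrat x a (a + i).
Proof.
move=> lti; have ltir : (i < r)%N by lia.
pose q0 := Ordinal ltir; pose l : 'cV[C]_r := delta_mx q0 0.
have lE (u : 'rV[C]_r) : u *m l = (u 0 q0)%:M.
  by rewrite -colE; apply/rowP => c; rewrite !mxE ord1 eqxx mulr1n.
have lE0 (u : 'rV[C]_r) : (u *m l) 0 0 = u 0 q0 by rewrite lE mxE eqxx.
have rowB : intv_row n k i q0 = (k + q0)%N by rewrite /intv_row ltir ltnn addnC.
have rowA : deco_row i q0 = (k + i).-1 by rewrite /deco_row ltir rowB eqxx.
have rowQ (q : 'I_r) : q != q0 -> deco_row i q = intv_row n k i q /\
    rowv x k (intv_row n k i q) *m l = 0.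
  rewrite -val_eqE /= => neq_q; rewrite /deco_row /intv_row ltir lE.
  have [ltq|leq] := ltnP q i.
    have -> : (q == k + i :> nat)%N = false by lia.
    by rewrite rowv_lower // raddf0.
  rewrite addnC eqn_add2l (negPf neq_q) rowv_frame frame_upper // -val_eqE /=.
  by rewrite [i == q]eq_sym (negPf neq_q) raddf0.
have := @det_row_form C r (\matrix_(a < r) rowv x k (deco_row i a))
  (\matrix_(a < r) rowv x k (intv_row n k i a)) l q0.
rewrite -!pminorE ?pminor_Theta //; try (by lia);
  [|by apply: deco_lt; lia|by apply: intv_lt; lia].
rewrite !lE0 !rowK rowA rowB rowv_frame frame_upper // eqxx mulr1 => ->; last 2 first.
- exact: intv_prod_neq0.
- by move=> q /rowQ[Eq El]; rewrite !rowK Eq.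
have lt_i1 : (i.-1 < r)%N by lia.
have -> : rowv x k (k + i).-1 0 q0 = frame x k (Ordinal lt_i1) q0.
  by rewrite -rowv_frame /=; congr (rowv _ _ _ _ _); lia.
congr (_ * _); rewrite frame_super /=; last by lia.
by apply: eq_bigr => a _; congr (zrat _ _ _); lia.
Qed.

(** A linear form given by its values on [frame x m]. The alternating signs and reciprocals make the
    two contributions to each row of factor m cancel, the first row excepted. *)
Definition frame_form m : 'cV[C]_r :=
  invmx (frame x m) *m \col_s ((-1) ^+ s / arr x m (m.+1 + s)).

Lemma frame_formE m s : (s < r)%N ->
  rowv x m (m + s) *m frame_form m = ((-1) ^+ s / arr x m (m.+1 + s))%:M.
Proof.
move=> lts; have -> : rowv x m (m + s) = row (Ordinal lts) (frame x m) by rewrite rowK.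
rewrite -row_mul mulmxA mulmxV ?frame_unit // mul1mx.
by apply/rowP => c; rewrite !mxE ord1 eqxx mulr1n.
Qed.

(** Factor m produces the cancellation; later factors combine only rows that are already killed,
    since they use row p - 1 only for p > a > m. *)
Lemma frame_form_kill m a p : (m < a)%N -> (m < p < m + r)%N ->
  rowv x a p *m frame_form m = 0.
Proof.
elim: a p => // a IH p; rewrite ltnS leq_eqVlt => /predU1P[<-|lt_ma] ltp.
  have -> : p = (m + (p - m.+1).+1)%N by lia.
  have lts : ((p - m.+1).+1 < r)%N by lia.
  move: (p - m.+1)%N lts => s lts; rewrite /= mulmxDl -scalemxAl frame_formE //.
  have -> : (m < m + s.+1 <= m + r)%N by lia.
  have -> : (m + s.+1).-1 = (m + s)%N by lia.
  rewrite frame_formE 1?ltnW // /zrat -!addSnnS; apply/rowP => c.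
  rewrite !mxE ord1 eqxx !mulr1n exprS [(m.+2 + s)%N]addSn.
  by field; rewrite !X0.
rewrite /= mulmxDl -scalemxAl IH // scaler0 add0r; case: ifP => lt_p; last by rewrite mul0mx.
by rewrite IH //; lia.
Qed.

(** With m = i - r, the form [frame_form x m] kills all rows of the interval but the first. The
    moved row m - 1 is expanded in the frame m, where the signs of coordinates and form cancel. *)
Lemma pminor_deco_large i : (r < i < n)%N ->
  pminor (Theta x).1 (deco_row i) = intv_prod x i *
    \sum_(s < r) (arr x (i - r).-1 ((i - r) + s) / arr x (i - r) ((i - r).+1 + s)).
Proof.
move=> lti; pose q0 := Ordinal r0; pose m := (i - r)%N; pose l := frame_form m.
have m0 : (0 < m)%N by rewrite subn_gt0; lia.
have gei : (i < r)%N = false by lia.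
have rowB : intv_row n k i q0 = m by rewrite /intv_row gei.
have rowA : deco_row i q0 = m.-1 by rewrite /deco_row gei rowB eqxx.
have rowQ (q : 'I_r) : q != q0 -> deco_row i q = intv_row n k i q /\
    rowv x k (intv_row n k i q) *m l = 0.
  rewrite -val_eqE /= => neq_q; rewrite /deco_row /intv_row gei -/m.
  rewrite -[X in _ == X]add0n eqn_add2r (negPf neq_q); split=> //.
  by have ltq := ltn_ord q; apply: frame_form_kill; rewrite /m; lia.
have := @det_row_form C r (\matrix_(a < r) rowv x k (deco_row i a))
  (\matrix_(a < r) rowv x k (intv_row n k i a)) l q0.
rewrite -!pminorE ?pminor_Theta //; try (by lia);
  [|by apply: deco_lt; lia|by apply: intv_lt; lia].
rewrite !rowK rowA rowB.
have -> : rowv x k m = arr x m m.+1 *: rowv x m m.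
  by rewrite rowv_stable ?rowv_diag // /m; lia.
have -> : rowv x k m.-1 = frame_coords x m.-1 *m frame x m.
  by rewrite rowv_stable ?rowv_coords ?prednK // /m; lia.
have := @frame_formE m 0%N r0; rewrite addn0 -scalemxAl => ->.
have -> : (arr x m m.+1 *: ((-1) ^+ 0 / arr x m (m.+1 + 0))%:M : 'rV[C]_1) 0 0 = 1.
  by rewrite !mxE addn0 expr0 eqxx mulr1n mul1r divff.
rewrite mulr1 => ->; last 2 first.
- exact: intv_prod_neq0.
- by move=> q /rowQ[Eq El]; rewrite !rowK Eq.
congr (_ * _); rewrite -mulmxA mxE; apply: eq_bigr => s _.
have -> : (frame x m *m l) s 0 = (-1) ^+ s / arr x m (m.+1 + s).
  by rewrite mulmxA mulmxV ?frame_unit // mul1mx mxE.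
rewrite mxE prednK // mulrACA -exprD addnn -mul2n exprM sqrrN expr1n expr1n mul1r.
by [].
Qed.

(** Here the interval is the frame k, of determinant 1, and the minor is the first coordinate of row
    k - 1 in it. *)
Lemma pminor_deco_last :
  pminor (Theta x).1 (deco_row n) = intv_prod x n * arr x k.-1 k.
Proof.
pose q0 := Ordinal r0.
rewrite pminorE; last by apply: deco_lt; lia.
have rE : (n < r)%N = false by lia.
have kE : (n - r = k)%N by lia.
rewrite (@det_row_comb C r _ (frame x k) (frame_coords x k.-1) q0) ?det_frame.
- by rewrite mxE expr0 mul1r mulr1 addn0 prednK // /intv_prod kE big_geq ?mul1r.
- move=> q; rewrite -val_eqE /= => neq_q.
  by rewrite !rowK /deco_row /intv_row rE kE -[X in _ == X]add0n eqn_add2r (negPf neq_q) addnC.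
rewrite rowK /deco_row /intv_row rE kE add0n eqxx.
by rewrite rowv_stable ?rowv_coords ?prednK //; lia.
Qed.

(** The comparison is with the interval [2, r + 1], which differs in the last row only;
    [frame_form x 0] kills the common rows. The last row of every frame is the last unit vector, so
    row n is known, and on row r + 1 the form is multiplied by one ratio per factor. *)
Lemma pminor_tdeco : pminor (Theta x).1 tdeco_row = intv_prod x r / arr x 0 r.
Proof.
have lt_r1 : (r.-1 < r)%N by rewrite prednK.
pose q0 := Ordinal lt_r1; pose l := frame_form 0.
have := @det_row_form C r (\matrix_(a < r) rowv x k (tdeco_row a))
  (\matrix_(a < r) rowv x k (intv_row n k r.+1 a)) l q0.
have tlt a : (a < r)%N -> (tdeco_row a < n)%N.
  by move=> lta; rewrite /tdeco_row; case: eqP => ?; lia.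
rewrite -!pminorE ?pminor_Theta //; try (by lia); last by apply: intv_lt; lia.
have rE : (r.+1 < r)%N = false by lia.
have rowB : intv_row n k r.+1 q0 = r by rewrite /intv_row rE subSnn addn1 /= prednK.
have rowA : tdeco_row q0 = n.-1 by rewrite /tdeco_row eqxx.
rewrite !rowK rowA rowB.
have top a : rowv x a (a + r.-1) = rowv x 0 r.-1.
  elim: a => [//|a IH]; rewrite [LHS]/= rowv_out ?scaler0 ?add0r; last by lia.
  by rewrite -IH ifT; [congr (rowv _ _ _); lia|lia].
have -> : rowv x k n.-1 = rowv x 0 r.-1 by rewrite -(top k); congr (rowv _ _ _); lia.
have lt0 : rowv x 0 r.-1 *m l = ((-1) ^+ r.-1 / arr x 0 r)%:M.
  by rewrite -[X in rowv _ _ X]add0n frame_formE // add1n prednK.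
have side a : (0 < a)%N -> rowv x a r *m l = (\prod_(1 <= b < a) zrat x b r) *: (rowv x 0 r.-1 *m l).
  elim: a => // a IH _; case: a IH => [_|a IH].
    rewrite big_geq // scale1r /= -[X in X *: _ + _]/(zrat x 0 r).
    rewrite -/(unitrow C r r) unitrow_out // scaler0 add0r ifT //.
    by rewrite leqnn r0.
  rewrite rowvS mulmxDl -scalemxAl IH // [in RHS]big_nat_recr // scalerA mulrC.
  case: ifP => [lt_a|_]; last by rewrite mul0mx addr0.
  have r1 : (1 < r)%N by lia.
  suff -> : rowv x a.+1 r.-1 *m l = 0 by rewrite addr0.
  by apply: frame_form_kill; lia.
rewrite (side k) // lt0 !mxE eqxx mulr1n => H.
have sgn0 : (-1) ^+ r.-1 / arr x 0 r != 0 by rewrite mulf_neq0 ?invr_eq0 ?expf_neq0 // oppr_eq0 oner_neq0.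
have z0 : \prod_(1 <= b < k) zrat x b r != 0.
  by rewrite prodf_seq_neq0; apply/allP => b _; apply: zrat_neq0.
have {}H : pminor (Theta x).1 tdeco_row * \prod_(1 <= b < k) zrat x b r
    = intv_prod x r.+1.
  apply: (mulIf sgn0); rewrite -mulrA; apply: H; first exact: intv_prod_neq0.
  move=> q; rewrite -val_eqE /= => /negPf neq_q.
  rewrite !rowK /tdeco_row neq_q /intv_row rE subSnn addn1; split=> //.
  by apply: frame_form_kill => //; have := ltn_ord q; move/eqP: neq_q; lia.
apply: (mulIf z0); rewrite [LHS]H /intv_prod subnn subSnn [X in _ = X / _ * _]big_ltn // mulrAC -mulrA.
rewrite [arr x 0 r * _]mulrC mulrACA mulfV ?X0 // mulr1 -big_split /=; apply: eq_bigr => b _.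
by rewrite /zrat mulrC divfK.
Qed.

Definition deco_term i : C :=
  if (i < r)%N then \sum_(0 <= a < k) zrat x a (a + i)
  else if (i < n)%N then
    \sum_(0 <= s < r) (arr x (i - r).-1 ((i - r) + s) / arr x (i - r) ((i - r).+1 + s))
  else arr x k.-1 k.

Lemma decoration_Theta :
  decoration (Theta x) = \sum_(1 <= i < n.+1 | i != r) deco_term i + x None / arr x 0 r.
Proof.
have -> : decoration (Theta x) = \sum_(1 <= i < n.+1 | i != r)
     plucker ((i%:Z - r%:Z) :: zitv (i%:Z - r%:Z + 2) i%:Z) (Theta x).1
     / plucker (zitv (i%:Z - r%:Z + 1) i%:Z) (Theta x).1
  + x None * (plucker (zitv 2 r%:Z ++ [:: n%:Z]) (Theta x).1 / plucker (zitv 1 r%:Z) (Theta x).1).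
  by [].
have N0 i := intv_prod_neq0 i hx.
congr (_ + _ * _).
  rewrite [LHS]big_seq_cond [RHS]big_seq_cond; apply: eq_bigr => i.
  rewrite mem_index_iota => /andP[lti neq_ir].
  rewrite plucker_deco // (plucker_interval k0 lt_kn _ (i := i)) //; [|by lia|by left].
  rewrite pminor_Theta //; last by lia.
  rewrite /deco_term; move/eqP: neq_ir => neq_ir.
  case: (ltnP i r) => ltir; first by rewrite pminor_deco_small ?big_mkord 1?mulrAC ?divff ?mul1r //; lia.
  case: (ltnP i n) => ltin.
    by rewrite pminor_deco_large ?big_mkord 1?mulrAC ?divff ?mul1r //; lia.
  have -> : i = n by lia.
  by rewrite pminor_deco_last mulrAC divff ?mul1r.
rewrite plucker_tdeco pminor_tdeco (plucker_interval k0 lt_kn _ (i := r)) ?leq_subr //;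
  [|by left|by lia].
by rewrite pminor_Theta ?leq_subr // mulrAC divff ?mul1r.
Qed.

End Terms.
End Decoration.

(** * Birational promotion and the operators for i = 0 *)

Section Toggles.
Variables (C : fieldType) (n k : nat).
Implicit Types x y : {ffun coordk n k -> C}.
Local Notation r := (n - k)%N.
Local Notation X x a q := (arrT 1 x a (a.+1 + q)).

(* The two factors of a birational toggle of the product of chains [k] x [r];
   the neighbours in row a of x' and of x are those above and below. *)
Definition tog_up x x' a q : C :=
  if a == 0%N then if (q.+1 < r)%N then X x' a q.+1 else x None
  else if (q.+1 < r)%N then X x' a q.+1 + X x a.-1 q else X x a.-1 q.

Definition tog_dn x x' a q : C :=
  if (a.+1 < k)%N then
    if (0 < q)%N then ((X x' a.+1 q)^-1 + (X x a q.-1)^-1)^-1 else X x' a.+1 q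
  else if (0 < q)%N then X x a q.-1 else 1.

Definition toggle (j : nat) x : {ffun coordk n k -> C} :=
  [ffun v : coordk n k => match v with
     | Some (a, q) => if (a.+1 + q)%N == j then tog_up x x a q * tog_dn x x a q / x v else x v
     | None => x v
     end].

Definition toggles x (s : seq nat) := foldr toggle x s.

Definition promote x := toggles x (iota 1 n.-1).

Definition promote_inv x := toggles x (rev (iota 1 n.-1)).

Lemma X_ord x (a : 'I_k) (q : 'I_r) : X x a q = x (Some (a, q)).
Proof. exact: arr_ord. Qed.

Lemma X_toggle j x a q : (a < k)%N -> (q < r)%N ->
  X (toggle j x) a q =
  if (a.+1 + q)%N == j then tog_up x x a q * tog_dn x x a q / X x a q else X x a q.
Proof.
move=> lta ltq; have E (z : {ffun coordk n k -> C}) : X z a q = z (Some (Ordinal lta, Ordinal ltq)).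
  exact: (X_ord z (Ordinal lta) (Ordinal ltq)).
by rewrite !E ffunE.
Qed.

Lemma toggles_None x s : toggles x s None = x None.
Proof. by elim: s => //= j s IH; rewrite ffunE. Qed.

Lemma X_toggles_out x s a q : (a < k)%N -> (q < r)%N -> (a.+1 + q)%N \notin s ->
  X (toggles x s) a q = X x a q.
Proof.
move=> lta ltq; elim: s => //= j s IH; rewrite inE negb_or => /andP[/negPf neq_j /IH <-].
by rewrite X_toggle // neq_j.
Qed.

(** Toggles run from column n - 1 down to column 1. When column j is toggled, column j + 1 already
    has its promoted values and column j - 1 still has the old ones. *)
Lemma X_promote x a q : (a < k)%N -> (q < r)%N ->
  X (promote x) a q = tog_up x (promote x) a q * tog_dn x (promote x) a q / X x a q.
Proof.
move=> lta ltq; have [j Ej] : exists j, j = (a.+1 + q)%N by exists (a.+1 + q)%N.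
pose y := toggles x (iota j.+1 (n.-1 - j)).
have Es : iota 1 n.-1 = iota 1 j.-1 ++ j :: iota j.+1 (n.-1 - j).
  have -> : n.-1 = (j.-1 + (n.-1 - j).+1)%N by lia.
  by rewrite iotaD; congr (_ ++ _ :: iota _ _); lia.
have Ep : promote x = toggles (toggle j y) (iota 1 j.-1) by rewrite /promote Es /toggles foldr_cat.
have yx b p : (b < k)%N -> (p < r)%N -> (b.+1 + p <= j)%N -> X y b p = X x b p.
  by move=> ltb ltp le_j; apply: X_toggles_out; rewrite // mem_iota; lia.
have yp b p : (b < k)%N -> (p < r)%N -> (j < b.+1 + p)%N -> X y b p = X (promote x) b p.
  move=> ltb ltp lt_j; rewrite Ep X_toggles_out ?X_toggle ?gtn_eqF //.
  by rewrite mem_iota; lia.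
have yN : y None = x None by apply: toggles_None.
have -> : X (promote x) a q = X (toggle j y) a q.
  by rewrite Ep X_toggles_out // mem_iota; lia.
rewrite X_toggle // -Ej eqxx Ej yx ?Ej //; congr (_ * _ / _).
  rewrite /tog_up yN; case: (posnP a) => [a0|a0].
    by case: ifP => // ltq1; rewrite yp //; lia.
  by case: ifP => ltq1; rewrite (yx a.-1 q) ?yp //; lia.
rewrite /tog_dn; case: ifP => lta1; case: ifP => q0; rewrite ?(yp a.+1 q) ?(yx a q.-1) //; lia.
Qed.

(** Both factors of a toggle at column j depend only on the adjacent columns and on t, so they are
    the same in the second application. *)
Lemma toggleK j x : in_torus x -> in_torus (toggle j x) -> toggle j (toggle j x) = x.
Proof.
move=> hx hy; apply/ffunP => -[[a q]|]; last by rewrite !ffunE.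
rewrite -!X_ord X_toggle //; case: eqP => [Ej|]; last first.
  by rewrite X_toggle // => /eqP/negPf->.
have lev b p : (b < k)%N -> (p < r)%N -> (b.+1 + p)%N != j -> X (toggle j x) b p = X x b p.
  by move=> ltb ltp /negPf E; rewrite X_toggle // E.
have lta := ltn_ord a; have ltq := ltn_ord q.
have -> : tog_up (toggle j x) (toggle j x) a q = tog_up x x a q.
  rewrite /tog_up ffunE; case: (posnP a) => [a0|a0].
    by case: ifP => // ltq1; rewrite lev //; apply/eqP; lia.
  by case: ifP => // ltq1; rewrite ?lev //; try apply/eqP; lia.
have -> : tog_dn (toggle j x) (toggle j x) a q = tog_dn x x a q.
  rewrite /tog_dn; case: ifP => lta1; case: ifP => q0 //; rewrite ?lev //; try apply/eqP; lia.
have := hy (Some (a, q)); rewrite -X_ord X_toggle // Ej eqxx => nz.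
by rewrite invf_div mulrCA mulfV ?mulr1 //; apply: contraNneq nz => ->; rewrite mul0r.
Qed.

Fixpoint toggles_torus x (s : seq nat) : Prop :=
  if s is j :: s' then in_torus x /\ toggles_torus (toggle j x) s' else in_torus x.

Lemma toggles_rev x s : toggles_torus x s -> toggles (toggles x (rev s)) s = x.
Proof.
elim: s x => //= j s IH x [hx hs]; rewrite rev_cons -cats1 /toggles foldr_cat /= -/(toggles _ _).
rewrite -/(toggles _ s) IH // toggleK //.
by case: s hs {IH} => //= j' s [].
Qed.

End Toggles.

Section Promotion.
Variables (C : fieldType) (n k : nat).
Hypotheses (k0 : (0 < k)%N) (lt_kn : (k < n)%N).
Local Notation r := (n - k)%N.
Local Notation X x a q := (arrT 1 x a (a.+1 + q)).
Local Notation arr := (arrT 1).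
Let r0 : (0 < r)%N.
Proof. by rewrite subn_gt0. Qed.
Variables x x' : {ffun coordk n k -> C}.
Hypotheses (hx : in_torus x) (hx' : in_torus x').
Hypothesis tog : forall a q, (a < k)%N -> (q < r)%N ->
  X x' a q = tog_up x x' a q * tog_dn x x' a q / X x a q.

Let X0 a j : arr x a j != 0. Proof. exact: arr_neq0. Qed.
Let X0' a j : arr x' a j != 0. Proof. exact: arr_neq0. Qed.

Definition tog_ratio a q : C := X x a q / tog_dn x x' a q.

Lemma tog_neq0 a q : (a < k)%N -> (q < r)%N -> tog_up x x' a q != 0 /\ tog_dn x x' a q != 0.
Proof.
move=> lta ltq; have := X0' a (a.+1 + q).
by rewrite (tog lta ltq) !mulf_eq0 !negb_or => /andP[/andP[]].
Qed.

Lemma tog_ratioE a q : (a < k)%N -> (q < r)%N -> tog_ratio a q = tog_up x x' a q / X x' a q.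
Proof.
move=> lta ltq; have [up0 dn0] := tog_neq0 lta ltq.
by rewrite /tog_ratio (tog lta ltq); field; rewrite X0 up0 dn0.
Qed.

Lemma tog_ratio_neq0 a q : (a < k)%N -> (q < r)%N -> tog_ratio a q != 0.
Proof.
by move=> lta ltq; have [up0 dn0] := tog_neq0 lta ltq; rewrite mulf_neq0 ?invr_eq0.
Qed.

Let L a : 'M[C]_r := @lobid C r (tog_ratio a) (fun=> 1).

(** The toggle relation gives [tog_ratio] two expressions, one through [tog_dn] and x, one through
    [tog_up] and x'. Equating them yields the conditions of [upbid_lobid]. *)
Lemma tog_exchange a : (a.+1 < k)%N ->
  frame_step x' a.+1 *m L a = L a.+1 *m frame_step x a.
Proof.
move=> lta; apply: upbid_lobid => q ltq.
  rewrite (tog_ratioE lta ltq) /tog_ratio /tog_up /tog_dn lta /= /zrat.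
  case: (posnP q) => [->|q0].
    rewrite addr0; case: ifP => lt1; rewrite ?addr0 ?addn0 ?addn1; last by [].
    by field; rewrite X0'.
  rewrite invrK -!addnS prednK //.
  case: ifP => lt1; rewrite ?addr0; field; rewrite X0 X0' //.
have ltq' : (q < r)%N by apply: ltnW.
rewrite (tog_ratioE lta ltq') /tog_ratio /tog_up /tog_dn lta /= ltq /zrat invrK -!addnS.
by field; rewrite !X0 !X0'.
Qed.

Let G : 'M[C]_r := invmx (frame_step x' 0) *m L 0.

Let frame_step_unit a : frame_step x' a \in unitmx.
Proof. by rewrite unitmxE det_upbid unitr1. Qed.

(** The matrix G is chosen to make the case a = 0 true, and the exchange relation carries it to all
    a. The index shift between the two frames is the shift of the rows by one. *)
Lemma tog_frame a : (a < k)%N -> frame x' a.+1 *m G = L a *m frame x a.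
Proof.
elim: a => [_|a IH lta].
  by rewrite frameS !frame0 !mulmx1 /G mulKVmx.
by rewrite frameS -mulmxA IH ?(ltnW lta) // mulmxA tog_exchange // -mulmxA -frameS.
Qed.

Lemma rowv_frame_row (y : {ffun coordk n k -> C}) a q (ltq : (q < r)%N) :
  rowv y a (a + q) = row (Ordinal ltq) (frame y a).
Proof. by rewrite rowK. Qed.

(** Rows below the top come from the first row of each frame and, from row k on, from the last
    frame: for a = k - 1 the value of [tog_dn] turns [tog_ratio] into [zrat], so that L acts as the
    last factor of [Phi]. The top row is an alternating sum over frame 1. *)
Lemma promote_rows : exists2 g : 'M[C]_r, g \in unitmx &
  rowv x' k 0 *m g = ((-1) ^+ r.-1 * x None) *: rowv x k n.-1 /\
  forall p, (p.+1 < n)%N -> rowv x' k p.+1 *m g = rowv x k p.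
Proof.
exists G.
  rewrite unitmx_mul unitmx_inv frame_step_unit unitmxE det_lobid unitfE /=.
  by apply/prodf_neq0 => q _; apply: tog_ratio_neq0.
have Lrow a (q : 'I_r) : row q (L a *m frame x a) =
    tog_ratio a q *: rowv x a (a + q) + (if (0 < q)%N then rowv x a (a + q.-1) else 0).
  by rewrite (@row_lobid_mul _ _ _ _ (fun q => rowv x a (a + q))) scale1r.
split.
  rewrite rowv_stable // rowv_coords // -mulmxA tog_frame // mulmx_sum_row.
  have lt_r1 : (r.-1 < r)%N by rewrite prednK.
  have top a : rowv x a (a + r.-1) = rowv x 0 r.-1.
    elim: a => [//|a IH]; rewrite [LHS]/= rowv_out ?scaler0 ?add0r; last by lia.
    by rewrite -IH ifT; [congr (rowv _ _ _); lia|lia].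
  have -> : rowv x k n.-1 = rowv x 0 r.-1 by rewrite -(top k); congr (rowv _ _ _); lia.
  pose e q := rowv x 0 q; pose w q := (-1) ^+ q * arr x' 0 (1 + q).
  (* Each term cancels against the subdiagonal contribution of the next one; only q = r - 1
     survives, with the sign and t. *)
  have up q : (q < r)%N -> w q * tog_ratio 0 q =
      if (q.+1 < r)%N then - w q.+1 else (-1) ^+ q * x None.
    move=> ltq; rewrite tog_ratioE // /tog_up /= /w.
    by case: ifP => _; rewrite ?(exprS _ q); field.
  rewrite (eq_bigr (fun q : 'I_r => (if (q.+1 < r)%N then - w q.+1 else (-1) ^+ q * x None) *: e q
      + (if (0 < q)%N then w q *: e q.-1 else 0))); last first.
    move=> q _; rewrite Lrow mxE -/(w q) scalerDr scalerA up //.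
    by congr (_ + _); case: ifP; rewrite ?scaler0.
  have S m : (m < r)%N -> \sum_(q < m.+1) ((if (q.+1 < r)%N then - w q.+1 else (-1) ^+ q * x None) *: e q
      + (if (0 < q)%N then w q *: e q.-1 else 0)) =
      (if (m.+1 < r)%N then - w m.+1 else (-1) ^+ m * x None) *: e m.
    elim: m => [|m IH] ltm; first by rewrite big_ord_recl big_ord0 /= !addr0.
    rewrite big_ord_recr IH ?(ltnW ltm) //= ltm scaleNr addrA addrAC addNr add0r //.
  have := S r.-1 lt_r1; rewrite prednK // ltnn => <-.
  by [].
move=> p ltp; have [ltpk|lekp] := ltnP p k.
  have [lt1|ge1] := ltnP p.+1 k.
    rewrite rowv_stable // rowv_diag -scalemxAl -[Z in rowv x' p.+1 Z]addn0 (rowv_frame_row _ _ r0).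
    rewrite -row_mul tog_frame // Lrow /= addr0 addn0 scalerA.
    rewrite (rowv_stable _ ltpk) rowv_diag /tog_ratio /tog_dn lt1 /= !addn0; congr (_ *: _).
    by field.
  have kE : k = p.+1 by lia.
  have -> : rowv x' k p.+1 = rowv x' p.+1 (p.+1 + 0) by rewrite addn0; congr (rowv _ _ _).
  have -> : rowv x k p = rowv x p.+1 p by congr (rowv _ _ _).
  rewrite (rowv_frame_row _ _ r0) -row_mul tog_frame // Lrow /= addr0 addn0.
  by rewrite [RHS]rowv_diag /tog_ratio /tog_dn ltnNge ge1 /= divr1 addn0.
have ltq : ((p - k).+1 < r)%N by lia.
have -> : p.+1 = (k + (p - k).+1)%N by lia.
have kE : k = k.-1.+1 by lia.
have -> : rowv x k p = rowv x k.-1.+1 (k.-1 + (p - k).+1) by congr (rowv _ _ _); lia.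
move: (p - k)%N ltq => q ltq.
rewrite (rowv_frame_row _ _ ltq) -row_mul [Z in frame x' Z]kE tog_frame ?Lrow; last by lia.
rewrite [RHS]/= ltnS [in RHS]addnS.
have -> : (k.-1 <= k.-1 + q < k.-1 + r)%N by lia.
rewrite /tog_ratio /tog_dn -kE ltnn /=.
congr (_ *: _ + _); last by rewrite addnS.
by rewrite /zrat; congr (_ / _); congr (arrT _ _ _ _); lia.
Qed.

End Promotion.

(** * The node 0 through the cyclic shift *)

Section ZeroNode.
Variables (C : fieldType) (n k : nat).
Hypotheses (k0 : (0 < k)%N) (lt_kn : (k < n)%N).
Local Notation r := (n - k)%N.
Implicit Types (x y : {ffun coordk n k -> C}) (M : 'M[C]_(n, r)).
Let le_kn : (k <= n)%N := ltnW lt_kn.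
Let r0 : (0 < r)%N.
Proof. by rewrite subn_gt0. Qed.

Lemma det_rotate (u : nat -> 'rV[C]_r) (c : C) :
  \det (\matrix_(a < r) if a == 0%N :> nat then c *: u r.-1 else u a.-1)
  = c * (-1) ^+ r.-1 * \det (\matrix_(a < r) u a).
Proof.
have lt_r1 : (r.-1 < r)%N by rewrite prednK.
pose q0 := Ordinal r0; pose q1 := Ordinal lt_r1.
pose P : 'M[C]_r := \matrix_(a, b) if a == 0%N :> nat then c * (b == r.-1 :> nat)%:R
                                   else (b == a.-1 :> nat)%:R.
have -> : \matrix_(a < r) (if a == 0%N :> nat then c *: u r.-1 else u a.-1) =
    P *m \matrix_(a < r) u a.
  apply/row_matrixP => a; rewrite row_mul_nat rowK; case: eqP => a0.
    by under eq_bigr do rewrite mxE a0 eqxx; rewrite sum_pick lt_r1.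
  under eq_bigr => b _ do rewrite mxE (introF eqP a0) -[_%:R]mul1r.
  by rewrite sum_pick scale1r (leq_ltn_trans (leq_pred a)).
rewrite det_mulmx; congr (_ * _); rewrite (expand_det_row P q0) (bigD1 q1) //= big1 => [|b].
  rewrite addr0 mxE /= !eqxx mulr1 /cofactor add0n; congr (c * _).
  rewrite [X in \det X](_ : _ = 1%:M) ?det1 ?mulr1 //.
  apply/matrixP => a b; rewrite !mxE.
  have -> : lift q0 a = a.+1 :> nat by [].
  have -> : lift q1 b = b :> nat by rewrite /= /bump leqNgt ltn_ord.
  by rewrite /= eq_sym.
by rewrite -val_eqE /= => neq_b; rewrite mxE eqxx (negPf neq_b) mulr0 mul0r.
Qed.

(* M' is M with its rows shifted cyclically, the new first row being multiplied
   by (-1)^(r-1) t. *)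
Definition cyclic_shift (t : C) M M' : Prop :=
  rw M' 0 = ((-1) ^+ r.-1 * t) *: rw M n.-1 /\
  forall p, (p.+1 < n)%N -> rw M' p.+1 = rw M p.

Lemma cyclic_shift_inj t M M' N N' (g : 'M[C]_r) : t != 0 ->
  cyclic_shift t M M' -> cyclic_shift t N N' -> N' = M' *m g -> N = M *m g.
Proof.
move=> t0 [M0 MS] [N0 NS] E; apply: rw_inj => p ltp; rewrite rw_mulmx.
have [ltp1|gep] := ltnP p.+1 n; first by rewrite -MS // -NS // E rw_mulmx.
have -> : p = n.-1 by lia.
have s0 : (-1) ^+ r.-1 * t != 0 by rewrite mulf_neq0 // expf_neq0 // oppr_eq0 oner_neq0.
by apply: (scalerI s0); rewrite scalemxAl -M0 -N0 E rw_mulmx.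
Qed.

Lemma promote_shift x : in_torus x -> in_torus (promote x) ->
  exists2 g : 'M[C]_r, g \in unitmx &
    cyclic_shift (x None) (Theta x).1 ((Theta (promote x)).1 *m g).
Proof.
move=> hx hy.
have [g gu [g0 gS]] := promote_rows k0 lt_kn hx hy (@X_promote _ _ _ x).
by exists g => //; split=> [|p ltp]; rewrite rw_mulmx !rw_Theta //; [lia|lia|exact: gS|lia].
Qed.

Lemma phi0E M t : phi 0 (M, t) =
  t^-1 * pminor M (fun a => if a == 0%N then 0%N else (a.-1 + k)%N) / pminor M (intv_row n k 0).
Proof.
rewrite phiE expr1 /=; congr (_ * _ / _); last first.
  by rewrite (plucker_interval k0 lt_kn _ (i := 0%N)) //; left.
apply: plucker_pminor.
- by move=> a lta; case: eqP => ?; lia.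
- by move=> a b ltab; do 2?case: eqP => ?; lia.
move=> j; have ltj := ltn_ord j; rewrite mem_residues; last first.
  by apply/allP => m'; rewrite mem_cat mem_seq1 mem_zitv; lia.
rewrite !mem_cat !mem_seq1 !mem_zitv; split=> [hj|[b ltb]]; last by case: eqP; lia.
have [Ej|neq_j] := eqVneq (nat_of_ord j) 0%N; first by exists 0%N.
by exists (j - k).+1; rewrite /=; lia.
Qed.

(** The sign put on the new first row cancels the sign of the r-cycle that brings the last row to
    the front; the factor t is the one in the definition of phi_0. *)
Lemma phi_shift t M M' : t != 0 -> pminor M (intv_row n k 0) != 0 ->
  cyclic_shift t M M' -> phi 0 (M, t) = phi 1 (M', t).
Proof.
move=> t0 M0 [E0 ES]; rewrite phi0E phiE /= expr0 invr1 mul1r.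
rewrite plucker_phi //; last by lia.
rewrite (plucker_interval k0 lt_kn _ (i := 1%N)) //; [|by lia|by left].
have rowE a : (0 < a < r)%N -> intv_row n k 1 a = (a.-1 + k).+1.
  by rewrite /intv_row => lta; case: (ltnP 1 r) => ?; [case: ltnP => ?; lia|lia].
have row0 : intv_row n k 1 0 = 0%N by rewrite /intv_row; case: ifP => // _; lia.
have -> : pminor M' (phi_row n k 1) = pminor M (fun a => if a == 0%N then 0%N else (a.-1 + k)%N).
  apply: eq_pminor => a lta; rewrite /phi_row; case: (posnP a) => [->|a0].
    by rewrite row0 eqxx ES //; lia.
  by rewrite rowE ?a0 //= ES //; lia.
have -> : pminor M' (intv_row n k 1) = t * pminor M (intv_row n k 0).
  pose u a := rw M (a + k).
  rewrite /pminor -[X in _ = X * _]mul1r -[X in _ = X * t * _](sqrr_sign C (r.-1)) expr2.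
  transitivity (((-1) ^+ r.-1 * t) * (-1) ^+ r.-1 * \det (\matrix_(a < r) u a)).
    rewrite -det_rotate; congr (\det _); apply/row_matrixP => a; rewrite !rowK.
    case: (posnP a) => [->|a0]; last by rewrite rowE ?a0 ?ltn_ord //= ES //; have := ltn_ord a; lia.
    by rewrite row0 E0 /u; congr (_ *: rw _ _); lia.
  congr (_ * _); first by ring.
  by congr (\det _); apply/row_matrixP => a; rewrite !rowK /intv_row r0.
by rewrite invfM mulrCA mulrA.
Qed.

Lemma phi_mul i M (g : 'M[C]_r) t : g \in unitmx -> (0 < i < n)%N ->
  phi i (M *m g, t) = phi i (M, t).
Proof.
move=> gu lti; rewrite !phiE /= !plucker_phi //.
rewrite !(plucker_interval k0 lt_kn _ (i := i)) //; try (by lia); try (by left).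
by rewrite !pminor_mul mulrA invfM mulrACA divff ?mulr1 // -unitfE -unitmxE.
Qed.

Lemma phi0_Theta x : in_torus x -> in_torus (promote x) ->
  phi 0 (Theta x) = phi 1 (Theta (promote x)).
Proof.
move=> hx hy; have [g gu hg] := promote_shift hx hy.
have lt1n : (0 < 1 < n)%N by lia.
have eqt : promote x None = x None by apply: toggles_None.
rewrite [Theta x]surjective_pairing [Theta (promote x)]surjective_pairing.
rewrite -(phi_mul _ _ gu lt1n) -[(Theta (promote x)).2]/(promote x None) eqt.
apply: phi_shift => //; first exact: hx.
by rewrite pminor_Theta //; apply: intv_prod_neq0.
Qed.

Lemma ecrystal0_Theta x c (u := promote x) (u' := e_coords u 1 c) :
    in_torus x -> in_torus u ->
    (forall b, (b <= k)%N -> esum u 1 (1 + 1) b != 0) ->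
    (forall b, (b <= k)%N -> esum u 1 c b != 0) ->
    toggles_torus u' (iota 1 n.-1) -> in_torus (promote_inv u') ->
  same_Xpoint (Theta (promote_inv u')) (ecrystal 0 c (Theta x)).
Proof.
move=> hx hu nz2 nzc hts hx2; set x2 := promote_inv u' in hx2 *.
have lt1n : (0 < 1 < n)%N by lia.
have hu' : in_torus u' by apply: e_coords_torus.
have Ex2 : promote x2 = u' by apply: toggles_rev.
have ut : u None = x None by apply: toggles_None.
have x2t : x2 None = x None by rewrite [LHS]toggles_None ffunE.
have [g1 g1u sh1] := promote_shift hx hu.
have [g2 g2u sh2] : exists2 g : 'M[C]_r, g \in unitmx &
    cyclic_shift (x None) (Theta x2).1 ((Theta u').1 *m g).
  by have := promote_shift hx2; rewrite Ex2 x2t => /(_ hu').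
have [g3 dg3 E3] := xmx_Theta k0 lt_kn hu lt1n nzc.
have g3u : g3 \in unitmx by rewrite unitmxE dg3 unitr1.
rewrite ecrystalE; set a := (_ * _).
(* On the shifted matrix x_0(a) acts as x_1((-1)^(r-1) t a), because its first row is row n times
   that scalar. The prefactor in e_0^c is the inverse scalar. *)
have Ea : (-1) ^+ r.-1 * x None * a = (c - 1) / phi_sum u 1.
  rewrite /a -[(Theta x).2]/(x None) phi0_Theta // -/u phi_Theta //.
  move: (_ / phi_sum u 1) (hx None) => w t0.
  move: ((-1) ^+ r.-1) (sqrr_sign C r.-1) => s s2.
  by transitivity (s ^+ 2 * w); [field | rewrite s2 mul1r].
have sh3 : cyclic_shift (x None) (xmx n 0 a *m (Theta x).1) ((Theta u').1 *m g3 *m g1).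
  rewrite -E3 -Ea -mulmxA; case: sh1 => sh1 shS; split=> [|p ltp].
    rewrite rw_xmx ?rw_xmx0 //; try by lia.
    rewrite eqxx prednK ?eqxx; last by lia.
    by rewrite sh1 shS ?scalerDr ?scalerA; last by lia.
  rewrite rw_xmx ?rw_xmx0 //; try by lia.
  have -> : (p.+1 == n) = false by lia.
  by rewrite !addr0 shS.
have := cyclic_shift_inj (hx None) sh2 sh3 (g := invmx g2 *m g3 *m g1).
rewrite !mulmxA mulmxK // => /(_ erefl) E.
apply: same_Xpoint_sym; apply: (same_Xpoint_mul (g := invmx g2 *m g3 *m g1)).
- by rewrite !unitmx_mul unitmx_inv g2u g3u g1u.
- by rewrite /= E !mulmxA.
- by rewrite /= x2t.
Qed.

End ZeroNode.

(** * The tropical functions *)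

Section TropicalForms.
Variables (n k : nat).
Local Notation r := (n - k)%N.
Implicit Types w : {ffun coordk n k -> int}.
Local Notation A := (arrT 0).

(** For lo < hi the minimum over lo <= b < hi, the term at lo being the default value. *)
Definition min_nat (lo hi : nat) (f : nat -> int) : int :=
  \big[Num.min/f lo]_(lo.+1 <= b < hi) f b.

Definition zdiff w a p : int := A w a p.+1 - A w a p.

Definition t_esum_term w i b : int :=
  \sum_(b.+1 <= b' < k) (zdiff w b' i - zdiff w b' i.-1) - zdiff w b i.-1.

Definition t_phi_sum w i : int := min_nat (i - r) (minn i k) (t_esum_term w i).

Definition t_esum w i (m : int) b : int :=
  min_nat (i - r) (minn i k) (fun b' => (if (b <= b')%N then m else 0) + t_esum_term w i b').

Definition t_e_coords w i (m : int) : {ffun coordk n k -> int} :=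
  [ffun v : coordk n k => match v with
     | Some (a, q) => if (a.+1 + q)%N == i then w v + (t_esum w i m a - t_esum w i m a.+1)
                      else w v
     | None => w v
     end].

Definition t_intv_prod w i : int := \sum_(i - r <= a < k) A w a i.

Definition t_tog_up w a q : int :=
  if a == 0%N then if (q.+1 < r)%N then A w a (a.+1 + q.+1) else w None
  else if (q.+1 < r)%N then Num.min (A w a (a.+1 + q.+1)) (A w a.-1 (a.-1.+1 + q))
       else A w a.-1 (a.-1.+1 + q).

Definition t_tog_dn w a q : int :=
  if (a.+1 < k)%N then
    if (0 < q)%N then - Num.min (- A w a.+1 (a.+2 + q)) (- A w a (a.+1 + q.-1))
    else A w a.+1 (a.+2 + q)
  else if (0 < q)%N then A w a (a.+1 + q.-1) else 0.

Definition t_toggle (j : nat) w : {ffun coordk n k -> int} :=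
  [ffun v : coordk n k => match v with
     | Some (a, q) => if (a.+1 + q)%N == j then t_tog_up w a q + t_tog_dn w a q - w v else w v
     | None => w v
     end].

Definition t_toggles w (s : seq nat) := foldr t_toggle w s.

Definition t_promote w := t_toggles w (iota 1 n.-1).

Definition t_promote_inv w := t_toggles w (rev (iota 1 n.-1)).

Definition t_deco_term w i : int :=
  if (i < r)%N then min_nat 0 k (fun a => zdiff w a (a + i))
  else if (i < n)%N then
    min_nat 0 r (fun s => A w (i - r).-1 ((i - r) + s) - A w (i - r) ((i - r).+1 + s))
  else A w k.-1 k.

Definition t_decoration w : int :=
  \big[Num.min/w None - A w 0 r]_(1 <= i < n.+1 | i != r) t_deco_term w i.

End TropicalForms.

Section TropicalMaps.
Variables (n k : nat) (C : numFieldType) (W : finType).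
Local Notation r := (n - k)%N.
Local Notation A := (arrT 0).
Variables (X : {ffun W -> C} -> {ffun coordk n k -> C})
          (Xt : {ffun W -> int} -> {ffun coordk n k -> int}).

Definition tropical_map (Y : {ffun W -> C} -> {ffun coordk n k -> C})
    (Yt : {ffun W -> int} -> {ffun coordk n k -> int}) :=
  forall v, tropical (fun y => Y y v) (fun w => Yt w v).

Hypothesis hX : tropical_map X Xt.

Lemma tropical_min_nat lo hi (F : nat -> {ffun W -> C} -> C) (f : nat -> {ffun W -> int} -> int) :
  (lo < hi)%N -> (forall b, tropical (F b) (f b)) ->
  tropical (fun y => \sum_(lo <= b < hi) F b y) (fun w => min_nat lo hi (f^~ w)).
Proof.
move=> lt_lh hF; apply: tropical_ext (tropical_sum lo (index_iota lo.+1 hi) hF) _ _ => y //.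
by rewrite [RHS]big_ltn // big_cons.
Qed.

Lemma tropical_arr a j :
  tropical (fun y => arrT 1 (X y) a j) (fun w => A (Xt w) a j).
Proof.
rewrite /arrT; case: (j <= a)%N; first by apply: tropical1.
case: (insub a) => [a'|]; last by apply: hX.
by case: (insub _) => [q|]; apply: hX.
Qed.

Lemma tropical_zrat a p : tropical (fun y => zrat (X y) a p) (fun w => zdiff (Xt w) a p).
Proof. by apply: tropical_div; apply: tropical_arr. Qed.

Lemma tropical_esum_term i b :
  tropical (fun y => esum_term (X y) i b) (fun w => t_esum_term (Xt w) i b).
Proof.
apply: tropical_div; last by apply: tropical_zrat.
by apply: tropical_prod => b'; apply: tropical_div; apply: tropical_zrat.
Qed.

Lemma tropical_phi_sum i : (i - r < minn i k)%N ->
  tropical (fun y => phi_sum (X y) i) (fun w => t_phi_sum (Xt w) i).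
Proof. by move=> lti; apply: tropical_min_nat => // b; apply: tropical_esum_term. Qed.

Lemma tropical_esum i b (c : {ffun W -> C} -> C) (m : {ffun W -> int} -> int) :
  (i - r < minn i k)%N -> tropical c m ->
  tropical (fun y => esum (X y) i (c y) b) (fun w => t_esum (Xt w) i (m w) b).
Proof.
move=> lti hc; apply: (tropical_min_nat (F := fun b' y => (if (b <= b')%N then c y else 1) * _)
  (f := fun b' w => (if (b <= b')%N then m w else 0) + _)) => // b'.
by apply: tropicalM (tropical_esum_term _ _); case: (b <= b')%N => //; apply: tropical1.
Qed.

Lemma tropical_e_coords i (c : {ffun W -> C} -> C) (m : {ffun W -> int} -> int) :
  (i - r < minn i k)%N -> tropical c m ->
  tropical_map (fun y => e_coords (X y) i (c y)) (fun w => t_e_coords (Xt w) i (m w)).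
Proof.
move=> lti hc v.
have hd : tropical (fun y => match v with
     | Some (a, q) => if (a.+1 + q)%N == i then
         X y v * (esum (X y) i (c y) a / esum (X y) i (c y) a.+1) else X y v
     | None => X y v end) (fun w => match v with
     | Some (a, q) => if (a.+1 + q)%N == i then
         Xt w v + (t_esum (Xt w) i (m w) a - t_esum (Xt w) i (m w) a.+1) else Xt w v
     | None => Xt w v end).
  case: v => [[a q]|]; last exact: hX.
  case: (_ == i); last exact: hX.
  by apply: tropicalM (hX _) _; apply: tropical_div; apply: tropical_esum.
by apply: tropical_ext hd _ _ => y; rewrite ffunE.
Qed.

Lemma tropical_intv_prod i :
  tropical (fun y => intv_prod (X y) i) (fun w => t_intv_prod (Xt w) i).
Proof. by apply: tropical_prod => a; apply: tropical_arr. Qed.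

Lemma tropical_deco_term i : (0 < k)%N -> (0 < r)%N ->
  tropical (fun y => deco_term (X y) i) (fun w => t_deco_term (Xt w) i).
Proof.
move=> k0 r0; rewrite /deco_term /t_deco_term.
case: (i < r)%N; first by apply: tropical_min_nat => // a; apply: tropical_zrat.
case: (i < n)%N; last by apply: tropical_arr.
by apply: tropical_min_nat => // a; apply: tropical_div; apply: tropical_arr.
Qed.

Lemma tropical_sum_from (I : Type) (s : seq I) (P : pred I) F0 f0
    (F : I -> {ffun W -> C} -> C) (f : I -> {ffun W -> int} -> int) :
  tropical F0 f0 -> (forall i, tropical (F i) (f i)) ->
  tropical (fun y => \sum_(i <- s | P i) F i y + F0 y)
    (fun w => \big[Num.min/f0 w]_(i <- s | P i) f i w).
Proof.
move=> h0 hF; elim: s => [|i s IHs].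
  by apply: tropical_ext h0 _ _ => y; rewrite big_nil ?add0r.
case Pi: (P i); last by apply: tropical_ext IHs _ _ => y; rewrite !big_cons Pi.
by apply: tropical_ext (tropicalD (hF i) IHs) _ _ => y; rewrite !big_cons Pi ?addrA.
Qed.

Lemma tropical_decoration : (0 < k)%N -> (0 < r)%N ->
  tropical (fun y => \sum_(1 <= i < n.+1 | i != r) deco_term (X y) i
                     + X y None / arrT 1 (X y) 0 r)
    (fun w => t_decoration (Xt w)).
Proof.
move=> k0 r0; apply: (@tropical_sum_from _ _ _ (fun y => X y None / arrT 1 (X y) 0 r)
  (fun w => Xt w None - A (Xt w) 0 r)).
  by apply: tropical_div (hX _) (tropical_arr _ _).
by move=> i; apply: tropical_deco_term.
Qed.

Lemma tropical_toggle j : tropical_map (fun y => toggle j (X y)) (fun w => t_toggle j (Xt w)).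
Proof.
move=> v.
have hup a q : tropical (fun y => tog_up (X y) (X y) a q) (fun w => t_tog_up (Xt w) a q).
  rewrite /tog_up /t_tog_up; case: (a == 0%N); case: (q.+1 < r)%N; try (by apply: tropical_arr); first exact: hX.
  by apply: tropicalD; apply: tropical_arr.
have hdn a q : tropical (fun y => tog_dn (X y) (X y) a q) (fun w => t_tog_dn (Xt w) a q).
  rewrite /tog_dn /t_tog_dn; case: (a.+1 < k)%N; case: (0 < q)%N; try (by apply: tropical_arr); last by apply: tropical1.
  by apply: tropicalV; apply: tropicalD; apply: tropicalV; apply: tropical_arr.
have hd : tropical (fun y => match v with
     | Some (a, q) => if (a.+1 + q)%N == j then
         tog_up (X y) (X y) a q * tog_dn (X y) (X y) a q / X y v else X y v
     | None => X y v end) (fun w => match v with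
     | Some (a, q) => if (a.+1 + q)%N == j then
         t_tog_up (Xt w) a q + t_tog_dn (Xt w) a q - Xt w v else Xt w v
     | None => Xt w v end).
  case: v => [[a q]|]; last exact: hX.
  case: (_ == j); last exact: hX.
  by apply: tropical_div (hX _); apply: tropicalM.
by apply: tropical_ext hd _ _ => y; rewrite ffunE.
Qed.

End TropicalMaps.

Lemma tropical_toggles (C : numFieldType) (W : finType) n k s
    (X : {ffun W -> C} -> {ffun coordk n k -> C}) Xt :
  tropical_map X Xt -> tropical_map (fun y => toggles (X y) s) (fun w => t_toggles (Xt w) s).
Proof. by move=> hX; elim: s => // j s IH; apply: tropical_toggle. Qed.

Section Genericity.
Variables (C : numFieldType) (W : finType) (n k : nat).
Implicit Types (X : {ffun W -> C} -> {ffun coordk n k -> C}).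

Lemma generically_map_torus X Xt : tropical_map X Xt -> generically (fun y => in_torus (X y)).
Proof.
move=> hX; apply: (@generically_all _ _ _ (fun v y => X y v != 0)) => v.
exact: tropical_neq0 (hX v).
Qed.

Lemma generically_esum_neq0 X Xt i c m : tropical_map X Xt -> (i - (n - k) < minn i k)%N ->
  tropical c m ->
  generically (fun y => forall b, (b <= k)%N -> esum (X y) i (c y) b != 0).
Proof.
move=> hX lti hc.
have : generically (fun y => forall b : 'I_k.+1, esum (X y) i (c y) b != 0).
  apply: (@generically_all _ _ _ (fun (b : 'I_k.+1) y => esum (X y) i (c y) b != 0)) => b.
  exact: tropical_neq0 (tropical_esum hX b lti hc).
by apply: generically_imp => y _ H b leb; have := H (Ordinal (leb : (b < k.+1)%N)).
Qed.

Lemma generically_toggles_torus X Xt s : tropical_map X Xt ->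
  generically (fun y => toggles_torus (X y) s).
Proof.
elim: s X Xt => [|j s IH] X Xt hX /=; first exact: generically_map_torus hX.
apply: generically_and; first exact: generically_map_torus hX.
exact: IH (tropical_toggle hX j).
Qed.

End Genericity.

Section Hats.
Variables (R : realType) (n k : nat).
Hypotheses (k0 : (0 < k)%N) (lt_kn : (k < n)%N).
Local Notation r := (n - k)%N.
Local Notation C := (R[i]).
Implicit Types w : {ffun coordk n k -> int}.
Let le_kn : (k <= n)%N := ltnW lt_kn.
Let r0 : (0 < r)%N.
Proof. by rewrite subn_gt0. Qed.

Let hid : tropical_map (fun x : {ffun coordk n k -> C} => x) id.
Proof. by move=> v; apply: tropical_var. Qed.

(** The constant 2, at which the sums must not vanish in [phi_Theta]. *)
Let two : tropical (fun _ : {ffun coordk n k -> C} => 1 + 1) (fun=> Num.min 0 0).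
Proof. by apply: tropicalD; apply: tropical1. Qed.

Let act_lt i : (0 < i < n)%N -> (i - r < minn i k)%N.
Proof. by rewrite leq_min; lia. Qed.

Lemma gamma_hatE l w : (0 < l <= n)%N ->
  gamma_hat R l w = (if (l <= r)%N then 0 else w None) + (t_intv_prod w l - t_intv_prod w l.-1).
Proof.
move=> ltl; rewrite /gamma_hat.
have hF : tropical (fun x : {ffun coordk n k -> C} =>
    (if (l <= r)%N then 1 else x None) * (intv_prod x l / intv_prod x l.-1))
  (fun w => (if (l <= r)%N then 0 else w None) + (t_intv_prod w l - t_intv_prod w l.-1)).
  apply: tropicalM; first by case: (l <= r)%N; [apply: tropical1|apply: tropical_var].
  by apply: tropical_div; apply: (tropical_intv_prod hid).
apply: (Trop_tropical _ hF); apply: generically_torus => x hx.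
exact: gamma_Theta.
Qed.

Lemma gamma_hat0 w : gamma_hat R 0 w = gamma_hat R n w.
Proof. by rewrite /gamma_hat; congr (Trop _ w); apply/funext => x; apply: gamma0_Theta. Qed.

Lemma generically_phi i : (0 < i < n)%N ->
  generically (fun x : {ffun coordk n k -> C} => phi i (Theta x) = phi_sum x i).
Proof.
move=> lti; apply: generically_imp (generically_esum_neq0 hid (act_lt lti) two) => x hx nz.
exact: phi_Theta.
Qed.

Let hpro : tropical_map (fun x : {ffun coordk n k -> C} => promote x) (@t_promote n k).
Proof. exact: tropical_toggles hid. Qed.

Lemma generically_phi0 : (1 < n)%N ->
  generically (fun x : {ffun coordk n k -> C} => phi 0 (Theta x) = phi_sum (promote x) 1).
Proof.
move=> n1; have lt1 : (0 < 1 < n)%N by lia.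
apply: generically_imp (generically_and (generically_map_torus hpro)
  (generically_esum_neq0 hpro (act_lt lt1) two)) => x hx [hy nz].
by rewrite phi0_Theta // phi_Theta.
Qed.

Definition t_phi i w := if i == 0%N then t_phi_sum (t_promote w) 1 else t_phi_sum w i.

Let F_phi i (x : {ffun coordk n k -> C}) := if i == 0%N then phi_sum (promote x) 1 else phi_sum x i.

Let tropical_F_phi i : (i < n)%N -> tropical (F_phi i) (t_phi i).
Proof.
move=> lti; rewrite /F_phi /t_phi; case: eqP => i0.
  by apply: (tropical_phi_sum hpro); apply: act_lt; lia.
by apply: (tropical_phi_sum hid); apply: act_lt; lia.
Qed.

Let generically_F_phi i : (i < n)%N ->
  generically (fun x : {ffun coordk n k -> C} => phi i (Theta x) = F_phi i x).
Proof.
move=> lti; rewrite /F_phi; case: eqP => [->|i0]; first by apply: generically_phi0; lia.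
by apply: generically_phi; lia.
Qed.

Lemma phi_hatE i w : (i < n)%N -> phi_hat R i w = t_phi i w.
Proof.
by move=> lti; apply: (Trop_tropical _ (tropical_F_phi lti)); apply: generically_F_phi.
Qed.

Lemma epsilon_hatE i w : (i < n)%N ->
  epsilon_hat R i w = t_phi i w + ((w None *+ (i == 0%N) - w None *+ (i == r)) +
    (t_intv_prod w i + t_intv_prod w i -
     (t_intv_prod w (if i == 0%N then n.-1 else i.-1) + t_intv_prod w i.+1))).
Proof.
move=> lti.
have hpow (b : bool) : tropical (fun x : {ffun coordk n k -> C} => x None ^+ b) (fun w => w None *+ b).
  by case: b; [apply: tropical_var|apply: tropical1].
have hN j := tropical_intv_prod hid j.
have hF := tropicalM (tropical_F_phi lti) (tropicalM
  (tropical_div (hpow (i == 0%N)) (hpow (i == r)))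
  (tropical_div (tropicalM (hN i) (hN i))
     (tropicalM (hN (if i == 0%N then n.-1 else i.-1)) (hN i.+1)))).
apply: (Trop_tropical _ hF); apply: generically_imp (generically_F_phi lti) => x hx <-.
exact: epsilon_Theta.
Qed.

Lemma f_hatE w : f_hat R w = t_decoration w.
Proof.
apply: (Trop_tropical _ (tropical_decoration hid k0 r0)); apply: generically_torus => x hx.
exact: decoration_Theta.
Qed.

Definition t_e i w (m : int) :=
  if i == 0%N then t_promote_inv (t_e_coords (t_promote w) 1 m) else t_e_coords w i m.

(** Promotion, e_1 and every inverse toggle have subtraction-free coordinates, so the points met on
    the way are generically in the torus, where [Theta_invE] identifies the chosen preimage. The
    parameter c is the extra variable, of tropical value m. *)
Lemma e_hatE i (m : int) w : (i < n)%N -> e_hat R i m w = t_e i w m.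
Proof.
move=> lti; apply/ffunP => v; rewrite ffunE.
pose Y (y : {ffun option (coordk n k) -> C}) : {ffun coordk n k -> C} := [ffun v => y (Some v)].
pose Yt (y : {ffun option (coordk n k) -> int}) : {ffun coordk n k -> int} := [ffun v => y (Some v)].
have hY : tropical_map Y Yt.
  by move=> u; apply: tropical_ext (tropical_var _ (Some u)) _ _ => y; rewrite ffunE.
have hc : tropical (fun y : {ffun option (coordk n k) -> C} => y None) (fun u => u None).
  exact: tropical_var.
have two' : tropical (fun _ : {ffun option (coordk n k) -> C} => 1 + 1) (fun=> Num.min 0 0).
  by apply: tropicalD; apply: tropical1.
have Y_torus y : in_torus y -> in_torus (Y y) by move=> hy u; rewrite ffunE.
set wm := [ffun u => _].
have YtE : Yt wm = w by apply/ffunP => u; rewrite !ffunE.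
have wmN : wm None = m by rewrite ffunE.
rewrite /t_e -wmN -YtE; case: eqP => [->|/eqP i0].
  have lt1 : (0 < 1 < n)%N by lia.
  have hP : tropical_map (fun y => promote (Y y)) (fun u => t_promote (Yt u)) := tropical_toggles _ hY.
  have hE := tropical_e_coords hP (act_lt lt1) hc.
  have hI : tropical_map (fun y => promote_inv (e_coords (promote (Y y)) 1 (y None)))
      (fun u => t_promote_inv (t_e_coords (t_promote (Yt u)) 1 (u None))) := tropical_toggles _ hE.
  apply: (Trop_tropical _ (hI v)).
  apply: generically_imp (generically_and (generically_and (generically_map_torus hP)
    (generically_map_torus hI)) (generically_and (generically_toggles_torus (iota 1 n.-1) hE)
    (generically_and (generically_esum_neq0 hP (act_lt lt1) two')
     (generically_esum_neq0 hP (act_lt lt1) hc)))).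
  move=> y hy [[hPy hIy] [hTy [nz2 nzc]]]; rewrite /e_torus -/(Y y) (@Theta_invE _ _ _ le_kn (promote_inv (e_coords (promote (Y y)) 1 (y None)))) //.
  by apply: ecrystal0_Theta => //; apply: Y_torus.
have lti' : (0 < i < n)%N by rewrite lt0n i0.
have hE := tropical_e_coords hY (act_lt lti') hc.
apply: (Trop_tropical _ (hE v)).
apply: generically_imp (generically_and (generically_map_torus hE)
    (generically_and (generically_esum_neq0 hY (act_lt lti') two')
     (generically_esum_neq0 hY (act_lt lti') hc))).
move=> y hy [hEy [nz2 nzc]].
rewrite /e_torus -/(Y y) (@Theta_invE _ _ _ le_kn (e_coords (Y y) i (y None))) //.
by apply: ecrystal_Theta => //; apply: Y_torus.
Qed.

End Hats.

(** * k-rectangles *)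

Section Minima.

Lemma big_min_ge0 (I : eqType) (s : seq I) (P : pred I) (f : I -> int) z :
  (0 <= \big[Num.min/z]_(i <- s | P i) f i) <->
  (0 <= z /\ forall i, i \in s -> P i -> 0 <= f i).
Proof.
elim: s => [|i s IH]; first by rewrite big_nil; split=> [//|[]].
rewrite big_cons; case: ifP => Pi.
  rewrite le_min; split=> [/andP[fi /IH[z0 hs]]|[z0 hs]].
    by split=> // j; rewrite inE => /predU1P[->|/hs].
  rewrite hs ?mem_head //=; apply/IH; split=> // j js; apply: hs.
  by rewrite inE js orbT.
rewrite IH; split=> -[z0 hs]; split=> // j.
  by rewrite inE => /predU1P[->|/hs] //; rewrite Pi.
by move=> js; apply: hs; rewrite inE js orbT.
Qed.

Lemma min_natP lo hi (f : nat -> int) : (lo < hi)%N ->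
  (exists2 b, (lo <= b < hi)%N & min_nat lo hi f = f b) /\
  (forall b, (lo <= b < hi)%N -> min_nat lo hi f <= f b).
Proof.
move=> lt_lh; rewrite /min_nat; split.
  have : {subset index_iota lo.+1 hi <= index_iota lo hi}.
    by move=> b; rewrite !mem_index_iota; lia.
  elim: (index_iota lo.+1 hi) => [_|b s IH sub].
    by exists lo; rewrite ?leqnn // big_nil.
  rewrite big_cons minEle; case: ifP => _.
    by exists b => //; have := sub b (mem_head _ _); rewrite mem_index_iota.
  by apply: IH => c cs; apply: sub; rewrite inE cs orbT.
move=> b /andP[]; rewrite leq_eqVlt => /predU1P[<- _|lt_lb lt_bh].
  by elim: (index_iota _ _) => [|c s IH]; rewrite ?big_nil // big_cons ge_min IH orbT.
have : b \in index_iota lo.+1 hi by rewrite mem_index_iota lt_lb.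
elim: (index_iota _ _) => // c s IH; rewrite inE big_cons ge_min => /predU1P[->|/IH->].
  by rewrite lexx.
by rewrite orbT.
Qed.

Lemma min_nat_ge0 lo hi (f : nat -> int) : (lo < hi)%N ->
  (0 <= min_nat lo hi f) <-> (forall b, (lo <= b < hi)%N -> 0 <= f b).
Proof.
move=> lt_lh; have [[b hb E] hle] := min_natP f lt_lh; split=> [h c hc|h].
  exact: le_trans h (hle c hc).
by rewrite E h.
Qed.

Lemma leftmost_argmin (lo hi : nat) (s : nat -> int) : (lo < hi)%N ->
  exists b, [/\ (lo <= b < hi)%N, forall c, (lo <= c < hi)%N -> s b <= s c
              & forall c, (lo <= c < b)%N -> s b < s c].
Proof.
move=> lt_lh; have [[b0 hb0 E0] h0] := min_natP s lt_lh.
have ex : exists b, [&& (lo <= b)%N, (b < hi)%N & s b == min_nat lo hi s].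
  by exists b0; rewrite andbA hb0 E0 eqxx.
case: (ex_minnP ex) => b /and3P[hb1 hb2 /eqP Eb] hmin; exists b; split.
- by rewrite hb1.
- by move=> c hc; rewrite Eb h0.
move=> c /andP[hc1 hc2]; have hc3 : (c < hi)%N := ltn_trans hc2 hb2.
rewrite Eb lt_neqAle h0 ?hc1 // andbT.
by apply: contraL hc2 => /eqP Ec; rewrite -leqNgt hmin // hc1 hc3 Ec eqxx.
Qed.

Lemma rightmost_argmin (lo hi : nat) (s : nat -> int) : (lo < hi)%N ->
  exists b, [/\ (lo <= b < hi)%N, forall c, (lo <= c < hi)%N -> s b <= s c
              & forall c, (b < c < hi)%N -> s b < s c].
Proof.
move=> lt_lh; have [[b0 hb0 E0] h0] := min_natP s lt_lh.
have ex : exists b, [&& (lo <= b)%N, (b < hi)%N & s b == min_nat lo hi s].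
  by exists b0; rewrite andbA hb0 E0 eqxx.
have ub b : [&& (lo <= b)%N, (b < hi)%N & s b == min_nat lo hi s] -> (b <= hi)%N.
  by case/and3P=> _ /ltnW.
case: (ex_maxnP ex ub) => b /and3P[hb1 hb2 /eqP Eb] hmax; exists b; split.
- by rewrite hb1.
- by move=> c hc; rewrite Eb h0.
move=> c /andP[hc1 hc2]; have hc3 : (lo <= c)%N := leq_trans hb1 (ltnW hc1).
rewrite Eb lt_neqAle h0 ?hc3 // andbT.
by apply: contraL hc1 => /eqP Ec; rewrite -leqNgt hmax // hc3 hc2 Ec eqxx.
Qed.

Lemma min_nat_unique lo hi (f : nat -> int) b z : (lo <= b < hi)%N -> f b = z ->
  (forall c, (lo <= c < hi)%N -> z <= f c) -> min_nat lo hi f = z.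
Proof.
move=> hb <- hle; have lt_lh : (lo < hi)%N by lia.
have [[c hc Ec] h] := min_natP f lt_lh.
by apply/le_anti; rewrite h // Ec hle.
Qed.

End Minima.

Section Rectangles.
Variables (n k : nat).
Hypotheses (k0 : (0 < k)%N) (lt_kn : (k < n)%N).
Local Notation r := (n - k)%N.
Implicit Types w : {ffun coordk n k -> int}.
Local Notation A := (arrT 0).

Lemma AijE w (a : 'I_k) j : Aij w a j = A w a j.
Proof. by rewrite /Aij /arrT valK. Qed.

Lemma A_lo w a j : (j <= a)%N -> A w a j = 0.
Proof. exact: arr_lo. Qed.

Lemma A_hi w a j : (a + r < j)%N -> A w a j = w None.
Proof. exact: arr_hi. Qed.

Lemma k_rectangleP w : k_rectangle w <->
  [/\ forall a j, (a < k)%N -> (a < j <= n)%N -> 0 <= A w a j,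
      forall a j, (a < k)%N -> (a < j < n)%N -> A w a j <= A w a j.+1
    & forall a j, (a.+1 < k)%N -> (a < j < n)%N -> A w a.+1 j.+1 <= A w a j].
Proof.
split=> -[h1 h2 h3]; split.
- by move=> a j lta ltj; have := h1 (Ordinal lta) j ltj; rewrite AijE.
- by move=> a j lta ltj; have := h2 (Ordinal lta) j ltj; rewrite !AijE.
- move=> a j lta ltj; have := h3 (Ordinal (ltnW lta)) (Ordinal lta) j erefl ltj.
  by rewrite !AijE.
- by move=> a j ltj; rewrite AijE h1.
- by move=> a j ltj; rewrite !AijE h2.
- by move=> a a' j E ltj; rewrite !AijE E h3 // -E.
Qed.

Lemma rect_ge0 w : k_rectangle w -> forall a j, (a < k)%N -> (j <= n)%N -> 0 <= A w a j.
Proof.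
case/k_rectangleP=> h1 _ _ a j lta lej; have [le_ja|lt_aj] := leqP j a; first by rewrite A_lo.
by rewrite h1 ?lt_aj.
Qed.

Lemma rect_mono w : k_rectangle w ->
  forall a j, (a < k)%N -> (j < n)%N -> A w a j <= A w a j.+1.
Proof.
move=> hw a j lta ltj; have [le_ja|lt_aj] := leqP j a; first by rewrite A_lo ?rect_ge0.
by have /k_rectangleP[_ h2 _] := hw; rewrite h2 ?lt_aj.
Qed.

Lemma rect_diag w : k_rectangle w ->
  forall a j, (a.+1 < k)%N -> (j < n)%N -> A w a.+1 j.+1 <= A w a j.
Proof.
move=> hw a j lta ltj; have [le_ja|lt_aj] := leqP j a; first by rewrite !A_lo.
by have /k_rectangleP[_ _ h3] := hw; rewrite h3 ?lt_aj.
Qed.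

Lemma rect_intro w :
  (forall a j, (a < k)%N -> (j <= n)%N -> 0 <= A w a j) ->
  (forall a j, (a < k)%N -> (j < n)%N -> A w a j <= A w a j.+1) ->
  (forall a j, (a.+1 < k)%N -> (j < n)%N -> A w a.+1 j.+1 <= A w a j) -> k_rectangle w.
Proof.
by move=> h1 h2 h3; apply/k_rectangleP; split=> a j lta /andP[_ ltj]; auto.
Qed.

(** The decoration contains neither all the signs nor all the comparisons with L. Nonnegativity
    spreads from A_{k,k} up the diagonal and then along the rows; the bound by L spreads from
    A_{1,r} down to the last coordinate of each row. *)
Lemma decoration_rect w : (0 <= t_decoration w) <-> k_rectangle w.
Proof.
have r0 : (0 < r)%N by rewrite subn_gt0.
rewrite /t_decoration big_min_ge0; split=> [[d0 dterm]|hw]; last first.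
  have h0 := rect_ge0 hw; have h1 := rect_mono hw; have h2 := rect_diag hw.
  split; first by have := h1 0%N r; rewrite (@A_hi _ 0%N r.+1) //; lia.
  move=> i; rewrite mem_index_iota => lti /eqP neq; rewrite /t_deco_term.
  case: ltnP => ltir; first apply/min_nat_ge0 => // a lta.
    by rewrite subr_ge0 h1 //; lia.
  case: ltnP => ltin; last by rewrite h0 //; lia.
  apply/min_nat_ge0 => // s lts; rewrite subr_ge0.
  have -> : (i - r = (i - r).-1.+1)%N by lia.
  by rewrite addSn; apply: h2; lia.
have dterm' i : (0 < i <= n)%N -> i <> r -> 0 <= t_deco_term w i.
  by move=> lti /eqP neq; apply: dterm; rewrite ?mem_index_iota.
have D1 a i : (a < k)%N -> (0 < i < r)%N -> A w a (a + i) <= A w a (a + i).+1.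
  move=> lta lti; have : 0 <= t_deco_term w i by apply: dterm'; lia.
  rewrite /t_deco_term; case: ltnP => ltir; last by lia.
  by move/(min_nat_ge0 _ k0)/(_ a); rewrite subr_ge0; apply; lia.
have D2 a s : (a.+1 < k)%N -> (s < r)%N -> A w a.+1 (a.+2 + s) <= A w a (a.+1 + s).
  move=> lta lts; have : 0 <= t_deco_term w (a.+1 + r)%N by apply: dterm'; lia.
  rewrite /t_deco_term addnK ltnNge leq_addl /=.
  case: ltnP => ltan; last by lia.
  by move/(min_nat_ge0 _ r0)/(_ s); rewrite subr_ge0; apply; lia.
have D3 : 0 <= A w k.-1 k.
  have : 0 <= t_deco_term w n by apply: dterm'; lia.
  by rewrite /t_deco_term ifF ?ltnn //; lia.
have top a : (a < k)%N -> A w a (a + r) <= w None.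
  elim: a => [|a IH] lta; first by rewrite add0n -subr_ge0.
  apply: le_trans (IH (ltnW lta)); have := D2 a r.-1 lta.
  have -> : (a.+2 + r.-1 = a.+1 + r)%N by lia.
  have -> : (a.+1 + r.-1 = a + r)%N by lia.
  by apply; lia.
have R2 a j : (a < k)%N -> (a < j < n)%N -> A w a j <= A w a j.+1.
  move=> lta ltj; have [lt1|ge1] := ltnP (j - a) r.
    by have := D1 a (j - a)%N lta; rewrite subnKC; [apply; lia|lia].
  have [Ej|neq] := eqVneq j (a + r)%N; first by rewrite Ej (@A_hi _ a (a + r).+1) ?top.
  by rewrite !A_hi //; lia.
have R3 a j : (a.+1 < k)%N -> (a < j < n)%N -> A w a.+1 j.+1 <= A w a j.
  move=> lta ltj; have [lt1|ge1] := ltnP (j - a.+1) r.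
    have := D2 a (j - a.+1)%N lta lt1.
    have -> : (a.+2 + (j - a.+1) = j.+1)%N by lia.
    by have -> : (a.+1 + (j - a.+1) = j)%N by lia.
  by rewrite !A_hi //; lia.
have diag0 d : (d < k)%N -> 0 <= A w (k.-1 - d) (k.-1 - d).+1.
  elim: d => [|d IH] ltd; first by rewrite subn0 prednK.
  apply: le_trans (IH (ltnW ltd)) _; have := R3 (k.-1 - d.+1)%N (k.-1 - d.+1).+1.
  have -> : ((k.-1 - d.+1).+1 = k.-1 - d)%N by lia.
  by apply; lia.
apply/k_rectangleP; split=> // a j lta /andP[lt_aj].
have base : 0 <= A w a a.+1.
  have := diag0 (k.-1 - a)%N; have -> : (k.-1 - (k.-1 - a) = a)%N by lia.
  by apply; lia.
have -> : j = (a.+1 + (j - a.+1))%N by lia.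
elim: (j - a.+1)%N => [|d IH] led; first by rewrite addn0.
apply: le_trans (IH _) _; first by lia.
by rewrite addnS R2 //; lia.
Qed.

Lemma sum_A_split w l : (l <= n)%N ->
  \sum_(0 <= a < k) A w a l = w None *+ (l - r) + t_intv_prod w l.
Proof.
move=> lel; rewrite /t_intv_prod (big_cat_nat (n := l - r)) //=; last by lia.
congr (_ + _); rewrite -[X in _ *+ X]subn0 -sumr_const_nat.
by apply: eq_big_nat => a lta; rewrite A_hi //; lia.
Qed.

(** The number of letters at most l in the tableau; unlike [t_intv_prod] it includes the rows where
    the entry is L. *)
Definition colsum w l : int := \sum_(0 <= a < k) A w a l.

Lemma t_gammaE w l : (0 < l <= n)%N ->
  (if (l <= r)%N then 0 else w None) + (t_intv_prod w l - t_intv_prod w l.-1)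
  = colsum w l - colsum w l.-1.
Proof.
move=> ltl; rewrite /colsum !sum_A_split; try lia.
case: leqP => lelr.
  have -> : (l - r = 0)%N by lia.
  have -> : (l.-1 - r = 0)%N by lia.
  by rewrite !mulr0n !add0r.
have -> : (l - r = (l.-1 - r).+1)%N by lia.
by rewrite mulrS; ring.
Qed.

Lemma colsum0 w : colsum w 0 = 0.
Proof. by rewrite /colsum big1 // => a _; rewrite A_lo. Qed.

(** The weight identity: epsilon_i minus phi_i is, tropically, the content of i minus that of i + 1,
    modulo n. The multiples of L restore the entries that [t_intv_prod] omits. *)
Lemma t_epsilonE w i : (i < n)%N ->
  (w None *+ (i == 0%N) - w None *+ (i == r)) +
    (t_intv_prod w i + t_intv_prod w i -
     (t_intv_prod w (if i == 0%N then n.-1 else i.-1) + t_intv_prod w i.+1))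
  = (colsum w (rep1n n i) - colsum w (rep1n n i).-1) - (colsum w i.+1 - colsum w i).
Proof.
move=> lti; rewrite -!t_gammaE /rep1n /=; try lia; try by (case: eqP; lia).
  have hn : t_intv_prod w n = 0 by rewrite /t_intv_prod big_geq //; lia.
  have h0 : t_intv_prod w 0 = 0 by rewrite /t_intv_prod big1 // => a _; rewrite A_lo.
  case: (posnP i) => [->|i0].
    rewrite h0 hn ifF; last by lia.
    rewrite ifT; last by lia.
    rewrite ltn_eqF ?subn_gt0 //= mulr1n mulr0n; ring.
  by rewrite /=; case: (ltngtP i r) => h; rewrite /= ?mulr1n ?mulr0n; ring.
Qed.

End Rectangles.

(** * The operators and toggles on k-rectangles *)

Section PiecewiseLinear.
Variables (n k : nat).
Hypotheses (k0 : (0 < k)%N) (lt_kn : (k < n)%N).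
Local Notation r := (n - k)%N.
Implicit Types w : {ffun coordk n k -> int}.
Local Notation A := (arrT 0).

Definition shift_entry w (b i : nat) (d : int) : {ffun coordk n k -> int} :=
  [ffun v : coordk n k => match v with
     | Some (a, q) => if (nat_of_ord a == b) && ((a.+1 + q)%N == i) then w v + d else w v
     | None => w v
     end].

Lemma A_coord (a q : nat) (lta : (a < k)%N) (ltq : (q < r)%N) w j :
  j = (a.+1 + q)%N -> A w a j = w (Some (Ordinal lta, Ordinal ltq)).
Proof. by move=> ->; apply: (@arr_ord _ _ _ 0 w (Ordinal lta) (Ordinal ltq)). Qed.

Lemma A_shift_entry w b i d a j : (a < k)%N -> (b < i <= b + r)%N ->
  A (shift_entry w b i d) a j = A w a j + (if (a == b) && (j == i) then d else 0).
Proof.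
move=> lta lti; have [le_ja|lt_aj] := leqP j a.
  by rewrite !A_lo // ifF //; lia.
have [gt_j|le_j] := ltnP (a + r) j.
  by rewrite !A_hi // ffunE ifF ?addr0 //; lia.
have ltq : (j - a.+1 < r)%N by lia.
have Ej : j = (a.+1 + (j - a.+1))%N by lia.
rewrite !(A_coord lta ltq _ Ej) ffunE /= -Ej.
by case: ifP; rewrite ?addr0.
Qed.

Section Columns.
Variables (w : {ffun coordk n k -> int}) (i b : nat).
Hypothesis lti : (0 < i < n)%N.
Hypothesis hb : (i - r <= b < minn i k)%N.
Hypothesis min_b : forall c, (i - r <= c < minn i k)%N -> t_esum_term w i b <= t_esum_term w i c.

(** Raising by 1 the terms of index at least c raises the minimum exactly when every minimizer has
    index at least c, that is c <= b for the leftmost one. Hence consecutive values differ only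
    between b and b + 1. *)
Lemma t_e_coords_up :
  (forall c, (i - r <= c < b)%N -> t_esum_term w i b < t_esum_term w i c) ->
  t_e_coords w i 1 = shift_entry w b i 1.
Proof.
move=> last_b.
have E c : t_esum w i 1 c = t_esum_term w i b + (if (c <= b)%N then 1 else 0).
  apply: (min_nat_unique hb); first by rewrite addrC.
  move=> d hd; have := min_b hd; case: (leqP c b) => hcb; case: (leqP c d) => hcd; try lia.
  by have := last_b d; lia.
apply/ffunP => -[[a q]|]; rewrite !ffunE //.
case: eqP => Ea; rewrite ?andbF ?andbT // !E.
by case: (ltngtP a b) => // h; rewrite ?addrK ?subrr ?addr0 //; lia.
Qed.

(** Lowering by 1 the terms of index at least c lowers the minimum exactly when some minimizer has
    index at least c, hence the rightmost one here. *)
Lemma t_e_coords_down :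
  (forall c, (b < c < minn i k)%N -> t_esum_term w i b < t_esum_term w i c) ->
  t_e_coords w i (-1) = shift_entry w b i (-1).
Proof.
move=> first_b.
have E c : t_esum w i (-1) c = t_esum_term w i b - (if (c <= b)%N then 1 else 0).
  apply: (min_nat_unique hb); first by case: ifP; lia.
  move=> d hd; have := min_b hd; case: (leqP c b) => hcb; case: (leqP c d) => hcd; try lia.
  by have := first_b d; lia.
apply/ffunP => -[[a q]|]; rewrite !ffunE //.
case: eqP => Ea; rewrite ?andbF ?andbT // !E.
by case: (ltngtP a b) => // h; rewrite ?subrr ?addr0 //; lia.
Qed.

End Columns.

(* The bounds between which the entry A_{a,j} of a k-rectangle may vary. *)
Definition entry_lo w a j : int :=
  if (a.+1 < k)%N then Num.max (A w a j.-1) (A w a.+1 j.+1) else A w a j.-1.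

Definition entry_hi w a j : int :=
  if a == 0%N then A w a j.+1 else Num.min (A w a j.+1) (A w a.-1 j.-1).

Lemma entry_bounds w a j : k_rectangle w -> (a < k)%N -> (0 < j < n)%N ->
  entry_lo w a j <= A w a j <= entry_hi w a j.
Proof.
move=> hw lta ltj; have h1 := rect_mono hw lta; have h2 := rect_diag hw.
have j1 : (j.-1.+1 = j)%N by lia.
have := h1 j; have := h1 j.-1; rewrite j1 => hA hB.
rewrite /entry_lo /entry_hi; case: (posnP a) => [a0|a0].
  case: ifP => lta1; rewrite ?ge_max hA ?hB ?h2 //; lia.
have a1 : (a.-1.+1 = a)%N by lia.
have := h2 a.-1 j.-1; rewrite a1 j1 => hC.
case: ifP => lta1; rewrite ?ge_max ?le_min hA ?hB ?hC ?h2 //; lia.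
Qed.

(** On a k-rectangle the neighbours omitted at the ends of a row, 0 or L, do not affect the bounds.
    At positions that hold no coordinate both bounds equal the fixed entry, so one formula covers
    the whole column. *)
Lemma A_toggle w j a m : k_rectangle w -> (a < k)%N -> (0 < j < n)%N ->
  A (t_toggle j w) a m =
  if m == j then entry_lo w a j + entry_hi w a j - A w a j else A w a m.
Proof.
move=> hw lta ltj; have h0 := rect_ge0 hw; have h1 := rect_mono hw; have h2 := rect_diag hw.
have [le_ma|lt_am] := leqP m a.
  rewrite !(@A_lo _ _ _ a m) //; case: (m =P j) => // Em; rewrite /entry_lo /entry_hi.
  rewrite gtn_eqF; last by lia.
  rewrite !(@A_lo _ _ _ a j.-1) ?(@A_lo _ _ _ a.-1 j.-1) ?(@A_lo _ _ _ a.+1 j.+1); try lia.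
  rewrite (@A_lo _ _ _ a j) -?Em //.
  have : 0 <= A w a m.+1 by apply: h0; lia.
  by case: ifP => _; lia.
have [gt_m|le_m] := ltnP (a + r) m.
  rewrite !(@A_hi _ _ _ a m) // ffunE; case: (m =P j) => // Em.
  have := h1 a j.-1 lta; rewrite prednK; last by lia.
  rewrite !(@A_hi _ _ _ a j) ?Em // ?(@A_hi _ _ _ a j); last by lia.
  rewrite /entry_lo /entry_hi (@A_hi _ _ _ a j.+1); last by lia.
  have -> : (a.+1 < k)%N by lia.
  rewrite (@A_hi _ _ _ a.+1 j.+1); last by lia.
  case: (posnP a) => a0; first by lia.
  by rewrite (@A_hi _ _ _ a.-1 j.-1); lia.
have ltq : (m - a.+1 < r)%N by lia.
have Em : m = (a.+1 + (m - a.+1))%N by lia.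
rewrite !(A_coord lta ltq _ Em) ffunE /= -Em.
case: (m =P j) => // Emj; subst j; rewrite -(A_coord lta ltq _ Em); congr (_ - _).
rewrite addrC; congr (_ + _).
  rewrite /t_tog_dn /entry_lo.
  case: (posnP (m - a.+1)) => [q0|q0].
    have -> : m.-1 = a by lia.
    rewrite (@A_lo _ _ _ a a) //; have -> : (a.+2 + (m - a.+1) = m.+1)%N by lia.
    case: ifP => // lta1; have : 0 <= A w a.+1 m.+1 by apply: h0; lia.
    by lia.
  have -> : (a.+2 + (m - a.+1) = m.+1)%N by lia.
  have -> : (a.+1 + (m - a.+1).-1 = m.-1)%N by lia.
  by case: ifP => // _; lia.
rewrite /t_tog_up /entry_hi; have -> : (a.+1 + (m - a.+1).+1 = m.+1)%N by lia.
case: (posnP a) => [a0|a0].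
  by case: ltnP => // hq; rewrite A_hi //; lia.
have -> : (a.-1.+1 + (m - a.+1) = m.-1)%N by lia.
case: ltnP => // hq; rewrite (@A_hi _ _ _ a m.+1); last by lia.
have H : A w a.-1 m.-1 <= A w a.-1 m.-1.+1 by apply: h1; lia.
have Em1 : m.-1.+1 = m by lia.
by rewrite Em1 (@A_hi _ _ _ a.-1 m) in H; lia.
Qed.

Lemma t_toggle_rect w j : k_rectangle w -> (0 < j < n)%N -> k_rectangle (t_toggle j w).
Proof.
move=> hw ltj; have h0 := rect_ge0 hw; have h1 := rect_mono hw; have h2 := rect_diag hw.
have E := A_toggle _ hw _ ltj; have B a (lta : (a < k)%N) := entry_bounds hw lta ltj.
have j1 : (j.-1.+1 = j)%N by lia.
have lo_le a : (a < k)%N -> A w a j.-1 <= entry_lo w a j.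
  by move=> lta; rewrite /entry_lo; case: ifP => _; lia.
have hi_le a : (a < k)%N -> entry_hi w a j <= A w a j.+1.
  by move=> lta; rewrite /entry_hi; case: ifP => _; lia.
have lo_diag a : (a.+1 < k)%N -> A w a.+1 j.+1 <= entry_lo w a j.
  by move=> lta; rewrite /entry_lo lta; lia.
have hi_diag a : (a.+1 < k)%N -> entry_hi w a.+1 j <= A w a j.-1.
  by move=> lta; rewrite /entry_hi /=; lia.
apply: rect_intro => // a m lta lem.
- rewrite E //; case: (m =P j) => Em; last exact: h0.
  by have := B a lta; have := lo_le a lta; have := h0 a j.-1 lta; lia.
- rewrite !E //; case: (m =P j) => Em; case: (m.+1 =P j) => Em1; try exact: h1; try lia.
  + by have := B a lta; have := hi_le a lta; rewrite Em; lia.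
  + have -> : m = j.-1 by lia.
    by have := B a lta; have := lo_le a lta; lia.
have lta' : (a < k)%N by lia.
rewrite !E //; case: (m =P j) => Em; case: (m.+1 =P j) => Em1; try exact: h2; try lia.
- by have := B a lta'; have := lo_diag a lta; rewrite Em; lia.
- have -> : m = j.-1 by lia.
  by have := B a.+1 lta; have := hi_diag a lta; lia.
Qed.

Lemma t_toggles_rect w s : k_rectangle w -> {subset s <= iota 1 n.-1} ->
  k_rectangle (t_toggles w s).
Proof.
move=> hw; elim: s => //= j s IH sub; apply: t_toggle_rect; last first.
  by have := sub j (mem_head _ _); rewrite mem_iota; lia.
by apply: IH => m ms; apply: sub; rewrite inE ms orbT.
Qed.

Lemma colsum_toggle w j m : k_rectangle w -> (0 < j < n)%N ->
  colsum (t_toggle j w) m =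
  if m == j then colsum w j.+1 + colsum w j.-1 - colsum w j else colsum w m.
Proof.
move=> hw ltj; rewrite /colsum.
have E a m' : (a < k)%N -> _ := fun lta => A_toggle m' hw lta ltj.
case: eqP => [->|neq]; last first.
  by apply: eq_big_nat => a lta; rewrite E ?ifF //; apply/eqP.
rewrite (eq_big_nat _ _ (F2 := fun a => entry_lo w a j + entry_hi w a j - A w a j)); last first.
  by move=> a lta; rewrite E ?eqxx //; lia.
rewrite sumrB; congr (_ - _).
(* The maximum in the lower bound of row a and the minimum in the upper bound of row a + 1 are of
   the same two numbers, so their corrections are d (a + 1) with opposite signs, and the sum
   telescopes. *)
pose d a := if a == 0%N then 0 else A w a j.+1 - Num.min (A w a j.+1) (A w a.-1 j.-1).
rewrite (eq_big_nat _ _ (F2 := fun a => (A w a j.+1 + A w a j.-1) +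
   ((if (a.+1 < k)%N then d a.+1 else 0) - d a))); last first.
  move=> a lta; rewrite /entry_lo /entry_hi /d /=.
  by case: (posnP a) => a0; case: ifP => lta1; lia.
rewrite 2!big_split /= [X in _ + X](_ : _ = 0) ?addr0 //.
have -> : \sum_(0 <= a < k) ((if (a.+1 < k)%N then d a.+1 else 0) - d a)
  = \sum_(0 <= a < k) ((fun a => if (a < k)%N then d a else 0) a.+1 -
                        (fun a => if (a < k)%N then d a else 0) a).
  by apply: eq_big_nat => a /andP[_ ->].
by rewrite telescope_sumr //= ltnn k0 /d /= subrr.
Qed.

(** Promotion rotates the content: the multiplicity of n becomes that of 1, and that of m becomes
    that of m + 1. This yields epsilon_0 from phi_0. *)
Lemma colsum_promote w m : k_rectangle w -> (0 < m <= n)%N ->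
  colsum (t_promote w) m = colsum w n - colsum w n.-1 + colsum w m.-1.
Proof.
move=> hw ltm.
suff H d : (d < n)%N -> forall m, (m <= n)%N ->
    colsum (t_toggles w (iota (n - d) d)) m =
    if (m < n - d)%N then colsum w m else colsum w n - colsum w n.-1 + colsum w m.-1.
  have := H n.-1; rewrite /t_promote; have -> : (n - n.-1 = 1)%N by lia.
  move=> -> //; try lia.
  by rewrite ifF //; lia.
elim: d => [_|d IH ltd] {ltm}m lem.
  rewrite subn0 /=; case: ltnP => // gem; have -> : m = n by lia.
  by rewrite subrK.
have Ed : (n - d.+1).+1 = (n - d)%N by lia.
rewrite /= Ed colsum_toggle; [|by apply: t_toggles_rect => // j; rewrite !mem_iota; lia|by lia].
case: eqP => Em; last first.
  rewrite IH //; last by lia.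
  by case: ltnP => h1; case: ltnP => h2 //; lia.
rewrite !IH; try lia.
rewrite ifF; last by lia.
rewrite ifT; last by lia.
rewrite ifT; last by lia.
rewrite ifF; last by lia.
by rewrite Em /=; ring.
Qed.

End PiecewiseLinear.

(** * The crystal operators on tableaux *)

Section Cancellation.
Variable i : nat.
Implicit Types (s t : seq (nat * nat)) (st : seq nat * seq nat).

(* Left-to-right bracket matching: the first stack holds the positions of the
   unmatched letters i, the second one those of the letters i+1. *)
Definition match_step st (p : nat * nat) : seq nat * seq nat :=
  if p.2 == i then if st.2 is _ :: V then (st.1, V) else (p.1 :: st.1, [::])
  else (st.1, p.1 :: st.2).

Definition match_word st s := foldl match_step st s.

Lemma match_cat st s t : match_word st (s ++ t) = match_word (match_word st s) t.
Proof. exact: foldl_cat. Qed.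

Lemma match_delete_pair st s : match_word st (delete_pair i s) = match_word st s.
Proof.
elim: s st => // x [|y s] IH st //=; case: ifP => [/andP[/eqP Ex /eqP Ey]|_].
  by rewrite /match_step Ex Ey eqxx gtn_eqF //=; case: st.
exact: IH.
Qed.

Lemma size_delete_pair s :
  delete_pair i s = s \/ (size (delete_pair i s)).+2 = size s.
Proof.
elim: s => [|x [|y s] IH]; try by left.
rewrite /= in IH *; case: ifP => _; first by right.
by case: IH => [->|E]; [left|right; rewrite /= E].
Qed.

Lemma all_delete_pair (P : pred (nat * nat)) s : all P s -> all P (delete_pair i s).
Proof.
elim: s => // x [|y s] IH //= /and3P[Px Py Ps]; case: ifP => //= _.
by rewrite Px /=; apply: IH; rewrite /= Py.
Qed.

(** Every pass that changes the word shortens it, so [size s] passes reach a fixed point. *)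
Lemma delete_pair_iter s :
  delete_pair i (iter (size s) (delete_pair i) s) = iter (size s) (delete_pair i) s.
Proof.
suff H m : delete_pair i (iter m (delete_pair i) s) = iter m (delete_pair i) s \/
    (size (iter m (delete_pair i) s) + m <= size s)%N.
  case: (H (size s)) => // le_s.
  suff -> : iter (size s) (delete_pair i) s = [::] by [].
  by apply: size0nil; lia.
elim: m => [|m [E|le_s]]; first by right; rewrite addn0.
  by left; rewrite /= !E.
rewrite /=; case: (size_delete_pair (iter m (delete_pair i) s)) => [E|E]; first by left; rewrite !E.
by right; lia.
Qed.

Lemma delete_pair_fixed s : delete_pair i s = s ->
  all (fun p => (p.2 == i) || (p.2 == i.+1)) s ->
  exists u v, [/\ s = u ++ v, all (fun p => p.2 == i) u & all (fun p => p.2 == i.+1) v].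
Proof.
elim: s => [|x s IH]; first by exists [::], [::].
move=> E /= /andP[Px Ps]; have Es : delete_pair i s = s.
  case: s E {IH Ps} => // y s /=; case: ifP => [_ /(congr1 size) /=|_ [] //]; lia.
have [u [v [Euv hu hv]]] := IH Es Ps.
case/orP: Px => Px; first by exists (x :: u), v; rewrite Euv /= Px.
exists [::], (x :: s); split=> //=; rewrite Px /=; rewrite Euv in E *.
case: u hu E {Euv} => [|y u] //= /andP[/eqP Py _].
by rewrite Px Py eqxx /= => /(congr1 size) /=; lia.
Qed.

Definition letters o (w : seq nat) :=
  [seq p <- zip (iota o (size w)) w | (p.2 == i) || (p.2 == i.+1)].

(** The repeated deletions are replaced by a single pass with two stacks, which can be run row by
    row. Deleting a pair does not change the outcome of the pass, and on a word i^a (i+1)^b the pass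
    merely lists the positions. *)
Lemma remaining_match w : let st := match_word ([::], [::]) (letters 0 w) in
  remaining i i w = rev st.1 /\ remaining i i.+1 w = rev st.2.
Proof.
rewrite /remaining /reduced_word -/(letters 0 w); set s := letters 0 w.
set t := iter _ _ _.
have Em : match_word ([::], [::]) s = match_word ([::], [::]) t.
  by rewrite /t; elim: (size s) => //= m ->; rewrite match_delete_pair.
have hall : all (fun p => (p.2 == i) || (p.2 == i.+1)) t.
  by rewrite /t; elim: (size s) => [|m IH] /=; [apply: filter_all|apply: all_delete_pair].
have [u [v [Et hu hv]]] : exists u v, [/\ t = u ++ v, all (fun p => p.2 == i) u
    & all (fun p => p.2 == i.+1) v] := delete_pair_fixed (delete_pair_iter s) hall.
have Eu U : match_word (U, [::]) u = (rev [seq p.1 | p <- u] ++ U, [::]).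
  elim: u U hu {Et} => //= x u IH U /andP[Ex hu].
  by rewrite /match_step Ex IH //= rev_cons cat_rcons.
have Ev U V : match_word (U, V) v = (U, rev [seq p.1 | p <- v] ++ V).
  elim: v V hv {Et} => //= x v IH V /andP[Ex hv].
  by rewrite /match_step (eqP Ex) gtn_eqF // IH //= rev_cons cat_rcons.
rewrite Em Et match_cat Eu Ev /= !cats0 !revK.
have filt (P Q : pred (nat * nat)) l : all P l -> (forall p, P p -> Q p = false) ->
    [seq p <- l | Q p] = [::].
  move=> hP PQ; apply/eqP; rewrite -(negbK (_ == _)) -has_filter.
  by apply/hasPn => p pl; rewrite PQ // (allP hP).
rewrite !filter_cat (all_filterP hu) (all_filterP hv).
rewrite (filt _ _ _ hv) => [|p /eqP->]; last by rewrite gtn_eqF.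
rewrite (filt _ _ _ hu) => [|p /eqP->]; last by rewrite ltn_eqF.
by rewrite cats0.
Qed.

Lemma match_block_low o x U V :
  match_word (U, V) (zip (iota o x) (nseq x i)) =
  (rev (drop (size V) (iota o x)) ++ U, drop x V).
Proof.
elim: x o U V => [|x IH] o U V; first by rewrite /= drop0.
rewrite /= {1}/match_step eqxx /=; case: V => [|v V] /=.
  by rewrite IH /= drop0 rev_cons cat_rcons.
by rewrite IH.
Qed.

Lemma match_block_high o y U V :
  match_word (U, V) (zip (iota o y) (nseq y i.+1)) = (U, rev (iota o y) ++ V).
Proof.
elim: y o V => [|y IH] o V //=.
by rewrite {1}/match_step /= gtn_eqF // IH rev_cons cat_rcons.
Qed.

Lemma letters_cat o w1 w2 : letters o (w1 ++ w2) = letters o w1 ++ letters (o + size w1) w2.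
Proof. by rewrite /letters size_cat iotaD zip_cat ?size_iota // filter_cat. Qed.

Lemma letters_none o w : all (fun l => (l != i) && (l != i.+1)) w -> letters o w = [::].
Proof.
rewrite /letters; elim: w o => //= l w IH o /andP[/andP[h1 h2] hw].
by rewrite (negPf h1) (negPf h2) /= IH.
Qed.

Lemma letters_nseq o m l : (l == i) || (l == i.+1) ->
  letters o (nseq m l) = zip (iota o m) (nseq m l).
Proof.
move=> hl; rewrite /letters size_nseq; apply/all_filterP.
by elim: m o => //= m IH o; rewrite hl IH.
Qed.

End Cancellation.

Section TableauRows.
Variables (n k : nat).
Hypotheses (k0 : (0 < k)%N) (lt_kn : (k < n)%N).
Local Notation r := (n - k)%N.
Variable w : {ffun coordk n k -> int}.
Hypothesis hw : k_rectangle w.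
Local Notation A := (@arrT n k int 0%R w).

Let h0 a j : (a < k)%N -> (j <= n)%N -> 0 <= A a j. Proof. exact: rect_ge0. Qed.
Let h1 a j : (a < k)%N -> (j < n)%N -> A a j <= A a j.+1. Proof. exact: rect_mono. Qed.
Let h2 a j : (a.+1 < k)%N -> (j < n)%N -> A a.+1 j.+1 <= A a j. Proof. exact: rect_diag. Qed.

Definition row_part (x : {ffun coordk n k -> int}) a (s : seq nat) : seq nat :=
  flatten [seq nseq (absz (@arrT n k int 0%R x a j - @arrT n k int 0%R x a j.-1)%R) j | j <- s].

Definition tab_row x a := row_part x a (iota 1 n).

Lemma tab_ofE x : tab_of x = [seq tab_row x a | a <- iota 0 k].
Proof.
rewrite /tab_of -val_enum_ord -map_comp; apply: eq_map => a /=.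
by congr flatten; apply: eq_map => j; rewrite !AijE.
Qed.

Lemma size_row_part a m : (a < k)%N -> (m <= n)%N -> size (row_part w a (iota 1 m)) = `|A a m|%N.
Proof.
move=> lta; elim: m => [|m IH] lem; first by rewrite A_lo.
have -> : iota 1 m.+1 = iota 1 m ++ [:: m.+1] by rewrite -[in LHS](addn1 m) iotaD add1n.
rewrite /row_part map_cat flatten_cat size_cat -/(row_part w a _) IH ?(ltnW lem) //.
rewrite /= cats0 size_nseq; have := h0 lta (ltnW lem); have := h1 lta lem; lia.
Qed.

Lemma size_tab_row a : (a < k)%N -> size (tab_row w a) = `|w None|%N.
Proof. by move=> lta; rewrite size_row_part // A_hi //; lia. Qed.

Lemma iota_split_at j : (0 < j <= n)%N -> iota 1 n = iota 1 j.-1 ++ j :: iota j.+1 (n - j).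
Proof.
move=> ltj; have -> : n = (j.-1 + (n - j).+1)%N by lia.
by rewrite iotaD /=; congr (_ ++ _ :: iota _ _); lia.
Qed.

Lemma tab_row_split a j : (a < k)%N -> (0 < j <= n)%N ->
  tab_row w a = row_part w a (iota 1 j.-1) ++ nseq (absz (A a j - A a j.-1)%R) j
                ++ row_part w a (iota j.+1 (n - j)).
Proof. by move=> lta ltj; rewrite /tab_row (iota_split_at ltj) /row_part map_cat flatten_cat. Qed.

Lemma row_part_letters (P : pred nat) x a s : all P s -> all P (row_part x a s).
Proof.
move=> hs; apply/allP => l /flattenP[_ /mapP[j js ->]] /nseqP[-> _].
exact: (allP hs).
Qed.

(** Turns statements about cells into inequalities between array entries, the form in which the
    Bender-Knuth rule is checked. *)
Lemma nth_tab_row a c j : (a < k)%N -> (0 < j <= n)%N ->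
  (nth 0%N (tab_row w a) c == j) = (A a j.-1 <= c%:Z < A a j).
Proof.
move=> lta ltj; have j1 : (j.-1.+1 = j)%N by lia.
have lej : (j.-1 <= n)%N by lia.
have hA1 := h0 lta lej; have hA : A a j.-1 <= A a j by rewrite -{2}j1; apply: h1; lia.
rewrite (tab_row_split lta ltj) nth_cat size_row_part //.
case: ltnP => hc.
  have hs : all (fun l => (l < j)%N) (row_part w a (iota 1 j.-1)).
    by apply: row_part_letters; apply/allP => l; rewrite mem_iota; lia.
  have hc' : (c < size (row_part w a (iota 1 j.-1)))%N by rewrite size_row_part.
  have hl := allP hs _ (mem_nth 0%N hc').
  rewrite (_ : (_ == j) = false); first by apply/esym/negbTE; lia.
  by apply/negbTE; rewrite neq_ltn hl.
rewrite nth_cat size_nseq; case: ltnP => hc2.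
  by rewrite nth_nseq hc2 eqxx; lia.
rewrite (_ : (_ == j) = false).
  have hc3 : A a j <= c%:Z by lia.
  by rewrite ltNge hc3 andbF.
apply/negbTE; set c' := (c - _ - _)%N.
have [hs|hs] := ltnP c' (size (row_part w a (iota j.+1 (n - j)))); last first.
  rewrite nth_default //.
  by case: (j) ltj.
have hl : all (fun l => (j < l)%N) (row_part w a (iota j.+1 (n - j))).
  by apply: row_part_letters; apply/allP => l; rewrite mem_iota; lia.
by have := allP hl _ (mem_nth 0%N hs); rewrite neq_ltn => ->; rewrite orbT.
Qed.

Lemma w_None_ge0 : 0 <= w None.
Proof. by rewrite -(@A_hi n k w 0 n); [exact: h0|lia]. Qed.

Lemma A_le_None a j : (a < k)%N -> (j <= n)%N -> A a j <= w None.
Proof.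
move=> lta lej; rewrite -(subKn lej); elim: (n - j)%N => [|d IH]; first by rewrite A_hi //; lia.
have [led|ltd] := leqP n d; first by rewrite (_ : (n - d.+1 = n - d)%N) //; lia.
apply: le_trans IH; rewrite (_ : (n - d = (n - d.+1).+1)%N); last by lia.
by apply: h1; lia.
Qed.

Lemma count_tab_row a m : (a < k)%N -> (m <= n)%N ->
  count (fun l => (l <= m)%N) (tab_row w a) = `|A a m|%N.
Proof.
move=> lta lem; rewrite -(size_row_part lta lem) /tab_row.
have -> : iota 1 n = iota 1 m ++ iota m.+1 (n - m) by rewrite -[in LHS](subnKC lem) iotaD add1n.
rewrite /row_part map_cat flatten_cat count_cat -!/(row_part w a _).
have : all (fun l => (l <= m)%N) (row_part w a (iota 1 m)).
  by apply: row_part_letters; apply/allP => l; rewrite mem_iota; lia.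
rewrite all_count => /eqP->.
suff -> : count (fun l => (l <= m)%N) (row_part w a (iota m.+1 (n - m))) = 0%N by rewrite addn0.
apply/eqP; rewrite -leqn0 leqNgt -has_count; apply/hasPn => l hl.
have hs : all (fun l => ~~ (l <= m)%N) (iota m.+1 (n - m)).
  by apply/allP => j; rewrite mem_iota; lia.
exact: (allP (row_part_letters w a hs)).
Qed.

Lemma rect_of_tab : rect_of n k (tab_of w) = w.
Proof.
apply/ffunP => -[[a s]|]; rewrite ffunE tab_ofE; last first.
  rewrite (_ : head _ _ = tab_row w 0); last by case: (k) k0.
  by rewrite size_tab_row // gez0_abs ?w_None_ge0.
rewrite (nth_map 0%N) ?size_iota // nth_iota // add0n count_tab_row //; last by have := ltn_ord s; have := ltn_ord a; lia.
rewrite gez0_abs; last by apply: h0 => //; have := ltn_ord s; have := ltn_ord a; lia.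
exact: arr_ord.
Qed.

Lemma content_tab_of l : (0 < l <= n)%N ->
  (content_tab l (tab_of w))%:Z = colsum w l - colsum w l.-1.
Proof.
move=> ltl; rewrite /content_tab tab_ofE count_flatten -map_comp sumnE big_map /colsum.
rewrite -sumrB (big_morph Posz PoszD (erefl _)) /index_iota subn0; apply: eq_big_seq => a.
rewrite mem_iota add0n => lta; rewrite /= (tab_row_split lta ltl) !count_cat.
have out s : all (fun m => m != l) s -> count_mem l (row_part w a s) = 0%N.
  move=> hs; apply/eqP; rewrite -leqn0 leqNgt -has_count; apply/hasPn => m hm /=.
  exact: (allP (row_part_letters w a hs)).
rewrite !out; last 2 first.
- by apply/allP => m; rewrite mem_iota; lia.
- by apply/allP => m; rewrite mem_iota; lia.
rewrite count_nseq /= eqxx mul1n add0n addn0.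
have E : (l.-1.+1 = l)%N by lia.
have : A a l.-1 <= A a l.-1.+1 by apply: h1 => //; lia.
rewrite E; lia.
Qed.

End TableauRows.

(** * Bracketing as a walk through the rows *)

Section Stack.
Variables (i k : nat) (x y p q : nat -> nat).

Definition block a := zip (iota (p a) (x a)) (nseq (x a) i)
                      ++ zip (iota (q a) (y a)) (nseq (y a) i.+1).

Fixpoint stack m : seq nat * seq nat :=
  if m is m'.+1 then match_word i (stack m') (block (k - m)) else ([::], [::]).

(** The word starts with the bottom row, so this is the excess of letters i + 1 over letters i after
    rows k - 1, ..., a have been read. *)
Definition height a : int := \sum_(a <= b < k) ((y b)%:Z - (x b)%:Z).

Lemma heightS a : (a < k)%N -> height a = (y a)%:Z - (x a)%:Z + height a.+1.
Proof. by move=> lta; rewrite /height big_ltn. Qed.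

(** The walk after the letters i of row b and before its letters i + 1, its lowest point within that
    row. *)
Definition depth b : int := height b.+1 - (x b)%:Z.

(* Reading row b makes the total number of unmatched letters i equal to
   - depth b if this exceeds the number before; every weak record empties the
   second stack. *)
Lemma stack_inv m : (m <= k)%N -> let st := stack m in
  [/\ (size st.2)%:Z = (size st.1)%:Z + height (k - m),
      forall b, (k - m <= b < k)%N -> - (size st.1)%:Z <= depth b,
      (0 < size st.1)%N -> exists bf, [/\ (k - m <= bf < k)%N, depth bf = - (size st.1)%:Z,
         forall c, (bf < c < k)%N -> depth bf < depth c & (head 0%N st.1).+1 = (p bf + x bf)%N]
    & (0 < m)%N -> exists bl, [/\ (k - m <= bl < k)%N, depth bl = - (size st.1)%:Z,
         forall c, (k - m <= c < bl)%N -> depth bl < depth c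
         & (0 < size st.2)%N -> last 0%N st.2 = q bl]].
Proof.
elim: m => [|m IH] lem.
  by rewrite /height big_geq ?subn0 //; split=> //= b; lia.
have /= [] := IH (ltnW lem); case: (stack m) => U V /= Esz hdep hU hV.
set a := (k - m.+1)%N; have Ea : (k - m = a.+1)%N by rewrite /a; lia.
have lta : (a < k)%N by rewrite /a; lia.
rewrite Ea in Esz hdep hU hV.
rewrite match_cat match_block_low match_block_high /=.
rewrite !size_cat !size_rev !size_drop !size_iota heightS //.
have ha : depth a = height a.+1 - (x a)%:Z by [].
(* If the row has fewer letters i than there are pending letters i + 1, all of them are matched, no
   record occurs, and the oldest pending i + 1 stays. *)
have [ltxV|leVx] := ltnP (x a) (size V).
  have Ex : (x a - size V = 0)%N by lia.
  rewrite [drop (size V) _]drop_oversize ?size_iota; last by lia.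
  rewrite Ex add0n /=; split; first by lia.
  - by move=> b hb; have [->|neq] := eqVneq b a; [|apply: hdep]; lia.
  - by case/hU=> bf [h1 h2 h3 h4]; exists bf; split=> //; lia.
  - move=> _; have m0 : (0 < m)%N.
      case: (posnP m) => // m0; have : height a.+1 = 0 by rewrite /height big_geq //; lia.
      by move=> E0; exfalso; move: Esz hU ltxV; rewrite E0; case: (U) => [|u U'] /=; first lia;
         move=> _ /(_ isT)[bf [h1 _ _ _]]; lia.
    have [bl [h1 h2 h3 h4]] := hV m0; exists bl; split=> //; first by lia.
    + by move=> c hc; have [->|neq] := eqVneq c a; [|apply: h3]; lia.
    + move=> _; rewrite -h4; last by lia.
      rewrite -[in RHS](cat_take_drop (x a) V) !last_cat.
      have : (0 < size (drop (x a) V))%N by rewrite size_drop; lia.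
      by case: (drop (x a) V).
(* Otherwise nothing remains pending, and the oldest unmatched i + 1 can only come from row a. The
   newest unmatched i is the last i of row a precisely when the record is strict. *)
rewrite [drop (x a) V]drop_oversize // cats0.
have Ex : (size V - x a = 0)%N by lia.
rewrite Ex addn0.
have Ed : depth a = - ((x a - size V) + size U)%N%:Z by lia.
split; first by lia.
- by move=> b hb; have [->|neq] := eqVneq b a; [|have := hdep b]; lia.
- move=> U0; have [E|ltVx] := eqVneq (x a) (size V).
    have [|bf [h1 h2 h3 h4]] := hU _; first by lia.
    exists bf; split=> //; try lia.
    by rewrite drop_oversize ?size_iota // E.
  exists a; split=> //; first by lia.
    by move=> c hc; have := hdep c; lia.
  rewrite drop_iota -nth0 nth_cat size_rev size_iota ifT; last by lia.
  by rewrite nth_rev ?size_iota ?nth_iota; lia.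
- move=> _; exists a; split=> //; try lia.
  move=> y0; rewrite -nth_last size_rev size_iota nth_rev ?size_iota ?nth_iota; lia.
Qed.

End Stack.

Section SetNth.
Variables (T : Type) (x0 : T).

Lemma set_nth_catl (s1 s2 : seq T) c v : (c < size s1)%N ->
  set_nth x0 (s1 ++ s2) c v = set_nth x0 s1 c v ++ s2.
Proof. by elim: s1 c => // z s1 IH [|c] //= ltc; rewrite IH. Qed.

Lemma set_nth_catr (s1 s2 : seq T) c v :
  set_nth x0 (s1 ++ s2) (size s1 + c) v = s1 ++ set_nth x0 s2 c v.
Proof. by elim: s1 => //= z s1 ->. Qed.

End SetNth.

Section TableauCrystal.
Variables (n k : nat).
Hypotheses (k0 : (0 < k)%N) (lt_kn : (k < n)%N).
Local Notation r := (n - k)%N.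
Implicit Types w : {ffun coordk n k -> int}.
Local Notation "'A' w" := (@arrT n k int 0%R w) (at level 10, w at level 9).

Definition tab_rows w a m := [seq tab_row w b | b <- iota a m].

Lemma reading_word_tab w : reading_word (tab_of w) = flatten (rev (tab_rows w 0 k)).
Proof. by rewrite /reading_word tab_ofE. Qed.

Lemma tab_row_split2 w a i : (0 < i < n)%N ->
  tab_row w a = row_part w a (iota 1 i.-1) ++ nseq (absz (A w a i - A w a i.-1)%R) i
    ++ nseq (absz (A w a i.+1 - A w a i)%R) i.+1 ++ row_part w a (iota i.+2 (n - i.+1)).
Proof.
move=> lti; rewrite /tab_row.
have -> : iota 1 n = iota 1 i.-1 ++ [:: i, i.+1 & iota i.+2 (n - i.+1)].
  have {1}-> : n = (i.-1 + (n - i.+1).+2)%N by lia.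
  by rewrite iotaD (_ : (1 + i.-1)%N = i); last lia.
by rewrite /row_part map_cat flatten_cat.
Qed.

Lemma size_rows w a m : k_rectangle w -> (a + m <= k)%N ->
  size (flatten (rev (tab_rows w a m))) = (m * `|w None|)%N.
Proof.
move=> hw; elim: m a => // m IH a lem; rewrite /tab_rows /= rev_cons flatten_rcons size_cat.
rewrite -/(tab_rows w _ _) IH ?size_tab_row //; try lia.
by rewrite mulSn addnC.
Qed.

Lemma with_reading_word_tab w w' : k_rectangle w -> k_rectangle w' -> w None = w' None ->
  with_reading_word (tab_of w) (reading_word (tab_of w')) = tab_of w'.
Proof.
move=> hw hw' E; rewrite /with_reading_word /reading_word.
suff -> : shape (rev (tab_of w)) = shape (rev (tab_of w')) by rewrite flattenK revK.
rewrite /shape !map_rev !tab_ofE -!map_comp; congr rev; apply/eq_in_map => a.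
by rewrite mem_iota /= => lta; rewrite !size_tab_row ?E.
Qed.

Section ShiftRow.
Variables (w : {ffun coordk n k -> int}) (i b : nat) (d : int).
Hypotheses (lti : (0 < i < n)%N) (ltb : (b < k)%N) (hb : (b < i <= b + r)%N).
Local Notation w' := (shift_entry w b i d).

Lemma row_part_shift a s : (a < k)%N -> (a != b) || all (fun j => (j != i) && (j != i.+1)) s ->
  row_part w' a s = row_part w a s.
Proof.
move=> lta hs; rewrite /row_part; congr flatten; apply/eq_in_map => j js.
rewrite !A_shift_entry //; case: (a =P b) hs => //= [_ /allP/(_ j js)/andP[n1 n2]|_ _].
  rewrite (negPf n1) addr0 ifF ?addr0 //; apply/negbTE; lia.
by rewrite !addr0.
Qed.

Lemma tab_row_shift a : (a < k)%N -> a != b -> tab_row w' a = tab_row w a.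
Proof. by move=> lta nab; rewrite /tab_row row_part_shift ?nab. Qed.

Lemma tab_row_shift_split : tab_row w' b = row_part w b (iota 1 i.-1)
  ++ nseq (absz (A w b i + d - A w b i.-1)%R) i
  ++ nseq (absz (A w b i.+1 - (A w b i + d))%R) i.+1 ++ row_part w b (iota i.+2 (n - i.+1)).
Proof.
rewrite (tab_row_split2 w' b lti) !A_shift_entry // !eqxx.
have -> : (i.-1 == i) = false by lia.
have -> : (i.+1 == i) = false by lia.
rewrite /= !addr0 !row_part_shift //; apply/orP; right; apply/allP => j; rewrite mem_iota; lia.
Qed.

Lemma reading_word_shift c v : k_rectangle w -> (c < `|w None|)%N ->
  tab_row w' b = set_nth 0%N (tab_row w b) c v ->
  reading_word (tab_of w') = set_nth 0%N (reading_word (tab_of w)) ((k - b.+1) * `|w None| + c) v.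
Proof.
move=> hw ltc Erow; rewrite !reading_word_tab.
have Ek : k = (b + (k - b.+1).+1)%N by lia.
have E z : flatten (rev (tab_rows z 0 k)) =
    flatten (rev (tab_rows z b.+1 (k - b.+1))) ++ tab_row z b ++ flatten (rev (tab_rows z 0 b)).
  rewrite {1}Ek /tab_rows iotaD map_cat rev_cat /= add0n rev_cons flatten_cat flatten_rcons.
  by rewrite catA.
rewrite !E -(@size_rows w b.+1 (k - b.+1)) //; last by lia.
rewrite set_nth_catr set_nth_catl ?size_tab_row // -Erow.
congr (flatten (rev _) ++ _ ++ flatten (rev _)); apply/eq_in_map => a; rewrite mem_iota => ha.
  by apply: tab_row_shift; lia.
by apply: tab_row_shift; lia.
Qed.

End ShiftRow.

Lemma tab_row_up w i b : k_rectangle w -> (0 < i < n)%N -> (b < k)%N -> (b < i <= b + r)%N ->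
  A w b i < A w b i.+1 ->
  tab_row (shift_entry w b i 1) b = set_nth 0%N (tab_row w b) `|A w b i| i.
Proof.
move=> hw lti ltb hb hy; rewrite tab_row_shift_split // (tab_row_split2 w b lti).
have hx : A w b i.-1 <= A w b i.-1.+1 by apply: (rect_mono hw) => //; lia.
have h0 : 0 <= A w b i.-1 by apply: (rect_ge0 hw) => //; lia.
rewrite (_ : i.-1.+1 = i) in hx; last by lia.
set x := absz (A w b i - A w b i.-1)%R; set y := absz (A w b i.+1 - (A w b i + 1))%R.
have -> : absz (A w b i + 1 - A w b i.-1)%R = (x + 1)%N by rewrite /x; lia.
have -> : absz (A w b i.+1 - A w b i)%R = y.+1 by rewrite /y; lia.
have -> : `|A w b i|%N = (size (row_part w b (iota 1 i.-1)) + (size (nseq x i) + 0))%N.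
  by rewrite size_row_part // ?size_nseq /x; lia.
by rewrite !set_nth_catr /= nseqD -!catA.
Qed.

Lemma tab_row_down w i b : k_rectangle w -> (0 < i < n)%N -> (b < k)%N -> (b < i <= b + r)%N ->
  A w b i.-1 < A w b i ->
  tab_row (shift_entry w b i (-1)) b = set_nth 0%N (tab_row w b) `|A w b i - 1| i.+1.
Proof.
move=> hw lti ltb hb hx; rewrite tab_row_shift_split // (tab_row_split2 w b lti).
have hy : A w b i <= A w b i.+1 by apply: (rect_mono hw) => //; lia.
have h0 : 0 <= A w b i.-1 by apply: (rect_ge0 hw) => //; lia.
set x := absz (A w b i - 1 - A w b i.-1)%R; set y := absz (A w b i.+1 - A w b i)%R.
have -> : absz (A w b i - A w b i.-1)%R = (x + 1)%N by rewrite /x; lia.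
have -> : absz (A w b i.+1 - (A w b i - 1))%R = y.+1 by rewrite /y; lia.
have -> : `|(A w b i - 1)%R|%N = (size (row_part w b (iota 1 i.-1)) + (size (nseq x i) + 0))%N.
  by rewrite size_row_part // ?size_nseq /x; lia.
by rewrite !set_nth_catr nseqD -!catA !set_nth_catr.
Qed.

End TableauCrystal.

Section CrystalOperators.
Variables (n k : nat).
Hypotheses (k0 : (0 < k)%N) (lt_kn : (k < n)%N).
Local Notation r := (n - k)%N.
Variables (w : {ffun coordk n k -> int}) (i : nat).
Hypotheses (hw : k_rectangle w) (lti : (0 < i < n)%N).
Local Notation A := (@arrT n k int 0%R w).

Definition low_letters a := absz (A a i - A a i.-1)%R.
Definition high_letters a := absz (A a i.+1 - A a i)%R.
(** Position in the reading word of the first i of row a: the k - a - 1 rows below it are read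
    earlier, each of length L. *)
Definition low_start a := ((k - a.+1) * `|w None| + `|A a i.-1|)%N.
Definition high_start a := ((k - a.+1) * `|w None| + `|A a i|)%N.

Local Notation x := low_letters.
Local Notation y := high_letters.
Local Notation stk := (stack i k x y low_start high_start).
Local Notation dep := (depth k x y).
Local Notation hgt := (height k x y).

Lemma low_lettersE a : (a < k)%N -> (x a)%:Z = A a i - A a i.-1.
Proof.
move=> lta; have : A a i.-1 <= A a i.-1.+1 by apply: (rect_mono hw) => //; lia.
have E : (i.-1.+1 = i)%N by lia.
rewrite E /low_letters; lia.
Qed.

Lemma high_lettersE a : (a < k)%N -> (y a)%:Z = A a i.+1 - A a i.
Proof.
move=> lta; have : A a i <= A a i.+1 by apply: (rect_mono hw) => //; lia.
rewrite /high_letters; lia.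
Qed.

Lemma low_high_start a : (a < k)%N -> (low_start a + x a = high_start a)%N.
Proof.
move=> lta; have := low_lettersE lta.
have : 0 <= A a i.-1 by apply: (rect_ge0 hw) => //; lia.
rewrite /low_start /high_start; lia.
Qed.

Lemma letters_tab_row a o : (a < k)%N ->
  letters i o (tab_row w a) = zip (iota (o + `|A a i.-1|) (x a)) (nseq (x a) i)
    ++ zip (iota (o + `|A a i|) (y a)) (nseq (y a) i.+1).
Proof.
move=> lta; rewrite (tab_row_split2 k0 lt_kn w a lti) !letters_cat.
have out s o' : all (fun j => (j != i) && (j != i.+1)) s -> letters i o' (row_part w a s) = [::].
  by move=> hs; apply/letters_none/row_part_letters.
rewrite (out (iota 1 _)) ?(out (iota i.+2 _)).
- rewrite cats0 /= !letters_nseq ?eqxx ?orbT // size_nseq size_row_part //; last by lia.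
  congr (_ ++ zip (iota _ _) _); rewrite -/(x a); have := low_high_start lta.
  rewrite /low_start /high_start; lia.
- by apply/allP => j; rewrite mem_iota; lia.
- by apply/allP => j; rewrite mem_iota; lia.
Qed.

Lemma stack_rows m : (m <= k)%N ->
  match_word i ([::], [::]) (letters i 0 (flatten (rev (tab_rows w (k - m) m)))) = stk m.
Proof.
elim: m => // m IH lem; have Ea : (k - m = (k - m.+1).+1)%N by lia.
rewrite /tab_rows /= rev_cons flatten_rcons letters_cat match_cat -/(tab_rows _ _ _).
rewrite -Ea IH ?(ltnW lem) // size_rows //; last by lia.
rewrite letters_tab_row //; last by lia.
rewrite /block /low_start /high_start add0n.
by have -> : (k - (k - m.+1).+1 = m)%N by lia.
Qed.

Lemma remaining_tab : let st := stk k in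
  remaining i i (reading_word (tab_of w)) = rev st.1
  /\ remaining i i.+1 (reading_word (tab_of w)) = rev st.2.
Proof.
rewrite reading_word_tab -(stack_rows (leqnn k)) subnn.
exact: remaining_match.
Qed.

Lemma phi_tabE : phi_tab i (tab_of w) = size (stk k).1.
Proof. by rewrite /phi_tab; case: remaining_tab => -> _; rewrite size_rev. Qed.

Lemma eps_tabE : eps_tab i (tab_of w) = size (stk k).2.
Proof. by rewrite /eps_tab; case: remaining_tab => _ ->; rewrite size_rev. Qed.

(** The bridge between the two crystals: the terms whose minimum is the tropical phi_i are the low
    points of the bracketing walk. *)
Lemma t_esum_depth b : (b < k)%N -> t_esum_term w i b = dep b.
Proof.
move=> ltb; have Ei : (i.-1.+1 = i)%N by lia.
have Ez c : (c < k)%N -> zdiff w c i.-1 = (x c)%:Z /\ zdiff w c i = (y c)%:Z.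
  by move=> ltc; rewrite low_lettersE // high_lettersE // /zdiff Ei.
rewrite /t_esum_term /depth /height (proj1 (Ez b ltb)); congr (_ - _).
by apply: eq_big_nat => c /andP[_ ltc]; case: (Ez c ltc) => -> ->.
Qed.

Local Notation lo := (i - r)%N.
Local Notation hi := (minn i k).

Lemma letters_high b : (i <= b < k)%N -> x b = 0%N /\ (y b)%:Z = A b i.+1.
Proof.
move=> hb; have ltb : (b < k)%N by lia.
have := low_lettersE ltb; have := high_lettersE ltb.
have -> : A b i = 0 by rewrite A_lo //; lia.
have -> : A b i.-1 = 0 by rewrite A_lo //; lia.
lia.
Qed.

Lemma depth_high b : (i <= b < k)%N -> dep b = 0.
Proof.
move=> hb; rewrite /depth /height big1_seq; first by have [-> _] := letters_high hb.
move=> c; rewrite mem_index_iota => /andP[_ hc].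
have [|-> ->] := @letters_high c; first by lia.
by rewrite A_lo //; lia.
Qed.

(** The walk starts at 0, while the tropical minimum runs over active rows only; this makes that
    minimum nonpositive too. If row i, from 0, exists, each of its letters i + 1 lies below a letter
    i. *)
Lemma depth_last_active : dep hi.-1 <= 0.
Proof.
case: (leqP k i) => [leki|ltik].
  by rewrite /depth (_ : hgt _ = 0) ?sub0r ?oppr_le0 // /height big_geq //; lia.
have Ei : (i.-1.+1 = i)%N by lia.
have lti1 : (i.-1 < k)%N by lia.
have [|_ Ey] := @letters_high i; first by lia.
have E0 := @depth_high i; have := low_lettersE lti1.
have -> : A i.-1 i.-1 = 0 by rewrite A_lo.
have : A i.-1.+1 i.+1 <= A i.-1 i by apply: (rect_diag hw); lia.
have [|Ex _] := @letters_high i; first by lia.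
rewrite /depth Ei heightS //; rewrite /depth in E0; lia.
Qed.

Lemma letters_low b : (b < lo)%N -> y b = 0%N /\ ((b < lo.-1)%N -> x b = 0%N).
Proof.
move=> hb; have ltb : (b < k)%N by lia.
have := low_lettersE ltb; have := high_lettersE ltb.
have -> : A b i = w None by rewrite A_hi //; lia.
have -> : A b i.+1 = w None by rewrite A_hi //; lia.
move=> hy hx; split; first by lia.
by move=> lt_b; rewrite A_hi in hx; lia.
Qed.

Lemma low_letters_lo : (0 < lo)%N ->
  (y lo)%:Z = w None - A lo i /\ (x lo.-1)%:Z = w None - A lo.-1 i.-1.
Proof.
move=> lo0; rewrite high_lettersE ?low_lettersE; try lia.
have -> : A lo i.+1 = w None by rewrite A_hi //; lia.
by have -> : A lo.-1 i = w None by rewrite A_hi //; lia.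
Qed.

(** The letters i of row lo - 1 end that row; below them row lo has entries greater than i and,
    being full by i + 1, only letters i + 1. *)
Lemma letters_lo_le : (0 < lo)%N -> (x lo.-1 <= y lo)%N.
Proof.
move=> lo0; have [Ey Ex] := low_letters_lo lo0.
have : A lo.-1.+1 i.-1.+1 <= A lo.-1 i.-1 by apply: (rect_diag hw); lia.
rewrite !prednK; lia.
Qed.

(** Above row lo the walk moves only at the letters i of row lo - 1; by [letters_lo_le] it never
    gets below the depth of row lo. *)
Lemma height_low b : (b < lo)%N ->
  hgt b = dep lo + (y lo)%:Z - (x lo.-1)%:Z /\ dep b = hgt b.
Proof.
move=> hb; have [m Em] : exists m, lo = (b + m.+1)%N by exists (lo - b.+1)%N; lia.
have Elo : hgt lo = dep lo + (y lo)%:Z by rewrite /depth heightS; lia.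
elim: m b hb Em => [|m IH] b hb Em.
  have Eb : b = lo.-1 by lia.
  have Eb1 : b.+1 = lo by lia.
  have [Ey _] := letters_low hb.
  have ltb : (b < k)%N by lia.
  have := heightS x y ltb; rewrite [dep b]/depth Eb1 Elo Ey -Eb; lia.
have [||E1 E2] := IH b.+1; try lia.
have [Ey Ex] := letters_low hb; have {}Ex : x b = 0%N by apply: Ex; lia.
have ltb : (b < k)%N by lia.
have := heightS x y ltb; rewrite [dep b]/depth Ex Ey; lia.
Qed.

End CrystalOperators.

(** * Bracketing rule against tropical operators *)

Section CrystalRectangles.
Variables (n k : nat).
Hypotheses (k0 : (0 < k)%N) (lt_kn : (k < n)%N).
Local Notation r := (n - k)%N.
Variables (w : {ffun coordk n k -> int}) (i : nat).
Hypotheses (hw : k_rectangle w) (lti : (0 < i < n)%N).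
Local Notation A := (@arrT n k int 0%R w).
Local Notation x := (low_letters w i).
Local Notation y := (high_letters w i).
Local Notation stk := (stack i k x y (low_start w i) (high_start w i)).
Local Notation dep := (depth k x y).
Local Notation hgt := (height k x y).
Local Notation lo := (i - r)%N.
Local Notation hi := (minn i k).
Local Notation U := (stk k).1.
Local Notation V := (stk k).2.

Let lt_lh : (lo < hi)%N. Proof. lia. Qed.

Let depth_ge b : (b < k)%N -> - (size U)%:Z <= dep b.
Proof.
by move=> ltb; have [_ h _ _] := stack_inv i x y (low_start w i) (high_start w i) (leqnn k); apply: h; lia.
Qed.

Let size_stack : (size V)%:Z = (size U)%:Z + hgt 0%N.
Proof. by have [h _ _ _] := stack_inv i x y (low_start w i) (high_start w i) (leqnn k); rewrite subnn in h. Qed.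

Let height_low0 : (0 < lo)%N -> hgt 0%N = dep lo + (y lo)%:Z - (x lo.-1)%:Z.
Proof. by move=> lo0; have [] := height_low k0 lt_kn hw lti lo0. Qed.

(** The record row is active: below the active range the depth is 0, and above it row lo is at least
    as deep, against strictness. *)
Let down_row : (0 < size U)%N -> exists b, [/\ (lo <= b < hi)%N, dep b = - (size U)%:Z,
  forall c, (b < c < k)%N -> dep b < dep c & (head 0%N U).+1 = high_start w i b].
Proof.
move=> U0; have [_ _ h _] := stack_inv i x y (low_start w i) (high_start w i) (leqnn k).
have [b [hb Eb hlt Eh]] := h U0; rewrite subnn in hb; exists b; split=> //; last first.
  by rewrite Eh; apply: (low_high_start k0 lt_kn hw lti); lia.
have [leib|ltbi] := leqP i b.
  by have := depth_high k0 lt_kn hw lti (b := b); lia.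
suff : (lo <= b)%N by lia.
rewrite leqNgt; apply/negP => ltb.
have [E1 E2] := height_low k0 lt_kn hw lti ltb.
have lo0 : (0 < lo)%N by lia.
have := letters_lo_le k0 lt_kn hw lti lo0; have := hlt lo; lia.
Qed.

(** A record row below the active range would contradict [depth_last_active]. A record row above it
    would have depth equal to the final height, leaving no unmatched i + 1. *)
Let up_row : (0 < size V)%N -> exists b, [/\ (lo <= b < hi)%N, dep b = - (size U)%:Z,
  forall c, (c < b)%N -> dep b < dep c & last 0%N V = high_start w i b].
Proof.
move=> V0; have [_ _ _ /(_ k0)] := stack_inv i x y (low_start w i) (high_start w i) (leqnn k).
rewrite subnn => -[b [hb Eb hlt Eh]]; exists b; split=> //; last exact: Eh.
have [leib|ltbi] := leqP i b.
  have := depth_high k0 lt_kn hw lti (b := b).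
  have := depth_last_active k0 lt_kn hw lti; have := hlt hi.-1; lia.
suff : (lo <= b)%N by lia.
rewrite leqNgt; apply/negP => ltb.
have [E1 E2] := height_low k0 lt_kn hw lti ltb.
have lo0 : (0 < lo)%N by lia.
have := letters_lo_le k0 lt_kn hw lti lo0; have := height_low0 lo0; have := depth_ge (b := lo); lia.
Qed.

(** If some i is unmatched, [down_row] gives an active row attaining the bound of [stack_inv];
    otherwise all depths are nonnegative, and the last active row attains 0. *)
Lemma t_phi_sum_tab : t_phi_sum w i = - (phi_tab i (tab_of w))%:Z.
Proof.
rewrite /t_phi_sum phi_tabE //; have hge c : (lo <= c < hi)%N -> - (size U)%:Z <= t_esum_term w i c.
  by move=> hc; rewrite t_esum_depth //; [apply: depth_ge|]; lia.
case: (posnP (size U)) => [U0|U0].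
  have hb : (lo <= hi.-1 < hi)%N by lia.
  apply: (min_nat_unique hb _ hge); rewrite t_esum_depth //; last by lia.
  have := depth_last_active k0 lt_kn hw lti; have := depth_ge (b := hi.-1); lia.
have [b [hb Eb _ _]] := down_row U0.
by apply: (min_nat_unique hb _ hge); rewrite t_esum_depth //; lia.
Qed.

Lemma eps_phi_tab : (eps_tab i (tab_of w))%:Z = (phi_tab i (tab_of w))%:Z
  + ((colsum w i.+1 - colsum w i) - (colsum w i - colsum w i.-1)).
Proof.
rewrite eps_tabE // phi_tabE // size_stack; congr (_ + _).
rewrite /height /colsum -!sumrB; apply: eq_big_nat => a /andP[_ lta].
by rewrite (low_lettersE k0 lt_kn hw lti lta) (high_lettersE k0 lt_kn hw lti lta).
Qed.

Let active_bounds b : (lo <= b < hi)%N -> (b < k)%N /\ (b < i <= b + r)%N.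
Proof. lia. Qed.

Lemma e_tab_rect : let v := t_e_coords w i 1 in
  (k_rectangle v /\ e_tab i (tab_of w) = Some (tab_of v)) \/
  (~ k_rectangle v /\ e_tab i (tab_of w) = None).
Proof.
have Ei : (i.-1.+1 = i)%N by lia.
have [_ Erem] := remaining_tab k0 lt_kn hw lti.
case: (posnP (size V)) => V0.
  right; split; last by rewrite /e_tab Erem (size0nil V0).
  have [b [hb min_b lt_b]] := leftmost_argmin dep lt_lh.
  have [ltb hbi] := active_bounds hb.
  rewrite (t_e_coords_up k0 lt_kn lti hb); first last.
  - by move=> c hc; rewrite !t_esum_depth //; [apply: lt_b|lia..].
  - by move=> c hc; rewrite !t_esum_depth //; [apply: min_b|lia..].
  move=> hv; have E0 := size_stack; rewrite V0 in E0; have hge := depth_ge ltb.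
  have ltlo : (lo < k)%N by lia.
  have lb := heightS x y ltlo.
  have Elo : dep lo = hgt lo - (y lo)%:Z by rewrite /depth; lia.
  have Ey := high_lettersE k0 lt_kn hw lti ltb.
  have y0 : (0 < y b)%N.
    have lt_in : (i < n)%N by lia.
    have := rect_mono hv ltb lt_in; rewrite !A_shift_entry // !eqxx /=.
    rewrite (_ : (i.+1 == i) = false); lia.
  have hlo := depth_ge ltlo; have hlob := min_b lo; have ltlob := lt_b lo.
  case: (posnP lo) => lo0.
    have {}E0 : 0 = (size U)%:Z + hgt lo by rewrite lo0.
    have Eb : b = lo by lia.
    by rewrite Eb in y0; lia.
  have := height_low0 lo0; have := letters_lo_le k0 lt_kn hw lti lo0.
  have [Eylo Exlo] := low_letters_lo k0 lt_kn hw lti lo0 => hle hE.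
  have Eb : b = lo by lia.
  have : arrT 0 (shift_entry w b i 1) lo.-1.+1 i.-1.+1 <= arrT 0 (shift_entry w b i 1) lo.-1 i.-1.
    by apply: (rect_diag hv); lia.
  rewrite !A_shift_entry //; try lia.
  rewrite (prednK lo0) Ei Eb !eqxx /= (_ : (lo.-1 == lo) = false) /=; lia.
left; have [b [hb Eb lt_b hlast]] := up_row V0; have [ltb hbi] := active_bounds hb.
rewrite (t_e_coords_up k0 lt_kn lti hb); first last.
- by move=> c hc; rewrite !t_esum_depth //; [apply: lt_b|..]; lia.
- by move=> c hc; rewrite !t_esum_depth // ?Eb; [apply: depth_ge|..]; lia.
have Ey := high_lettersE k0 lt_kn hw lti ltb; have hS := heightS x y ltb.
(* Strict minimality against row b - 1 means that row b has more letters i + 1 than row b - 1 has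
   letters i. This leaves room for the raised entry in its row and under row b - 1. *)
have y0 : (0 < y b)%N.
  case: (posnP b) => b0; first by have := size_stack; rewrite b0 /depth in hS Eb *; lia.
  have := lt_b b.-1; rewrite {2}/depth (prednK b0) hS; rewrite /depth in Eb *; lia.
have diag_b : (0 < b)%N -> A b i < A b.-1 i.-1.
  move=> b0; have Ex := low_lettersE k0 lt_kn hw lti (a := b.-1) (leq_ltn_trans (leq_pred _) ltb).
  have : A b.-1.+1 i.+1 <= A b.-1 i by apply: (rect_diag hw); lia.
  have := lt_b b.-1; rewrite {2}/depth (prednK b0) hS; rewrite /depth in Eb *; lia.
have hv : k_rectangle (shift_entry w b i 1).
  apply: rect_intro => [a j lta lej|a j lta ltj|a j lta ltj]; rewrite !A_shift_entry //; try lia.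
  - by have := rect_ge0 hw lta lej; case: ifP; lia.
  - have := rect_mono hw lta ltj; case: (a =P b) => [Ea|_] /=; last by lia.
    case: (j =P i) => [Ej|_]; last by case: ifP; lia.
    by rewrite ifF; [rewrite Ea Ej; lia|lia].
  - have := rect_diag hw lta ltj; case: (a.+1 =P b) => [Ea|_] /=; last by case: ifP; lia.
    case: (j.+1 =P i) => [Ej|_]; last by case: ifP; lia.
    by have := diag_b; rewrite -Ea -Ej /=; case: ifP; lia.
split=> //; rewrite /e_tab Erem; case: (lastP V) V0 hlast => // V' p _.
rewrite last_rcons rev_rcons => -> /=; congr Some.
have ltc : (`|A b i| < `|w None|)%N.
  have h0 : 0 <= A b i by apply: (rect_ge0 hw) => //; lia.
  by have lei : (i.+1 <= n)%N; [lia|have := A_le_None k0 lt_kn hw ltb lei; lia].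
have Erow : tab_row (shift_entry w b i 1) b = set_nth 0%N (tab_row w b) `|A b i| i.
  by apply: tab_row_up => //; lia.
rewrite /high_start -(reading_word_shift k0 lt_kn lti ltb hbi hw ltc Erow).
by apply: with_reading_word_tab; rewrite ?ffunE.
Qed.

Lemma f_tab_rect : let v := t_e_coords w i (-1) in
  (k_rectangle v /\ f_tab i (tab_of w) = Some (tab_of v)) \/
  (~ k_rectangle v /\ f_tab i (tab_of w) = None).
Proof.
have Ei : (i.-1.+1 = i)%N by lia.
have lti1 : (i.-1 < n)%N by lia.
have [Erem _] := remaining_tab k0 lt_kn hw lti.
case: (posnP (size U)) => U0.
  right; split; last by rewrite /f_tab Erem (size0nil U0).
  have [b [hb min_b lt_b]] := rightmost_argmin dep lt_lh.
  have [ltb hbi] := active_bounds hb.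
  rewrite (t_e_coords_down k0 lt_kn lti hb); first last.
  - by move=> c hc; rewrite !t_esum_depth //; [apply: lt_b|lia..].
  - by move=> c hc; rewrite !t_esum_depth //; [apply: min_b|lia..].
  (* Without an unmatched i all depths are nonnegative, so the rightmost minimum is 0, at the last
     active row. Lowering there breaks the row inequality if k <= i and the diagonal one with the
     next row otherwise. *)
  move=> hv; have hge := depth_ge ltb; have hlast := depth_last_active k0 lt_kn hw lti.
  have Eb : b = hi.-1 by have := lt_b hi.-1; rewrite U0 in hge; lia.
  have Ex := low_lettersE k0 lt_kn hw lti ltb.
  have x0 : (0 < x b)%N.
    have := rect_mono hv ltb lti1; rewrite Ei !A_shift_entry // !eqxx /=.
    rewrite (_ : (i.-1 == i) = false); lia.
  have [leki|ltik] := leqP k i.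
    have E0 : hgt b.+1 = 0 by rewrite /height big_geq //; lia.
    by move: hlast hge; rewrite -Eb /depth E0 U0; lia.
  have Eb1 : b = i.-1 by lia.
  have hii : (i <= i < k)%N by lia.
  have [Exi Eyi] := letters_high k0 lt_kn hw lti hii.
  have hS := heightS x y ltik; have hdi := depth_high k0 lt_kn hw lti (b := i).
  have lt_in : (i < n)%N by lia.
  have lti1k : (i.-1.+1 < k)%N by lia.
  have := rect_diag hv lti1k lt_in; rewrite !A_shift_entry //; try lia.
  rewrite Ei Eb1 !eqxx (_ : (i == i.-1) = false) /= ?addr0; last by lia.
  have E0 : A i.-1 i.-1 = 0 by rewrite A_lo.
  rewrite Eb1 E0 in Ex; rewrite -Eb Eb1 /depth Ei in hlast; rewrite Eb1 /depth Ei U0 in hge.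
  rewrite /depth in hdi; lia.
left; have [b [hb Eb lt_b hhead]] := down_row U0; have [ltb hbi] := active_bounds hb.
rewrite (t_e_coords_down k0 lt_kn lti hb); first last.
- by move=> c hc; rewrite !t_esum_depth //; [apply: lt_b|..]; lia.
- by move=> c hc; rewrite !t_esum_depth // ?Eb; [apply: depth_ge|..]; lia.
have Ex := low_lettersE k0 lt_kn hw lti ltb.
have h0 : 0 <= A b i.-1 by apply: (rect_ge0 hw) => //; lia.
(* Strict minimality against row b + 1: there are fewer letters i + 1 in that row than letters i in
   row b, so the lowered entry still dominates its lower neighbour. *)
have x_y : (b.+1 < k)%N -> (y b.+1 < x b)%N.
  move=> ltb1; have hS := heightS x y ltb1; have := lt_b b.+1; rewrite /depth hS; lia.
have x0 : (0 < x b)%N.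
  have [lekb|ltb1] := leqP k b.+1; last by have := x_y ltb1; lia.
  by move: Eb; rewrite /depth /height big_geq //; lia.
have diag_b : (b.+1 < k)%N -> A b.+1 i.+1 < A b i.
  move=> ltb1; have Ey := high_lettersE k0 lt_kn hw lti ltb1.
  have : A b.+1 i.-1.+1 <= A b i.-1 := rect_diag hw ltb1 lti1.
  by rewrite Ei; have := x_y ltb1; lia.
have hv : k_rectangle (shift_entry w b i (-1)).
  apply: rect_intro => [a j lta lej|a j lta ltj|a j lta ltj]; rewrite !A_shift_entry //; try lia.
  - by have := rect_ge0 hw lta lej; case: (a =P b) => [->|_] /=; [case: (j =P i) => [->|_]|]; lia.
  - have := rect_mono hw lta ltj; case: (a =P b) => [Ea|_] /=; last by lia.
    case: (j.+1 =P i) => [Ej|_]; last by case: ifP; lia.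
    by rewrite ifF; [move: Ex x0; rewrite Ea -Ej /=; lia|lia].
  - have := rect_diag hw lta ltj; case: (a =P b) => [Ea|_] /=; last by case: ifP; lia.
    case: (j =P i) => [Ej|_]; last by case: ifP; lia.
    by have := diag_b; rewrite -Ea -Ej /=; case: ifP; lia.
split=> //; rewrite /f_tab Erem revK; case: (U) U0 hhead => // p U' _ /= hp; congr Some.
have ltc : (`|(A b i - 1)%R| < `|w None|)%N.
  by have lei : (i <= n)%N; [lia|have := A_le_None k0 lt_kn hw ltb lei; lia].
have Erow : tab_row (shift_entry w b i (-1)) b = set_nth 0%N (tab_row w b) `|(A b i - 1)%R| i.+1.
  by apply: tab_row_down => //; lia.
have -> : p = ((k - b.+1) * `|w None| + `|(A b i - 1)%R|)%N.
  by move: hp; rewrite /high_start; lia.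
rewrite -(reading_word_shift k0 lt_kn lti ltb hbi hw ltc Erow).
by apply: with_reading_word_tab; rewrite ?ffunE.
Qed.

End CrystalRectangles.

(** * Bender-Knuth involutions *)

Section TropicalToggles.
Variables (n k : nat).
Local Notation r := (n - k)%N.
Implicit Types w : {ffun coordk n k -> int}.
Local Notation X w a q := (@arrT n k int 0%R w a (a.+1 + q)).

Lemma Z_toggle j w a q : (a < k)%N -> (q < r)%N ->
  X (t_toggle j w) a q =
  if (a.+1 + q)%N == j then t_tog_up w a q + t_tog_dn w a q - X w a q else X w a q.
Proof.
move=> lta ltq.
have E (z : {ffun coordk n k -> int}) : X z a q = z (Some (Ordinal lta, Ordinal ltq)).
  exact: (@arr_ord _ _ _ 0 z (Ordinal lta) (Ordinal ltq)).
by rewrite !E ffunE.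
Qed.

Lemma t_toggleK j w : t_toggle j (t_toggle j w) = w.
Proof.
apply/ffunP => -[[a q]|]; last by rewrite !ffunE.
have lta := ltn_ord a; have ltq := ltn_ord q.
have E (z : {ffun coordk n k -> int}) : z (Some (a, q)) = X z a q by apply: esym; apply: arr_ord.
rewrite !E Z_toggle //; case: eqP => [Ej|]; last by rewrite Z_toggle // => /eqP/negPf->.
have lev b p : (b < k)%N -> (p < r)%N -> (b.+1 + p)%N != j -> X (t_toggle j w) b p = X w b p.
  by move=> ltb ltp /negPf neq; rewrite Z_toggle // neq.
have -> : t_tog_up (t_toggle j w) a q = t_tog_up w a q.
  rewrite /t_tog_up ffunE; case: (posnP a) => [a0|a0].
    by case: ifP => // ltq1; rewrite lev //; apply/eqP; lia.
  by case: ifP => // ltq1; rewrite ?lev //; try apply/eqP; lia.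
have -> : t_tog_dn (t_toggle j w) a q = t_tog_dn w a q.
  rewrite /t_tog_dn; case: ifP => lta1; case: ifP => q0 //; rewrite ?lev //; try apply/eqP; lia.
by rewrite Z_toggle // Ej eqxx; lia.
Qed.

Lemma t_toggles_rev w s : t_toggles (t_toggles w (rev s)) s = w.
Proof.
elim: s w => //= j s IH w; rewrite rev_cons -cats1 /t_toggles foldr_cat /= -/(t_toggles _ _).
by rewrite -/(t_toggles _ s) IH t_toggleK.
Qed.

Lemma t_promote_invK w : t_promote (t_promote_inv w) = w.
Proof. exact: t_toggles_rev. Qed.

End TropicalToggles.

Lemma count_interval lo hi m : (count (fun c => (lo <= c < hi)%N) (iota 0 m) = minn m hi - lo)%N.
Proof.
elim: m => [|m IH]; first by rewrite min0n.
have -> : iota 0 m.+1 = iota 0 m ++ [:: m] by rewrite -(addn1 m) (iotaD 0 m 1).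
rewrite count_cat IH /=.
case: (boolP (lo <= m < hi)%N) => h; rewrite /=; lia.
Qed.

Section BenderKnuth.
Variables (n k : nat).
Hypotheses (k0 : (0 < k)%N) (lt_kn : (k < n)%N).
Local Notation r := (n - k)%N.
Implicit Types w : {ffun coordk n k -> int}.
Local Notation "'A' w" := (@arrT n k int 0%R w) (at level 10, w at level 9).

Lemma t_promote_inv_rect w : k_rectangle (t_promote_inv w) <-> k_rectangle w.
Proof.
split=> hw; last by apply: t_toggles_rect => // j; rewrite mem_rev.
by rewrite -(t_promote_invK w); apply: t_toggles_rect.
Qed.

Section Row.
Variables (w : {ffun coordk n k -> int}) (j a : nat).
Hypotheses (hw : k_rectangle w) (ltj : (0 < j < n)%N) (lta : (a < k)%N).

Local Notation u := (nth [::] ([::] :: tab_of w) a).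
Local Notation l := (nth [::] (tab_of w) a.+1).
Local Notation x := (nth [::] (tab_of w) a).

Lemma nth_tab_of b : (b < k)%N -> nth [::] (tab_of w) b = tab_row w b.
Proof. by move=> ltb; rewrite tab_ofE (nth_map 0%N) ?size_iota // nth_iota. Qed.

(** A letter j of row a has j + 1 below it exactly left of column A_{a+1,j+1}, and a letter j + 1
    has j above it exactly from column A_{a-1,j-1} on (row indices from 0). The free cells thus fill
    the interval in which the toggle reflects the entry. *)
Lemma bk_freeE c : bk_free j u x l c = (entry_lo w a j <= c%:Z < entry_hi w a j).
Proof.
have h1 := rect_mono hw lta; have h2 := rect_diag hw.
have j1 : (j.-1.+1 = j)%N by lia.
have ltj1 : (0 < j.+1 <= n)%N by lia.
have ltj0 : (0 < j <= n)%N by lia.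
have := entry_bounds k0 lt_kn hw lta ltj.
rewrite /bk_free !(nth_tab_of lta) !(nth_tab_row k0 lt_kn hw _ lta) //=.
have hA : A w a j.-1 <= A w a j by rewrite -{2}j1; apply: h1; lia.
have hB : A w a j <= A w a j.+1 by apply: h1; lia.
have -> : (nth 0%N l c == j.+1) = (a.+1 < k)%N && (A w a.+1 j <= c%:Z < A w a.+1 j.+1).
  case: ltnP => lta1; first by rewrite nth_tab_of // (nth_tab_row k0 lt_kn hw).
  by rewrite [nth [::] _ _]nth_default ?nth_nil // tab_ofE size_map size_iota.
have -> : (nth 0%N u c == j) = (0 < a)%N && (A w a.-1 j.-1 <= c%:Z < A w a.-1 j).
  case: (posnP a) => [->|a0]; first by rewrite /= nth_nil; case: (j) ltj.
  have lta1 : (a.-1 < k)%N by lia.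
  by rewrite -{1}(prednK a0) /= nth_tab_of // (nth_tab_row k0 lt_kn hw).
rewrite /entry_lo /entry_hi; set c' : int := c%:Z.
have hl : (a.+1 < k)%N -> A w a.+1 j <= A w a j.-1.
  by move=> lta1; rewrite -{1}j1; apply: h2; lia.
have hu : (0 < a)%N -> A w a j.+1 <= A w a.-1 j.
  by move=> a0; rewrite -{1}(prednK a0); apply: h2; lia.
move: hl hu; case: (posnP a) => a0; case: ltnP => lta1 /= hl hu hb; apply/idP/idP; lia.
Qed.

(** There are [entry_hi] - A free letters j + 1. Writing that many letters j from [entry_lo] on
    moves the boundary to [entry_lo] + [entry_hi] - A, the toggled entry. *)
Lemma bk_rowE : bk_row j u x l = tab_row (t_toggle j w) a.
Proof.
have hw' := t_toggle_rect k0 lt_kn hw ltj.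
have EN : t_toggle j w None = w None by rewrite ffunE.
have N0 := w_None_ge0 k0 lt_kn hw.
have hb : entry_lo w a j <= A w a j <= entry_hi w a j := entry_bounds k0 lt_kn hw lta ltj.
have /andP[hlo hhi] := hb.
have ltj1 : (0 < j.+1 <= n)%N by lia.
have ltj0 : (0 < j <= n)%N by lia.
have j1 : (j.-1.+1 = j)%N by lia.
have h0 : 0 <= A w a j.-1 by apply: (rect_ge0 hw) => //; lia.
have lo0 : A w a j.-1 <= entry_lo w a j by rewrite /entry_lo; case: ifP => _; rewrite ?le_max lexx.
have hi0 : entry_hi w a j <= A w a j.+1 by rewrite /entry_hi; case: ifP => _; rewrite ?ge_min lexx.
have EA m : A (t_toggle j w) a m = (if m == j then entry_lo w a j + entry_hi w a j - A w a j else A w a m)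
  := A_toggle k0 lt_kn m hw lta ltj.
have size_x : size x = `|w None|%N by rewrite nth_tab_of // size_tab_row.
have hiN : entry_hi w a j <= w None.
  by apply: (le_trans hi0); apply: A_le_None => //; lia.
rewrite /bk_row size_x; set beta := count _ _.
have Ebeta : beta = `|(entry_hi w a j - A w a j)%R|%N.
  have -> : beta = count (fun c => (`|A w a j| <= c < `|entry_hi w a j|)%N) (iota 0 `|w None|).
    apply: eq_count => c; rewrite bk_freeE nth_tab_of // (nth_tab_row k0 lt_kn hw) //=.
    by apply/idP/idP; lia.
  by rewrite count_interval; lia.
apply: (@eq_from_nth _ 0%N); first by rewrite size_mkseq size_tab_row // EN.
move=> c; rewrite size_mkseq => ltc; rewrite nth_mkseq // bk_freeE; apply/esym/eqP.
case: ifP => hfree.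
  have -> : count (bk_free j u x l) (iota 0 c) = (c - `|entry_lo w a j|)%N.
    rewrite (eq_count (a2 := fun c => (`|entry_lo w a j| <= c < `|entry_hi w a j|)%N)).
      by rewrite count_interval; lia.
    by move=> c'; rewrite bk_freeE; apply/idP/idP; lia.
  rewrite Ebeta; case: ltnP => hc; rewrite (nth_tab_row k0 lt_kn hw') // !EA eqxx.
    by rewrite (_ : (j.-1 == j) = false); lia.
  by rewrite (_ : (j.+1 == j) = false) /= ?eqxx; lia.
rewrite nth_tab_of //; set v := nth 0%N (tab_row w a) c.
have hv : (0 < v <= n)%N.
  have hs : all (fun m => (0 < m <= n)%N) (iota 1 n) by apply/allP => m; rewrite mem_iota; lia.
  have hc : (c < size (tab_row w a))%N by rewrite size_tab_row.
  exact: (allP (row_part_letters w a hs) _ (mem_nth 0%N hc)).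
have /eqP := erefl v; rewrite {1}/v (nth_tab_row k0 lt_kn hw) // (nth_tab_row k0 lt_kn hw') // !EA.
case: (v =P j) => [->|nj]; first by rewrite (_ : (j.-1 == j) = false); lia.
case: (v.-1 =P j) => [Ev|_ //].
have -> : v = j.+1 by lia.
by rewrite /=; lia.
Qed.

End Row.

Lemma bender_knuth_tab w j : k_rectangle w -> (0 < j < n)%N ->
  bender_knuth j (tab_of w) = tab_of (t_toggle j w).
Proof.
move=> hw ltj; rewrite /bender_knuth; have -> : size (tab_of w) = k by rewrite tab_ofE size_map size_iota.
rewrite [RHS]tab_ofE /mkseq; apply/eq_in_map => a; rewrite mem_iota => /andP[_ lta].
exact: bk_rowE.
Qed.

Lemma bender_knuth_tabs w s : k_rectangle w -> {subset s <= iota 1 n.-1} ->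
  foldr bender_knuth (tab_of w) s = tab_of (t_toggles w s).
Proof.
move=> hw; elim: s => //= j s IH sub.
have sub' : {subset s <= iota 1 n.-1} by move=> m ms; apply: sub; rewrite inE ms orbT.
rewrite IH // bender_knuth_tab //; first exact: t_toggles_rect.
by have := sub j (mem_head _ _); rewrite mem_iota; lia.
Qed.

Lemma promotion_tab w : k_rectangle w -> promotion n (tab_of w) = tab_of (t_promote w).
Proof. by move=> hw; apply: bender_knuth_tabs. Qed.

Lemma promotion_inv_tab w : k_rectangle w -> promotion_inv n (tab_of w) = tab_of (t_promote_inv w).
Proof. by move=> hw; apply: bender_knuth_tabs => // j; rewrite mem_rev. Qed.

End BenderKnuth.

Theorem theorem5p7 (R : realType) (n k : nat) (hn : (2 <= n)%N)
    (hk : (1 <= k <= n - 1)%N) (b : {ffun coordk n k -> int})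
    (hb : k_rectangle b) (i : 'I_n) :
  [/\ gamma_hat R i b = (gamma_tilde i b)%:Z,
      phi_hat R i b = - (phi_tilde i b)%:Z /\
      epsilon_hat R i b = - (epsilon_tilde i b)%:Z,
      (e_tilde i b <-> 0 <= f_hat R (e_hat R i 1 b)) /\
      (forall b', e_tilde i b = Some b' -> e_hat R i 1 b = b')
    & (f_tilde i b <-> 0 <= f_hat R (e_hat R i (-1) b)) /\
      (forall b', f_tilde i b = Some b' -> e_hat R i (-1) b = b')].
Proof.
have k0 : (0 < k)%N by lia.
have lt_kn : (k < n)%N by lia.
have n1 : (0 < 1 < n)%N by lia.
have lti := ltn_ord i.
have hp : k_rectangle (t_promote b) by apply: t_toggles_rect.
(* Assertions (3) and (4) both reduce to a dichotomy: the tropical image is a k-rectangle and the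
   tableau operator yields its tableau, or neither exists. *)
have crystal (v : {ffun coordk n k -> int}) (T : option tableau) :
    (k_rectangle v /\ T = Some (tab_of v)) \/ (~ k_rectangle v /\ T = None) ->
    (omap (rect_of n k) T <-> 0 <= f_hat R v) /\
    (forall b', omap (rect_of n k) T = Some b' -> v = b').
  rewrite f_hatE // decoration_rect //.
  by case=> -[hv ->]; split=> //= b' [<-]; rewrite rect_of_tab.
(* For i = 0 the dichotomy is transported along inverse promotion, which preserves and reflects
   k-rectangles. *)
have promoted (v : {ffun coordk n k -> int}) (T : option tableau) :
    (k_rectangle v /\ T = Some (tab_of v)) \/ (~ k_rectangle v /\ T = None) ->
    (k_rectangle (t_promote_inv v) /\ omap (promotion_inv n) T = Some (tab_of (t_promote_inv v)))
    \/ (~ k_rectangle (t_promote_inv v) /\ omap (promotion_inv n) T = None).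
  by rewrite t_promote_inv_rect // => -[] [hv ->]; [left|right]; rewrite /= ?promotion_inv_tab.
split.
- rewrite /gamma_tilde content_tab_of //; last by rewrite /rep1n; case: eqP => ?; lia.
  rewrite -t_gammaE //; last by rewrite /rep1n; case: eqP => ?; lia.
  rewrite /rep1n; case: eqP => [->|i0]; last by rewrite gamma_hatE //; lia.
  by rewrite gamma_hat0 // gamma_hatE //; lia.
- rewrite phi_hatE // epsilon_hatE // t_epsilonE // /phi_tilde /epsilon_tilde.
  rewrite /phi_tilde_tab /eps_tilde_tab /t_phi /rep1n.
  case: eqP => [->|/eqP i0].
    (* The contents of 1 and 2 after promotion are those of n and 1 before; they enter the weight
       identity that gives epsilon_0. *)
    have E1 : colsum (t_promote b) 1 = colsum b n - colsum b n.-1 + colsum b 0.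
      by apply: colsum_promote => //; lia.
    have E2 : colsum (t_promote b) 2 = colsum b n - colsum b n.-1 + colsum b 1.
      by apply: colsum_promote => //; lia.
    rewrite promotion_tab // eps_phi_tab // t_phi_sum_tab // E1 E2 /= !colsum0.
    by split=> //; lia.
  have lti0 : (0 < i < n)%N by rewrite lt0n i0.
  by rewrite eps_phi_tab // t_phi_sum_tab //; split=> //; lia.
- rewrite e_hatE // /e_tilde /e_tilde_tab /t_e; case: eqP => [_|/eqP i0]; apply: crystal.
    by apply: promoted; rewrite promotion_tab //; apply: e_tab_rect.
  by apply: e_tab_rect => //; rewrite lt0n i0.
rewrite e_hatE // /f_tilde /f_tilde_tab /t_e; case: eqP => [_|/eqP i0]; apply: crystal.
  by apply: promoted; rewrite promotion_tab //; apply: f_tab_rect.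
by apply: f_tab_rect => //; rewrite lt0n i0.
Qed.
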